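(* Let $k$ be a field and let $(X,\phi)$ be a translational dynamical system over $k$ with $X$ geometrically irreducible. Then $\operatorname{sadim}(X,\phi)\ge \dim X$.
   Context: A rational dynamical system $(X,\phi)$ over a field $k$ is an irreducible quasi-projective variety $X$ over $k$ together with a dominant rational map $\phi:X\dashrightarrow X$ over $k$. It induces the $k$-endomorphism $\phi^*:k(X)\to k(X)$, $\phi^*(f)=f\circ\phi$. The algebraic dimension $\operatorname{adim}(X,\phi)$ is the transcendence degree over $k$ of $\operatorname{Fix}(k(X),\phi^* )=\{f\in k(X):\phi^*(f)=f\}$. For $X$ geometrically irreducible, the stabilised algebraic dimension $\operatorname{sadim}(X,\phi)$ is the maximum of $\operatorname{adim}(X\times Y,\phi\times\psi)-\operatorname{adim}(Y,\psi)$ as $(Y,\psi)$ ranges over all irreducible rational dynamical systems over $k$. $(X,\phi)$ is called translational if there exist an algebraic group $G$ over $k$ and a faithful algebraic group action $\rho:G\times X\to X$ over $k$ such that $\phi=\rho(g,-)$ for some $g\in G(k)$. *)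

(* Defs.v *)
(* Classical (Weil-style) algebraic geometry: a variety over the
   field k is the set of its points with coordinates in an algebraically closed
   extension iota : k -> K, cut out by polynomials with coefficients in k.
   Reduced quasi-projective k-schemes and their k-morphisms are faithfully
   described in this way, whatever the choice of K.
   A point of P^(N-1)(K) is a nonzero row vector v : 'rV[K]_N, two vectors
   giving the same point when (v == w)%MS, i.e. when they span the same line. *)

From HB Require Import structures.
From mathcomp Require Import all_boot all_order all_algebra.
From mathcomp Require Import generic_quotient ring_quotient fraction.
From mathcomp Require Import boolp mpoly.

Set Implicit Arguments.
Unset Strict Implicit.
Unset Printing Implicit Defensive.

Import GRing.Theory.
Local Open Scope ring_scope.
Local Open Scope quotient_scope.

Definition is_max (P : nat -> Prop) (m : nat) : Prop :=
  P m /\ forall n, P n -> (n <= m)%N.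

(* The maximum of P; the value is 0 if there is none. *)
Definition natmax (P : nat -> Prop) : nat :=
  if pselect (exists m, is_max P m) is left h then projT1 (cid h) else 0%N.

Lemma natmaxE (P : nat -> Prop) (m : nat) : is_max P m -> natmax P = m.
Proof.
move=> [Pm Hm]; rewrite /natmax; case: pselect => [h|]; last by case; exists m.
case: (cid h) => n [Pn Hn] /=.
by apply/eqP; rewrite eqn_leq Hm ?Hn.
Qed.

Section TranscendenceDegree.
Variables (k L : fieldType) (j : k -> L).

Definition alg_indep (r : nat) (x : r.-tuple L) : Prop :=
  forall q : {mpoly k[r]}, mmap j (tnth x) q = 0 -> q = 0.

Definition trdeg (S : L -> Prop) : nat :=
  natmax (fun r => exists2 x : r.-tuple L,
            (forall i, S (tnth x i)) & alg_indep x).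

End TranscendenceDegree.

Section Evaluation.
Variables (F : fieldType) (K : fieldType) (j : {rmorphism F -> K}).

Definition ev (N : nat) (p : {mpoly F[N]}) (v : 'rV[K]_N) : K :=
  mmap j (fun i => v 0 i) p.

Definition evmap (N M : nat) (P : M.-tuple {mpoly F[N]}) (v : 'rV[K]_N) :
  'rV[K]_M := \row_i ev (tnth P i) v.

Lemma ev_comp (N M : nat) (p : {mpoly F[M]}) (P : M.-tuple {mpoly F[N]}) v :
  ev (p \mPo P) v = ev p (evmap P v).
Proof.
rewrite /ev comp_mpolyE raddf_sum /= [RHS]/mmap; apply: eq_bigr => m _.
rewrite mmapZ rmorph_prod; congr (_ * _); apply: eq_bigr => i _.
by rewrite rmorphXn mxE.
Qed.

Lemma evM N (p q : {mpoly F[N]}) v : ev (p * q) v = ev p v * ev q v.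
Proof. by rewrite /ev rmorphM. Qed.

Lemma evB N (p q : {mpoly F[N]}) v : ev (p - q) v = ev p v - ev q v.
Proof. exact: rmorphB. Qed.

Lemma ev_scale (N d : nat) (p : {mpoly F[N]}) c v :
  p \is d.-homog -> ev p (c *: v) = c ^+ d * ev p v.
Proof.
move=> /dhomogP hp; rewrite /ev /mmap mulr_sumr; apply: eq_big_seq => m hm.
have -> : d = (\sum_i m i)%N by rewrite -mdegE; apply/esym/hp.
rewrite mulrCA expr_sum /mmap1 -big_split /=; congr (_ * _).
by apply: eq_bigr => i _; rewrite mxE exprMn.
Qed.

End Evaluation.

Lemma dhomog_comp (R : comNzRingType) (N M d e : nat) (p : {mpoly R[M]})
    (P : M.-tuple {mpoly R[N]}) :
  p \is d.-homog -> (forall i, tnth P i \is e.-homog) ->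
  p \mPo P \is (d * e).-homog.
Proof.
move=> /dhomogP hp hP; rewrite comp_mpolyE big_seq.
apply: rpred_sum => m hm; apply: rpredZ.
have -> : (d * e = \sum_i e * m i)%N.
  by rewrite -big_distrr mulnC -mdegE; congr (_ * _)%N; apply/esym/hp.
elim/big_ind2: _ => [|a x b y|i _]; [exact: dhomog1 | exact: dhomogM |].
exact: dhomogMn.
Qed.

(* A quasi-projective variety over k, not necessarily irreducible: the points
   of the projective space with N homogeneous coordinates at which all the
   [qp_eqs] vanish but not all the [qp_neqs]. *)
Record qpvar (k : fieldType) (K : closedFieldType) (iota : {rmorphism k -> K}) :=
  QPVar {
    qp_N : nat;
    qp_eqs : seq {mpoly k[qp_N]};
    qp_neqs : seq {mpoly k[qp_N]};
    qp_homog : all (fun f => f \is homog mdeg) (qp_eqs ++ qp_neqs)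
  }.

Definition pts (k : fieldType) (K : closedFieldType)
    (iota : {rmorphism k -> K}) (X : qpvar iota) : {pred 'rV[K]_(qp_N X)} :=
  [pred v | [&& v != 0, all (fun f => ev iota f v == 0) (qp_eqs X)
              & has (fun f => ev iota f v != 0) (qp_neqs X)]].
Arguments pts {k K iota} X.

(* Zariski-closed subsets defined over a subfield j : F -> K. *)
Definition zclosed (F : fieldType) (K : closedFieldType)
    (j : {rmorphism F -> K}) (N : nat) (C : 'rV[K]_N -> Prop) : Prop :=
  exists2 fs : seq {mpoly F[N]}, all (fun f => f \is homog mdeg) fs
    & forall v, v != 0 -> C v <-> all (fun f => ev j f v == 0) fs.

(* Irreducibility of the base change of X to F, as a topological space. *)
Definition irreducible_over (k F : fieldType) (K : closedFieldType)
    (iota : {rmorphism k -> K}) (j : {rmorphism F -> K}) (X : qpvar iota) :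
    Prop :=
  (exists v, v \in pts X) /\
  forall C D : 'rV[K]_(qp_N X) -> Prop, zclosed j C -> zclosed j D ->
    (forall v, v \in pts X -> C v \/ D v) ->
    (forall v, v \in pts X -> C v) \/ (forall v, v \in pts X -> D v).

Definition irreducible (k : fieldType) (K : closedFieldType)
    (iota : {rmorphism k -> K}) (X : qpvar iota) : Prop :=
  irreducible_over iota X.

Definition geom_irreducible (k : fieldType) (K : closedFieldType)
    (iota : {rmorphism k -> K}) (X : qpvar iota) : Prop :=
  irreducible_over (idfun : {rmorphism K -> K}) X.

Record ivar (k : fieldType) (K : closedFieldType) (iota : {rmorphism k -> K}) :=
  IVar { iv_var :> qpvar iota; iv_irr : irreducible iv_var }.

Section FunctionField.
Variables (k : fieldType) (K : closedFieldType) (iota : {rmorphism k -> K}).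
Implicit Types X Y : qpvar iota.

Definition vanish X : pred {mpoly k[qp_N X]} :=
  fun p => `[< forall v, v \in pts X -> ev iota p v = 0 >].

Arguments vanish : clear implicits.

Lemma vanishP X p :
  reflect (forall v, v \in pts X -> ev iota p v = 0) (p \in vanish X).
Proof. exact: asboolP. Qed.

Lemma vanish_idealr X : (exists v, v \in pts X) -> idealr_closed (vanish X).
Proof.
move=> [v0 hv0]; split.
- by apply/vanishP => v _; rewrite /ev mmap0.
- apply/negP => /vanishP /(_ _ hv0) /eqP.
  by rewrite /ev rmorph1 oner_eq0.
- move=> a p q /vanishP hp /vanishP hq; apply/vanishP => v hv.
  by rewrite /ev mmapD -!/(ev iota _ v) evM hp // hq // mulr0 addr0.
Qed.

Lemma pts_scale X c v : c != 0 -> v \in pts X -> c *: v \in pts X.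
Proof.
move=> c0; have := qp_homog X; rewrite all_cat => /andP[/allP he /allP hn].
rewrite !inE.
case/and3P => v0 /allP h1 /hasP[f fn h2].
rewrite scalemx_eq0 negb_or c0 v0 /=; apply/andP; split.
  apply/allP => g gs; have /homogP[d hd] := he _ gs.
  by rewrite (ev_scale _ _ _ hd) (eqP (h1 _ gs)) mulr0.
apply/hasP; exists f => //; have /homogP[d hd] := hn _ fn.
by rewrite (ev_scale _ _ _ hd) mulf_neq0 ?expf_neq0.
Qed.

Lemma poly_eq0_pointwise (q : {poly K}) :
  (forall c, c != 0 -> q.[c] = 0) -> q = 0.
Proof.
move=> hq; apply/eqP/negPn/negP => q0.
have sz : size ('X * q + 1) != 1%N.
  have s1 : size ('X * q) = (size q).+1 by rewrite mulrC size_mulX.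
  by rewrite size_polyDl ?s1 ?size_poly1 ?ltnS ?lt0n ?eqSS size_poly_eq0.
have /closed_rootP[c] := sz; rewrite rootE !hornerE.
case: (eqVneq c 0) => [->|/hq ->]; rewrite ?mul0r ?mulr0 add0r ?oner_eq0 //.
Qed.

Definition slice N (p : {mpoly k[N]}) (v : 'rV[K]_N) : {poly K} :=
  \poly_(d < msize p) ev iota (pihomog mdeg d p) v.

Lemma pihomog_part N (p : {mpoly k[N]}) :
  p = \sum_(d < msize p) pihomog mdeg d p.
Proof. exact: pihomog_partitionE. Qed.

Lemma sliceE N (p : {mpoly k[N]}) v c : (slice p v).[c] = ev iota p (c *: v).
Proof.
rewrite horner_poly [in RHS](pihomog_part p) /ev raddf_sum /=.
apply: eq_bigr => d _; rewrite -!/(ev iota _ _).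
by rewrite (ev_scale _ _ _ (pihomogP _ _ _)) mulrC.
Qed.

Lemma slice_eq0 N (p : {mpoly k[N]}) v :
  slice p v = 0 -> forall d : 'I_(msize p), ev iota (pihomog mdeg d p) v = 0.
Proof.
by move=> /polyP h d; have := h d; rewrite coef_poly ltn_ord coef0.
Qed.

Lemma vanish_slices X (p : {mpoly k[qp_N X]}) :
  (forall d : 'I_(msize p), pihomog mdeg d p \in vanish X) -> p \in vanish X.
Proof.
move=> h; apply/vanishP => v hv; rewrite (pihomog_part p) /ev raddf_sum /=.
by apply: big1 => d _; have /vanishP := h d; apply.
Qed.

Lemma irreducible_form X (p q : {mpoly k[qp_N X]}) : irreducible X ->
  p \is homog mdeg -> q \is homog mdeg ->
  (forall v, v \in pts X -> ev iota p v = 0 \/ ev iota q v = 0) ->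
  p \in vanish X \/ q \in vanish X.
Proof.
move=> [_ hX] hp hq hpq.
have cl r : r \is homog mdeg ->
    zclosed iota (fun v : 'rV[K]_(qp_N X) => ev iota r v = 0).
  move=> hr; exists [:: r]; first by rewrite /= hr.
  by move=> v _; rewrite /= andbT; split=> [->|/eqP].
by case: (hX _ _ (cl p hp) (cl q hq) hpq) => h; [left|right]; apply/vanishP.
Qed.

Lemma vanish_prime X : irreducible X -> prime_idealr_closed (vanish X).
Proof.
move=> hX p q /vanishP hpq; apply/orP.
have hs v : v \in pts X -> slice p v = 0 \/ slice q v = 0.
  move=> hv.
  suff /eqP : slice p v * slice q v = 0.
    by rewrite mulf_eq0 => /orP[] /eqP; [left|right].
  apply: poly_eq0_pointwise => c c0; rewrite hornerM !sliceE -evM.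
  by apply: hpq; apply: pts_scale.
have hab (a : 'I_(msize p)) (b : 'I_(msize q)) :
    pihomog mdeg a p \in vanish X \/ pihomog mdeg b q \in vanish X.
  apply: irreducible_form => //; try by apply/homogE/pihomogP.
  by move=> v /hs[] /slice_eq0 h; [left|right].
have [ha|/existsNP[a ha]] :=
  pselect (forall a : 'I_(msize p), pihomog mdeg a p \in vanish X).
  by left; apply: vanish_slices.
by right; apply: vanish_slices => b; case: (hab a b).
Qed.

End FunctionField.
Arguments vanish {k K iota} X.

HB.instance Definition _ (k : fieldType) (K : closedFieldType)
    (iota : {rmorphism k -> K}) (X : ivar iota) :=
  isIdealr.Build {mpoly k[qp_N X]} (vanish X)
    (vanish_idealr (proj1 (iv_irr X))).

HB.instance Definition _ (k : fieldType) (K : closedFieldType)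
    (iota : {rmorphism k -> K}) (X : ivar iota) :=
  isPrimeIdealrClosed.Build {mpoly k[qp_N X]} (vanish X)
    (vanish_prime (iv_irr X)).

(* The homogeneous coordinate ring k[x_1, ..., x_N] / I(X). *)
Definition coordring (k : fieldType) (K : closedFieldType)
    (iota : {rmorphism k -> K}) (X : ivar iota) : Type :=
  {ideal_quot (vanish X : prime_idealr _)}.

Section CoordinateRing.
Variables (k : fieldType) (K : closedFieldType) (iota : {rmorphism k -> K}).
Variable X : ivar iota.

HB.instance Definition _ := GRing.ComNzRing.on (coordring X).

Definition coordring_unit : {pred coordring X} :=
  fun x => `[< exists y, y * x = 1 >].

Definition coordring_inv (x : coordring X) : coordring X :=
  if pselect (exists y, y * x = 1) is left h then projT1 (cid h) else x.

Lemma coordring_mulVx : {in coordring_unit, left_inverse 1 coordring_inv *%R}.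
Proof.
move=> x /asboolP hx; rewrite /coordring_inv; case: pselect => // h.
by case: (cid h).
Qed.

Lemma coordring_unitP (x y : coordring X) : y * x = 1 -> x \in coordring_unit.
Proof. by move=> h; apply/asboolP; exists y. Qed.

Lemma coordring_inv_out :
  {in [predC coordring_unit], coordring_inv =1 id}.
Proof.
move=> x; rewrite inE => hx; rewrite /coordring_inv; case: pselect => // h.
by case/negP: hx; apply/asboolP.
Qed.

HB.instance Definition _ := GRing.ComNzRing_hasMulInverse.Build (coordring X)
  coordring_mulVx coordring_unitP coordring_inv_out.

Lemma coordring_idomain : GRing.integral_domain_axiom (coordring X).
Proof. exact: Quotient.rquot_IdomainAxiom. Qed.

HB.instance Definition _ :=
  GRing.ComUnitRing_isIntegral.Build (coordring X) coordring_idomain.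

End CoordinateRing.

Section FunctionFieldDef.
Variables (k : fieldType) (K : closedFieldType) (iota : {rmorphism k -> K}).
Implicit Types X Y : ivar iota.

Definition fracring X : fieldType := {fraction (coordring X)}.

Definition frac_of X (p : {mpoly k[qp_N X]}) : fracring X :=
  tofrac (\pi_(coordring X) p : coordring X).
Arguments frac_of : clear implicits.

Definition frac_const X (c : k) : fracring X := frac_of X c%:MP.
Arguments frac_const : clear implicits.

(* k(X) is the subfield of degree 0 homogeneous fractions. *)
Definition funfield X (f : fracring X) : Prop :=
  exists d (A B : {mpoly k[qp_N X]}),
    [/\ A \is d.-homog, B \is d.-homog, B \notin vanish X
      & f = frac_of X A / frac_of X B].

(* The dimension of an irreducible variety is the transcendence degree of its
   function field. *)
Definition dim_var X : nat := trdeg (frac_const X) (@funfield X).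

(* A rational map from X to Y is given by forms of the same degree, which
   define it on a nonempty open subset of X. *)
Definition rational_map X Y (P : (qp_N Y).-tuple {mpoly k[qp_N X]}) : Prop :=
  (exists d, forall i, tnth P i \is d.-homog) /\
  exists H : {mpoly k[qp_N X]},
    [/\ H \is homog mdeg, H \notin vanish X
      & forall v, v \in pts X -> ev iota H v != 0 -> evmap iota P v \in pts Y].

(* The image is Zariski-dense in Y. *)
Definition dominant X Y (P : (qp_N Y).-tuple {mpoly k[qp_N X]}) : Prop :=
  forall C, zclosed iota C ->
    (forall v, v \in pts X -> evmap iota P v \in pts Y -> C (evmap iota P v)) ->
    forall w, w \in pts Y -> C w.

(* The graph of f |-> f \o phi on k(X), where phi is given by P. *)
Definition pullback X (P : (qp_N X).-tuple {mpoly k[qp_N X]})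
    (f g : fracring X) : Prop :=
  exists d (A B : {mpoly k[qp_N X]}),
    [/\ A \is d.-homog, B \is d.-homog, B \notin vanish X,
        f = frac_of X A / frac_of X B
      & g = frac_of X (A \mPo P) / frac_of X (B \mPo P)].

Lemma frac_of_eq0 X p : (frac_of X p == 0) = (p \in vanish X).
Proof.
rewrite /frac_of tofrac_eq0 -(rmorph0 (\pi_(coordring X))).
by rewrite -Quotient.idealrBE subr0.
Qed.

Lemma frac_ofM X p q : frac_of X (p * q) = frac_of X p * frac_of X q.
Proof. by rewrite /frac_of rmorphM /= tofracM. Qed.

Lemma frac_ofB X p q : frac_of X (p - q) = frac_of X p - frac_of X q.
Proof. by rewrite /frac_of rmorphB /= tofracB. Qed.

Lemma frac_eq X (A B A' B' : {mpoly k[qp_N X]}) :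
  B \notin vanish X -> B' \notin vanish X ->
  frac_of X A / frac_of X B = frac_of X A' / frac_of X B' <->
  A * B' - A' * B \in vanish X.
Proof.
rewrite -!frac_of_eq0 => hB hB'; rewrite frac_ofB !frac_ofM subr_eq0.
split=> [/eqP|h]; first by rewrite eqr_div // => /eqP ->.
by apply/eqP; rewrite eqr_div.
Qed.

Lemma vanish_comp X (P : (qp_N X).-tuple {mpoly k[qp_N X]}) A :
  rational_map P -> A \in vanish X -> A \mPo P \in vanish X.
Proof.
move=> [_ [H [_ hH hP]]] /vanishP hA.
suff : H * (A \mPo P) \in vanish X by rewrite prime_idealrM (negPf hH).
apply/vanishP => v hv; rewrite evM ev_comp.
have [->|h] := eqVneq (ev iota H v) 0; first by rewrite mul0r.
by rewrite hA ?mulr0 ?hP.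
Qed.

Lemma vanish_comp_dom X (P : (qp_N X).-tuple {mpoly k[qp_N X]}) B :
  dominant P -> B \is homog mdeg -> B \mPo P \in vanish X -> B \in vanish X.
Proof.
move=> hP hB /vanishP hv; apply/vanishP.
apply: (hP (fun w : 'rV[K]_(qp_N X) => ev iota B w = 0)).
  exists [:: B]; first by rewrite /= hB.
  by move=> v _; rewrite /= andbT; split=> [->|/eqP].
by move=> v hX _; rewrite -ev_comp hv.
Qed.

Lemma pullback_uniq X (P : (qp_N X).-tuple {mpoly k[qp_N X]}) f g g' :
  rational_map P -> dominant P ->
  pullback P f g -> pullback P f g' -> g = g'.
Proof.
move=> hP hd [d [A [B [hA hB vB -> ->]]]] [d' [A' [B' [hA' hB' vB']]]].
move=> /(frac_eq _ _ vB vB') h ->; apply/frac_eq.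
- by apply: contraNN vB; apply: vanish_comp_dom => //; apply: homogE hB.
- by apply: contraNN vB'; apply: vanish_comp_dom => //; apply: homogE hB'.
by rewrite -!rmorphM -rmorphB; apply: vanish_comp.
Qed.

Lemma pullback_total X (P : (qp_N X).-tuple {mpoly k[qp_N X]}) f :
  rational_map P -> dominant P -> funfield f ->
  exists2 g, funfield g & pullback P f g.
Proof.
move=> [[e he] _] hd [d [A [B [hA hB vB ->]]]].
exists (frac_of X (A \mPo P) / frac_of X (B \mPo P)); last by exists d, A, B.
exists (d * e)%N, (A \mPo P), (B \mPo P); split=> //; try exact: dhomog_comp.
by apply: contraNN vB; apply: vanish_comp_dom => //; apply: homogE hB.
Qed.

End FunctionFieldDef.

Arguments frac_of {k K iota} X p.
Arguments frac_const {k K iota} X c.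

Record rds (k : fieldType) (K : closedFieldType) (iota : {rmorphism k -> K}) :=
  RDS {
    rds_var :> ivar iota;
    rds_map : (qp_N rds_var).-tuple {mpoly k[qp_N rds_var]};
    rds_rational : rational_map rds_map;
    rds_dominant : dominant rds_map
  }.

Definition adim (k : fieldType) (K : closedFieldType)
    (iota : {rmorphism k -> K}) (S : rds iota) : nat :=
  trdeg (frac_const S) (fun f => pullback (rds_map S) f f).

Definition segre (K : fieldType) (N M : nat) (v : 'rV[K]_N) (w : 'rV[K]_M) :
  'rV[K]_(N * M) := mxvec (v^T *m w).

Section Product.
Variables (k : fieldType) (K : closedFieldType) (iota : {rmorphism k -> K}).
Implicit Types X Y : qpvar iota.

Section SegreEquations.
Variables N M : nat.

Definition zvar (i : 'I_N) (j : 'I_M) : {mpoly k[N * M]} :=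
  'X_(mxvec_index i j).

Definition zrow (i : 'I_N) : M.-tuple {mpoly k[N * M]} :=
  [tuple zvar i j | j < M].

Definition zcol (j : 'I_M) : N.-tuple {mpoly k[N * M]} :=
  [tuple zvar i j | i < N].

Definition segre_minors : seq {mpoly k[N * M]} :=
  [seq zvar a.1 b.1 * zvar a.2 b.2 - zvar a.1 b.2 * zvar a.2 b.1
     | a <- enum {: 'I_N * 'I_N}, b <- enum {: 'I_M * 'I_M}].

End SegreEquations.

Definition prod_eqs X Y : seq {mpoly k[qp_N X * qp_N Y]} :=
  segre_minors (qp_N X) (qp_N Y)
  ++ [seq f \mPo zcol (qp_N X) j | f <- qp_eqs X, j <- enum 'I_(qp_N Y)]
  ++ [seq g \mPo zrow (qp_N Y) i | g <- qp_eqs Y, i <- enum 'I_(qp_N X)].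

Definition prod_neqs X Y : seq {mpoly k[qp_N X * qp_N Y]} :=
  [seq p * q
     | p <- [seq f \mPo zcol (qp_N X) j
               | f <- qp_neqs X, j <- enum 'I_(qp_N Y)],
       q <- [seq g \mPo zrow (qp_N Y) i
               | g <- qp_neqs Y, i <- enum 'I_(qp_N X)]].

Lemma zvar_homog N M (i : 'I_N) (j : 'I_M) : zvar i j \is 1.-homog.
Proof. by rewrite dhomogX; apply/eqP/mdeg1. Qed.

Lemma zrow_homog N M (f : {mpoly k[M]}) (i : 'I_N) :
  f \is homog mdeg -> f \mPo zrow M i \is homog mdeg.
Proof.
move=> /homogP[d hd]; apply: (@homogE _ _ _ (d * 1)).
by apply: dhomog_comp => // a; rewrite tnth_mktuple zvar_homog.
Qed.

Lemma zcol_homog N M (f : {mpoly k[N]}) (j : 'I_M) :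
  f \is homog mdeg -> f \mPo zcol N j \is homog mdeg.
Proof.
move=> /homogP[d hd]; apply: (@homogE _ _ _ (d * 1)).
by apply: dhomog_comp => // a; rewrite tnth_mktuple zvar_homog.
Qed.

Lemma prod_homog X Y :
  all (fun f => f \is homog mdeg) (prod_eqs X Y ++ prod_neqs X Y).
Proof.
have := qp_homog X; rewrite all_cat => /andP[/allP eX /allP nX].
have := qp_homog Y; rewrite all_cat => /andP[/allP eY /allP nY].
rewrite !all_cat -!andbA; apply/and4P; split; apply/allP => h.
- case/allpairsP => -[a b] [_ _ ->] /=; apply: (@homogE _ _ _ (1 + 1)).
  by apply: rpredB; apply: dhomogM; apply: zvar_homog.
- by case/allpairsP => -[f j] /= [/eX hf _ ->]; apply: zcol_homog.
- by case/allpairsP => -[f j] /= [/eY hf _ ->]; apply: zrow_homog.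
case/allpairsP => -[p q] /= [/allpairsP[[f j] /= [/nX hf _ ->]]].
case/allpairsP=> -[g i] /= [/nY hg _ ->] ->.
have /homogP[d hd] := zcol_homog j hf; have /homogP[e he] := zrow_homog i hg.
by apply/homogP; exists (d + e)%N; apply: dhomogM.
Qed.

(* X x Y, Segre-embedded; see prod_pts for its points. *)
Definition prodv X Y : qpvar iota := QPVar iota (prod_homog X Y).

Lemma ev_zvar N M (i : 'I_N) (j : 'I_M) (u : 'rV[K]_(N * M)) :
  ev iota (zvar i j) u = vec_mx u i j.
Proof. by rewrite /ev mmapX mmap1U mxE. Qed.

Lemma evmap_zrow N M (i : 'I_N) (u : 'rV[K]_(N * M)) :
  evmap iota (zrow M i) u = row i (vec_mx u).
Proof. by apply/rowP => j; rewrite mxE tnth_mktuple ev_zvar !mxE. Qed.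

Lemma evmap_zcol N M (j : 'I_M) (u : 'rV[K]_(N * M)) :
  evmap iota (zcol N j) u = (col j (vec_mx u))^T.
Proof. by apply/rowP => i; rewrite mxE tnth_mktuple ev_zvar !mxE. Qed.

Lemma ev_eq0_scale N (f : {mpoly k[N]}) c (v : 'rV[K]_N) :
  f \is homog mdeg -> c != 0 -> (ev iota f (c *: v) == 0) = (ev iota f v == 0).
Proof.
move=> /homogP[d hd] c0.
by rewrite (ev_scale _ _ _ hd) mulf_eq0 expf_eq0 (negPf c0) andbF.
Qed.

Lemma row_segre N M (v : 'rV[K]_N) (w : 'rV[K]_M) i :
  row i (vec_mx (segre v w)) = v 0 i *: w.
Proof. by apply/rowP => j; rewrite mxvecK !mxE big_ord1 !mxE. Qed.

Lemma col_segre N M (v : 'rV[K]_N) (w : 'rV[K]_M) j :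
  (col j (vec_mx (segre v w)))^T = w 0 j *: v.
Proof. by apply/rowP => i; rewrite mxvecK !mxE big_ord1 !mxE mulrC. Qed.

Lemma ev_scale_neq0 N (f : {mpoly k[N]}) c (v : 'rV[K]_N) :
  f \is homog mdeg -> ev iota f (c *: v) != 0 -> ev iota f v != 0.
Proof.
move=> /homogP[d hd]; rewrite (ev_scale _ _ _ hd).
by apply: contraNN => /eqP ->; rewrite mulr0.
Qed.

Lemma ev_scale_eq0 N (f : {mpoly k[N]}) c (v : 'rV[K]_N) :
  f \is homog mdeg -> ev iota f v == 0 -> ev iota f (c *: v) == 0.
Proof.
by move=> /homogP[d hd] /eqP h; rewrite (ev_scale _ _ _ hd) h mulr0.
Qed.

Lemma prod_pts X Y u :
  u \in pts (prodv X Y) <->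
  exists v w, [/\ v \in pts X, w \in pts Y & u = segre v w].
Proof.
have := qp_homog X; rewrite all_cat => /andP[/allP eX /allP nX].
have := qp_homog Y; rewrite all_cat => /andP[/allP eY /allP nY].
rewrite !inE /= /prod_eqs !all_cat; split.
  case/and3P => u0 /and3P[/allP hm /allP hX /allP hY] /hasP[h].
  case/allpairsP=> -[p q] /= [/allpairsP[[f j] /= [fn _ ->]]].
  case/allpairsP=> -[g i] /= [gn _ ->] -> {h}.
  rewrite evM !ev_comp evmap_zcol evmap_zrow mulf_eq0 negb_or => /andP[hf hg].
  have /matrix0Pn[a [b ab0]] : vec_mx u != 0 by rewrite vec_mx_eq0.
  pose v : 'rV[K]_(qp_N X) := (col b (vec_mx u))^T.
  pose w : 'rV[K]_(qp_N Y) := (vec_mx u a b)^-1 *: row a (vec_mx u).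
  have uE : u = segre v w.
    apply: (can_inj vec_mxK); rewrite mxvecK; apply/matrixP => r s.
    have : zvar r s * zvar a b - zvar r b * zvar a s
             \in segre_minors (qp_N X) (qp_N Y).
      by apply/allpairsP; exists ((r, a), (s, b)); rewrite !mem_enum.
    move=> /hm; rewrite evB !evM !ev_zvar subr_eq0 => /eqP E.
    rewrite [RHS]mxE big_ord1; apply: (mulIf ab0); rewrite E !mxE -!mulrA.
    by congr (_ * _); rewrite mulrCA mulVf ?mulr1 //; rewrite mxE in ab0.
  have ha : v 0 a != 0 by rewrite mxE [col _ _ _ _]mxE.
  have hb : w 0 b != 0 by rewrite mxE [row _ _ _ _]mxE mulVf ?oner_eq0.
  have v0 : v != 0 by apply/eqP => E; rewrite E mxE eqxx in ha.
  have w0 : w != 0 by apply/eqP => E; rewrite E mxE eqxx in hb.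
  exists v, w; split=> //; rewrite inE.
    rewrite v0 /=; apply/andP; split.
      apply/allP => r rX; have : r \mPo zcol (qp_N X) b \in
          [seq f \mPo zcol (qp_N X) j | f <- qp_eqs X, j <- enum 'I_(qp_N Y)].
        by apply/allpairsP; exists (r, b); rewrite mem_enum.
      by move=> /hX; rewrite ev_comp evmap_zcol.
    apply/hasP; exists f => //; move: hf; rewrite uE col_segre.
    exact/ev_scale_neq0/nX.
  rewrite w0 /=; apply/andP; split.
    apply/allP => r rY; have : r \mPo zrow (qp_N Y) a \in
        [seq g \mPo zrow (qp_N Y) i | g <- qp_eqs Y, i <- enum 'I_(qp_N X)].
      by apply/allpairsP; exists (r, a); rewrite mem_enum.
    move=> /hY; rewrite ev_comp evmap_zrow => h.
    exact/ev_scale_eq0/h/eY.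
  apply/hasP; exists g => //; move: hg; rewrite uE row_segre.
  exact/ev_scale_neq0/nY.
case=> v [w [/and3P[v0 /allP hv /hasP[f fX hf]] /and3P[w0 /allP hw]]].
move=> /hasP[g gY hg] ->.
have /rV0Pn[a ha] := v0; have /rV0Pn[b hb] := w0.
apply/and3P; split; last first.
- apply/hasP; exists ((f \mPo zcol (qp_N X) b) * (g \mPo zrow (qp_N Y) a)).
    apply/allpairsP; exists (f \mPo zcol (qp_N X) b, g \mPo zrow (qp_N Y) a).
    split=> //=; apply/allpairsP; first by exists (f, b); rewrite mem_enum.
    by exists (g, a); rewrite mem_enum.
  rewrite evM !ev_comp evmap_zcol evmap_zrow row_segre col_segre.
  rewrite mulf_eq0 negb_or !ev_eq0_scale ?hf ?hg //; [exact: nY | exact: nX].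
- apply/and3P; split; apply/allP => h /allpairsP.
  + case=> -[[i i'] [j j']] /= [_ _ ->].
    rewrite evB !evM !ev_zvar !mxvecK !mxE !big_ord1 !mxE subr_eq0.
    by rewrite mulrACA [w 0 j * _]mulrC mulrACA.
  + case=> -[r j] /= [rX _ ->]; rewrite ev_comp evmap_zcol col_segre.
    by apply: ev_scale_eq0; [exact: eX | exact: hv].
  case=> -[r j] /= [rY _ ->]; rewrite ev_comp evmap_zrow row_segre.
  by apply: ev_scale_eq0; [exact: eY | exact: hw].
apply/eqP => E; have := congr1 (fun x => vec_mx x a b) E.
rewrite mxvecK !mxE big_ord1 !mxE => /eqP.
by rewrite mulf_eq0 (negPf ha) (negPf hb).
Qed.

End Product.

(* The system (S x T, phi x psi): phi x psi is given by forms in the Segre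
   coordinates.  Those are not unique, but the rational map they define is, and
   for S geometrically irreducible it exists.  It is irreducible and dominant. *)
Record prod_rds (k : fieldType) (K : closedFieldType)
    (iota : {rmorphism k -> K}) (S T : rds iota) :=
  ProdRDS {
    pr_irr : irreducible (prodv S T);
    pr_var := IVar pr_irr;
    pr_map : (qp_N pr_var).-tuple {mpoly k[qp_N pr_var]};
    pr_rational : @rational_map _ _ _ pr_var pr_var pr_map;
    pr_dominant : @dominant _ _ _ pr_var pr_var pr_map;
    pr_mapE : forall v w, v \in pts S -> w \in pts T ->
      evmap iota (rds_map S) v != 0 -> evmap iota (rds_map T) w != 0 ->
      evmap iota pr_map (segre v w) != 0 ->
      (evmap iota pr_map (segre v w) ==
       segre (evmap iota (rds_map S) v) (evmap iota (rds_map T) w))%MS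
  }.

Definition rds_of_prod (k : fieldType) (K : closedFieldType)
    (iota : {rmorphism k -> K}) (S T : rds iota) (Z : prod_rds S T) : rds iota :=
  RDS (@pr_rational _ _ _ _ _ Z) (@pr_dominant _ _ _ _ _ Z).

(* The truncated subtraction is harmless: adim T <= adim (S x T). *)
Definition sadim (k : fieldType) (K : closedFieldType)
    (iota : {rmorphism k -> K}) (S : rds iota) : nat :=
  natmax (fun s => exists (T : rds iota) (Z : prod_rds S T),
            s = (adim (rds_of_prod Z) - adim T)%N).

(* Morphisms of varieties over k: locally given by forms of the same degree. *)
Definition var_morphism (k : fieldType) (K : closedFieldType)
    (iota : {rmorphism k -> K}) (X Y : qpvar iota)
    (f : 'rV[K]_(qp_N X) -> 'rV[K]_(qp_N Y)) : Prop :=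
  forall v, v \in pts X ->
    f v \in pts Y /\
    exists P : (qp_N Y).-tuple {mpoly k[qp_N X]},
      [/\ exists d, forall i, tnth P i \is d.-homog,
          evmap iota P v != 0
        & forall w, w \in pts X -> evmap iota P w != 0 ->
            (f w == evmap iota P w)%MS].

(* Group varieties over k; the unit is a k-rational point. *)
Record alg_group (k : fieldType) (K : closedFieldType)
    (iota : {rmorphism k -> K}) :=
  AlgGroup {
    ag_var :> qpvar iota;
    ag_prod : 'rV[K]_(qp_N (prodv ag_var ag_var)) -> 'rV[K]_(qp_N ag_var);
    ag_inv : 'rV[K]_(qp_N ag_var) -> 'rV[K]_(qp_N ag_var);
    ag_one : 'rV[k]_(qp_N ag_var);
    ag_mul := fun a b => ag_prod (segre a b);
    ag_unit := map_mx iota ag_one;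
    ag_prod_morph : @var_morphism _ _ _ (prodv ag_var ag_var) ag_var ag_prod;
    ag_inv_morph : @var_morphism _ _ _ ag_var ag_var ag_inv;
    ag_unit_pts : ag_unit \in pts ag_var;
    ag_mulA : forall a b c,
      a \in pts ag_var -> b \in pts ag_var -> c \in pts ag_var ->
      (ag_mul a (ag_mul b c) == ag_mul (ag_mul a b) c)%MS;
    ag_mul1g : forall a, a \in pts ag_var -> (ag_mul ag_unit a == a)%MS;
    ag_mulg1 : forall a, a \in pts ag_var -> (ag_mul a ag_unit == a)%MS;
    ag_mulVg : forall a, a \in pts ag_var -> (ag_mul (ag_inv a) a == ag_unit)%MS;
    ag_mulgV : forall a, a \in pts ag_var -> (ag_mul a (ag_inv a) == ag_unit)%MS
  }.

Section Actions.
Variables (k : fieldType) (K : closedFieldType) (iota : {rmorphism k -> K}).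
Variables (G : alg_group iota) (X : qpvar iota).
Variable rho : 'rV[K]_(qp_N (prodv G X)) -> 'rV[K]_(qp_N X).

Definition group_action : Prop :=
  [/\ @var_morphism _ _ _ (prodv G X) X rho,
      forall x, x \in pts X -> (rho (segre (ag_unit G) x) == x)%MS
    & forall a b x, a \in pts G -> b \in pts G -> x \in pts X ->
        (rho (segre (ag_mul a b) x) == rho (segre a (rho (segre b x))))%MS].

Definition faithful_action : Prop :=
  forall a, a \in pts G ->
    (forall x, x \in pts X -> (rho (segre a x) == x)%MS) ->
    (a == ag_unit G)%MS.

End Actions.

(* Faithfulness is tested on K-points, as befits (reduced) group varieties: only
   the unit acts trivially.  g0 : 'rV[k]_N represents an
   element of G(k). *)
Definition translational (k : fieldType) (K : closedFieldType)
    (iota : {rmorphism k -> K}) (S : rds iota) : Prop :=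
  exists (G : alg_group iota)
         (rho : 'rV[K]_(qp_N (prodv G S)) -> 'rV[K]_(qp_N S))
         (g0 : 'rV[k]_(qp_N G)),
    [/\ group_action rho, faithful_action rho, map_mx iota g0 \in pts G
      & forall x, x \in pts S -> evmap iota (rds_map S) x != 0 ->
          (evmap iota (rds_map S) x == rho (segre (map_mx iota g0) x))%MS].

(* Main.v *)
(** Let d = dim S and let S^m be the m-fold product of S with itself, a system by
    the diagonal map. All iterates of S^m are translations by the powers of the
    same k-point g of G, so they are obtained by specialising finitely many
    families of rational functions whose parameters are the homogeneous
    coordinates of G. By a Casorati-type argument, elements of k(S^m) that are
    algebraically independent over the fixed field stay independent along the
    whole orbit, so there are at most N_G of them, N_G being the number of those
    coordinates. Hence adim(S^m) >= m d - N_G for all m, and one of the increments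
    adim(S x S^m) - adim(S^m) is at least d. This bypasses Rosenlicht's theorem and
    works whether or not G is connected. On the other hand, fixed functions of
    S x T that are algebraically independent over the fixed functions of T are so
    over k(T), hence all increments are bounded and the maximum defining sadim is
    attained. *)

Require Import Defs.
From HB Require Import structures.
From mathcomp Require Import all_boot all_order all_algebra.
From mathcomp Require Import generic_quotient fraction.
From mathcomp Require Import boolp mpoly ring.

Set Implicit Arguments.
Unset Strict Implicit.
Unset Printing Implicit Defensive.

Import GRing.Theory.
Local Open Scope ring_scope.
Local Notation wid := (widen_ord (leqnSn _)).

(** * Subfields, algebraic closure and exchange *)

(** The deficit N_G does not depend on m, because the diagonal map on S^m still comes from the same
    element of G; this is why powers of S are used. The obstacle is that the action is given by
    forms only locally, and the form that works at the n-th power of g may change with n. So an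
    orbit follows not one rational family but a finite list of them, and the Casorati argument is
    applied to a product of relations, one for each way of choosing from the lists. Moreover k may
    be finite, and K may be algebraic over k, so that K need not contain a generic point of S.
    Independence in k(S x T) is therefore proved by specialisation: independent functions take
    almost all systems of values in K, and a pair of points is a point of the product. All counts
    use one exchange argument in which the base field is a parameter: the ground field, the fixed
    field and k(T) take this role in turn. *)

Section Subfields.
Variable L : fieldType.
Implicit Types (S T P : L -> Prop) (x y : L).

(** A predicate rather than a type, because the base field changes constantly inside one fixed [L].
    As x / 0 = 0 here, closure under division carries no side condition. *)
Record subfield := Subfield {
  sf_mem :> L -> Prop;
  sf_1 : sf_mem 1;
  sf_B : forall x y, sf_mem x -> sf_mem y -> sf_mem (x - y);
  sf_div : forall x y, sf_mem x -> sf_mem y -> sf_mem (x / y)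
}.

Definition sf_pred (F : subfield) : {pred L} := fun x => `[< F x >].

Lemma sf_predP (F : subfield) x : reflect (F x) (x \in sf_pred F).
Proof. exact: asboolP. Qed.

Lemma sf_divring (F : subfield) : divring_closed (sf_pred F).
Proof.
split; first by apply/sf_predP/sf_1.
  by move=> x y /sf_predP hx /sf_predP hy; apply/sf_predP/sf_B.
by move=> x y /sf_predP hx /sf_predP hy; apply/sf_predP/sf_div.
Qed.

HB.instance Definition _ (F : subfield) :=
  GRing.isDivringClosed.Build L (sf_pred F) (sf_divring F).

Record sf (F : subfield) := MkSF { sf_val : L; sf_valP : sf_val \in sf_pred F }.

HB.instance Definition _ (F : subfield) := [isSub for @sf_val F].
HB.instance Definition _ (F : subfield) := [Choice of sf F by <:].
HB.instance Definition _ (F : subfield) :=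
  [SubChoice_isSubIntegralDomain of sf F by <:].
HB.instance Definition _ (F : subfield) :=
  [SubIntegralDomain_isSubField of sf F by <:].

End Subfields.
Definition sfv (L : fieldType) (F : subfield L) : sf F -> L := val.
HB.instance Definition _ (L : fieldType) (F : subfield L) :=
  GRing.RMorphism.on (@sfv L F).
Arguments sfv {L} F.

Section Closure.
Variable L : fieldType.
Implicit Types (S T P : L -> Prop) (F : subfield L) (x y z : L) (s u w : seq L).

Lemma sfvP F (x : sf F) : F (sfv F x).
Proof. by case: x => x hx; apply/sf_predP. Qed.

Lemma sf_lift F x : F x -> exists y : sf F, sfv F y = x.
Proof. by move=> Fx; have hx := introT (sf_predP F x) Fx; exists (MkSF hx). Qed.

Lemma sfv_inj F : injective (sfv F).
Proof. exact: val_inj. Qed.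

Lemma sf_poly_lift F (p : {poly L}) : p \is a polyOver (sf_pred F) ->
  exists q : {poly sf F}, map_poly (sfv F) q = p.
Proof.
move=> /polyOverP h.
have {}h i : exists y : sf F, sfv F y = p`_i by apply: sf_lift; apply/sf_predP.
have [f hf] := choice h.
exists (\poly_(i < size p) f i); apply/polyP => i.
by rewrite coef_map /= coef_poly; case: ltnP => hi; rewrite ?hf // rmorph0 nth_default.
Qed.

Lemma sf_map_over F (p : {poly sf F}) : map_poly (sfv F) p \is a polyOver (sf_pred F).
Proof. by apply/polyOverP => i; rewrite coef_map; apply/sf_predP/sfvP. Qed.

Lemma sf_0 F : F 0.
Proof. by rewrite -(subrr 1); apply: sf_B; apply: sf_1. Qed.

(** Intersection of all subfields containing [S]. Membership is used by instantiating it at a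
    suitable subfield, which amounts to induction on generators. *)
Definition gen S : subfield L.
refine (@Subfield L (fun x => forall F, (forall y, S y -> F y) -> F x) _ _ _).
- by move=> F _; apply: sf_1.
- by move=> x y hx hy F hF; apply: sf_B; [apply: hx | apply: hy].
- by move=> x y hx hy F hF; apply: sf_div; [apply: hx | apply: hy].
Defined.

Lemma gen_sub S x : S x -> gen S x.
Proof. by move=> hx F; apply. Qed.

Lemma gen_min S F : (forall x, S x -> F x) -> forall x, gen S x -> F x.
Proof. by move=> h x; apply. Qed.

Lemma gen_mono S T : (forall x, S x -> gen T x) -> forall x, gen S x -> gen T x.
Proof. exact: gen_min. Qed.

Definition cl S x : Prop := algebraicOver (sfv (gen S)) x.

Lemma clP S x :
  cl S x <-> exists p : {poly L}, [/\ p != 0, p \is a polyOver (sf_pred (gen S)) & root p x].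
Proof.
split=> [[p p0 px]|[p [p0 hp px]]].
  by exists (map_poly (sfv _) p); split; rewrite ?map_poly_eq0 ?sf_map_over.
have [q e] := sf_poly_lift hp; exists q; last by rewrite e.
by rewrite -(map_poly_eq0 (sfv (gen S))) e.
Qed.

Definition cl_sf S : subfield L.
refine (@Subfield L (cl S) _ _ _).
- exact: algebraic1.
- exact: algebraic_sub.
- exact: algebraic_div.
Defined.

Lemma gen_cl S x : gen S x -> cl S x.
Proof. by move=> /sf_lift[y <-]; apply: algebraic_id. Qed.

Lemma cl_sub S x : S x -> cl S x.
Proof. by move=> /gen_sub/gen_cl. Qed.

(** Transitivity of algebraic extensions: the coefficients of [p] lie in [cl_sf T], and over a field
    integral and algebraic elements agree. *)
Lemma cl_min S T : (forall x, S x -> cl T x) -> forall x, cl S x -> cl T x.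
Proof.
move=> h x /clP[p [p0 /polyOverP hp px]].
apply/integral_algebraic/(integral_root p0 px) => c /(nthP 0)[i _ <-].
apply/integral_algebraic; have /sf_predP := hp i.
exact: (@gen_min S (cl_sf T)).
Qed.

Definition adj S s : L -> Prop := fun x => S x \/ x \in s.

Lemma gen_adj1_frac S x z : gen (adj S [:: x]) z -> exists a b : {poly L},
  [/\ a \is a polyOver (sf_pred (gen S)), b \is a polyOver (sf_pred (gen S)),
      b.[x] != 0 & z = a.[x] / b.[x]].
Proof.
move=> h; pose P z := exists a b : {poly L},
  [/\ a \is a polyOver (sf_pred (gen S)), b \is a polyOver (sf_pred (gen S)),
      b.[x] != 0 & z = a.[x] / b.[x]].
have P1 : P 1 by exists 1, 1; rewrite !rpred1 hornerE oner_eq0 divr1.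
have PB a b : P a -> P b -> P (a - b).
  move=> [a1 [b1 [ha1 hb1 n1 ->]]] [a2 [b2 [ha2 hb2 n2 ->]]].
  exists (a1 * b2 - a2 * b1), (b1 * b2).
  by rewrite rpredB ?rpredM // !hornerE mulf_neq0 // -mulNr addf_div // mulNr.
have Pd a b : P a -> P b -> P (a / b).
  move=> [a1 [b1 [ha1 hb1 n1 ->]]] [a2 [b2 [ha2 hb2 n2 ->]]].
  have [e|ne] := eqVneq a2.[x] 0.
    exists 0, 1; rewrite rpred0 rpred1 !hornerE oner_eq0 e.
    by rewrite mul0r invr0 mulr0 ?mul0r.
  exists (a1 * b2), (b1 * a2).
  by rewrite !rpredM // !hornerE mulf_neq0 // invf_div mulf_div.
apply: (@gen_min _ (Subfield P1 PB Pd) _ z h) => y /= [hy|].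
  exists y%:P, 1; rewrite rpred1 !hornerE oner_eq0 divr1 polyOverC; split=> //.
  exact/sf_predP/gen_sub.
by rewrite inE => /eqP ->; exists 'X, 1; rewrite polyOverX rpred1 !hornerE oner_eq0 divr1.
Qed.

Lemma common_denominator (A : comNzRingType) (U : {pred A}) (ev : A -> L)
    (n : nat) (c : nat -> L) :
  mulr_closed U -> ev 1 = 1 -> {morph ev : x y / x * y} ->
  (forall i, exists a b, [/\ a \in U, b \in U, ev b != 0 & c i = ev a / ev b]) ->
  exists (d : A) (q : nat -> A),
    [/\ ev d != 0, d \in U, forall i, q i \in U
      & forall i, (i < n)%N -> ev (q i) = ev d * c i].
Proof.
move=> [U1 UM] ev1 evM h; elim: n => [|n [d [q [d0 hd hq hdq]]]].
  by exists 1, (fun=> 1); rewrite ev1 oner_eq0.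
have [a [b [ha hb b0 hc]]] := h n.
exists (d * b), (fun i => if (i < n)%N then q i * b else d * a); split.
- by rewrite evM mulf_neq0.
- exact: UM.
- by move=> i; case: ifP => _; apply: UM.
move=> i hi; case: ifP => lt_in; first by rewrite !evM hdq // mulrAC.
have -> : i = n by apply/eqP; rewrite eqn_leq -ltnS hi leqNgt lt_in.
by rewrite !evM hc -mulrA [ev b * _]mulrC divfK.
Qed.

(** Clearing denominators turns the equation of [y] over the field generated by [S] and [x] into a
    relation in two variables, which is then read as an equation for [x]. *)
Lemma cl_gen_exchange S x y :
  cl (adj S [:: x]) y -> ~ cl S y -> cl (adj S [:: y]) x.
Proof.
move=> /clP[p [p0 /polyOverP hp /eqP py]] nSy.
have hfr i : exists a b : {poly L}, [/\ a \in polyOver (sf_pred (gen S)),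
    b \in polyOver (sf_pred (gen S)), b.[x] != 0 & p`_i = a.[x] / b.[x]].
  by have /sf_predP/gen_adj1_frac := hp i.
have Uc : mulr_closed (polyOver (sf_pred (gen S))).
  by split; [apply: rpred1 | apply: rpredM].
have [d [q [d0 _ hq hdq]]] := @common_denominator {poly L} _ (horner_eval x)
  (size p) (nth 0 p) Uc (rmorph1 _) (rmorphM _) hfr.
pose r := \sum_(i < size p) q i * (y ^+ i)%:P.
have gy : gen (adj S [:: y]) y by apply: gen_sub; right; rewrite inE.
apply/clP; exists r; split.
(* If [r] vanished identically, each of its coefficients in [x] would be a relation for [y] over
   [gen S], and a nonzero one exists. *)
- apply/eqP => r0; case/eqP: p0; apply/polyP => i; rewrite coef0.
  have [hi|hi] := ltnP i (size p); last by rewrite nth_default.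
  suff qi0 : q i = 0.
    apply/eqP; have /eqP := hdq i hi; rewrite qi0 rmorph0 eq_sym mulf_eq0.
    by rewrite (negPf d0).
  apply/polyP => j; rewrite coef0; apply/eqP/negPn/negP => qij.
  apply: nSy; apply/clP; exists (\poly_(l < size p) (q l)`_j); split.
  + apply/negP => /eqP/polyP/(_ i); rewrite coef_poly hi coef0 => /eqP.
    by rewrite (negPf qij).
  + apply/polyOverP => l; rewrite coef_poly; case: ifP => _; last exact: rpred0.
    exact: (polyOverP (hq l)).
  rewrite rootE horner_poly; apply/eqP; have /polyP/(_ j) := r0.
  rewrite coef_sum coef0 => e; apply: etrans e.
  by apply: eq_bigr => l _; rewrite coefMC.
- apply: rpred_sum => i _; apply: rpredM.
    apply/polyOverP => j; apply/sf_predP; have /polyOverP/(_ j)/sf_predP := hq i.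
    by apply: gen_mono => z hz; apply: gen_sub; left.
  by rewrite polyOverC rpredX //; apply/sf_predP.
rewrite rootE horner_sum; have /eqP := py; rewrite horner_coef => /eqP e.
rewrite (eq_bigr (fun i : 'I_(size p) => d.[x] * (p`_i * y ^+ i))).
  by rewrite -mulr_sumr e mulr0.
by move=> i _; rewrite hornerM hornerC [(q i).[x]]hdq // mulrA.
Qed.

(** Sequential form of algebraic independence, tied to the polynomial form by [aind_chain]; the
    exchange arguments are inductions on it. *)
Fixpoint chain S s : Prop :=
  if s is x :: s' then ~ cl S x /\ chain (adj S [:: x]) s' else True.

Lemma cl_mono S T : (forall x, S x -> T x) -> forall x, cl S x -> cl T x.
Proof. by move=> h; apply: cl_min => x /h /cl_sub. Qed.

Lemma chain_rcons S s x : chain S (rcons s x) <-> chain S s /\ ~ cl (adj S s) x.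
Proof.
elim: s S => [|y s IH] S /=.
  split=> [[h _]|[_ h]]; split=> //; apply: contra_not h; apply: cl_mono => z.
    by case.
  by left.
rewrite IH; have E : cl (adj (adj S [:: y]) s) x <-> cl (adj S (y :: s)) x.
  split; apply: cl_mono => z.
    move=> [[h|]|h]; [by left | by rewrite inE => h; right; rewrite inE h |].
    by right; rewrite inE h orbT.
  move=> [h|]; first by left; left.
  by rewrite inE => /orP[h|h]; [left; right; rewrite inE | right].
by split=> [[? [? ?]]|[[? ?] ?]]; split=> //; try split=> //; apply/E.
Qed.

(** Take the shortest prefix of [w] over which [x] is algebraic: its last element [z] is the one
    that [x] can replace. *)
Lemma cl_split S w x : cl (adj S w) x -> ~ cl S x ->
  exists w1 z w2, [/\ w = w1 ++ z :: w2, cl (adj S (rcons w1 z)) x & ~ cl (adj S w1) x].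
Proof.
elim/last_ind: w => [|w z IH] h nS.
  by case: nS; apply: cl_mono h => y; case.
have [hw|hw] := pselect (cl (adj S w) x); last by exists w, z, [::]; rewrite cats1.
have [w1 [z' [w2 [-> h1 h2]]]] := IH hw nS.
by exists w1, z', (rcons w2 z); rewrite rcons_cat.
Qed.

(** The element [x] joins the base and replaces [z], so that both lists lose one element; hence [S]
    is generalised in the induction. *)
Lemma steinitz u S w : chain S u -> (forall y, y \in u -> cl (adj S w) y) ->
  (size u <= size w)%N.
Proof.
elim: u S w => //= x u IH S w [nx hu] hw.
have [|w1 [z [w2 [def_w hz nz]]]] := cl_split (hw x _) nx; first by rewrite inE eqxx.
have xz : cl (adj (adj S w1) [:: x]) z.
  apply: cl_gen_exchange nz; apply: cl_mono hz => y [|]; first by left; left.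
  by rewrite mem_rcons !inE => /orP[|h]; [right; rewrite inE | left; right].
rewrite def_w size_cat addnS -size_cat ltnS; apply: IH hu _ => y yu.
have : cl (adj S w) y by apply: hw; rewrite inE yu orbT.
apply: cl_min => t [St|]; first by apply: cl_sub; left; left.
rewrite def_w mem_cat inE => /or3P[h|/eqP ->|h]; try (by apply: cl_sub; right; rewrite mem_cat h ?orbT).
apply: cl_mono xz => s [[h|h]|h]; [by left; left|by right; rewrite mem_cat h|by left; right].
Qed.

Lemma chain_base S u : exists v, [/\ chain S v, {subset v <= u}
  & forall y, y \in u -> cl (adj S v) y].
Proof.
elim: u => [|x u [v [hv vu hu]]]; first by exists [::].
have [hx|hx] := pselect (cl (adj S v) x).
  exists v; split=> //.
  - by move=> y /vu h; rewrite inE h orbT.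
  - by move=> y; rewrite inE => /orP[/eqP ->|/hu].
exists (rcons v x); split; first by apply/chain_rcons.
- by move=> y; rewrite mem_rcons !inE => /orP[->|/vu ->] //; rewrite orbT.
- move=> y; rewrite inE => /orP[/eqP ->|/hu].
    by apply: cl_sub; right; rewrite mem_rcons inE eqxx.
  apply: cl_mono => z [h|h]; [by left | by right; rewrite mem_rcons inE h orbT].
Qed.

(* Additivity of transcendence degrees in the tower S, F, L. *)
Lemma chain_tower S (F : L -> Prop) u b : (forall x, S x -> F x) -> chain S u ->
  (forall w, chain S w -> (forall x, x \in w -> F x) -> (size w <= b)%N) ->
  exists v, [/\ chain F v, {subset v <= u} & (size u <= b + size v)%N].
Proof.
move=> SF hu hb; have [v [hv vu huv]] := chain_base F u.
exists v; split=> //.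
(* A longest chain of elements of [F] exists by the bound [b], and [F] is algebraic over it by
   maximality. *)
pose P n := `[< exists w, [/\ chain S w, forall x, x \in w -> F x & size w = n] >].
have exP : exists n, P n by exists 0%N; apply/asboolP; exists [::].
have ubP n : P n -> (n <= b)%N by move=> /asboolP[w [h1 h2 <-]]; apply: hb.
case: (ex_maxnP exP ubP) => n /asboolP[w [cw wF <-]] mx.
have Fw x : F x -> cl (adj S w) x.
  move=> Fx; apply: contrapT => nx.
  have : P (size (rcons w x)).
    apply/asboolP; exists (rcons w x); split=> //; first by apply/chain_rcons.
    by move=> y; rewrite mem_rcons inE => /orP[/eqP ->|/wF].
  by move=> /mx; rewrite size_rcons ltnn.
apply: leq_trans (_ : size (w ++ v) <= _)%N; last by rewrite size_cat leq_add2r hb.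
apply: steinitz hu _ => y /huv; apply: cl_min => x [/Fw|h].
  by apply: cl_mono => z [h|h]; [left | right; rewrite mem_cat h].
by apply: cl_sub; right; rewrite mem_cat h orbT.
Qed.

End Closure.

(** * Polynomials in one more variable *)

Section Mpoly.

Variant ord_wid_spec n (i : 'I_n.+1) : Prop :=
  | OrdWid (j : 'I_n) of i = wid j
  | OrdWidMax of i = ord_max.

Lemma ordWid n (i : 'I_n.+1) : ord_wid_spec i.
Proof.
have [hi|hi] := ltnP i n; first by apply: (@OrdWid _ _ (Ordinal hi)); apply: val_inj.
by right; apply/val_inj/eqP; rewrite eqn_leq hi -ltnS ltn_ord.
Qed.

Lemma mpoly_rmorph_ext (R : comNzRingType) (A : comNzRingType) n
    (f g : {rmorphism {mpoly R[n]} -> A}) :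
  (forall c, f c%:MP = g c%:MP) -> (forall i, f 'X_i = g 'X_i) -> f =1 g.
Proof.
move=> hC hX; elim/mpolyind => [|c m p _ _ IH]; first by rewrite !rmorph0.
rewrite !rmorphD IH -mul_mpolyC !rmorphM hC /= mpolyXE_id; congr (_ * _ + _).
by rewrite !rmorph_prod; apply: eq_bigr => i _; rewrite !rmorphXn hX.
Qed.

Lemma mnm_rcons_wid n (m : 'X_{1..n}) d j : [multinom of rcons m d] (wid j) = m j.
Proof.
rewrite multinomE (tnth_nth 0%N) nth_rcons size_tuple /= ltn_ord.
by rewrite (mnm_nth 0%N).
Qed.

Lemma mnm_rcons_max n (m : 'X_{1..n}) d : [multinom of rcons m d] ord_max = d.
Proof. by rewrite multinomE (tnth_nth 0%N) nth_rcons size_tuple ltnn eqxx. Qed.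

Variables (R : comNzRingType) (n : nat).
Implicit Types (q : {mpoly R[n.+1]}) (p : {mpoly R[n]}).

Lemma muniXmax : muni ('X_ord_max : {mpoly R[n.+1]}) = 'X.
Proof.
rewrite muniE msuppX big_seq1 mcoeffX eqxx scale1r mnm1E eqxx.
rewrite (_ : [multinom _ | _ < _] = 0%MM) ?mpolyX0 ?scale1r //.
apply/mnmP => i; rewrite mnmE mnm1E mnm0E -val_eqE /=.
by rewrite gtn_eqF.
Qed.

Lemma muniXwiden i : muni ('X_(wid i) : {mpoly R[n.+1]}) = ('X_i)%:P.
Proof.
rewrite muniE msuppX big_seq1 mcoeffX eqxx scale1r mnm1E.
rewrite -val_eqE /= ltn_eqF // expr0 alg_polyC.
congr ('X_[_])%:P; apply/mnmP => j; rewrite mnmE !mnm1E.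
by rewrite -!val_eqE.
Qed.

Lemma muni_mwiden p : muni (mwiden p) = p%:P.
Proof.
have := @mpoly_rmorph_ext R {poly {mpoly R[n]}} n (@muni n R \o @mwiden n R) polyC.
apply => [c|i] /=; first by rewrite mwidenC muniC.
by rewrite mwidenX mnmwiden1 muniXwiden.
Qed.

Lemma mmultiK (P : {poly {mpoly R[n]}}) : muni (mmulti P) = P.
Proof.
rewrite /mmulti rmorph_sum -[RHS]coefK poly_def; apply: eq_bigr => i _.
by rewrite rmorphM rmorphXn /= muni_mwiden muniXmax mul_polyC.
Qed.

Lemma coef_muni q i (m : 'X_{1..n}) :
  (muni q)`_i@_m = q@_[multinom of rcons m i].
Proof.
rewrite muniE coef_sum raddf_sum /= [in RHS](mpolyE q) raddf_sum /=.
apply: eq_bigr => M _; rewrite coefZ coefXn mulr_natr mcoeffMn !mcoeffZ !mcoeffX.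
rewrite -mulrnAr; congr (_ * _); rewrite -mulrnA mulnb; congr (_ *+ nat_of_bool _).
apply/andP/eqP => [[/eqP <- /eqP ->]|->].
  apply/mnmP => j; case: (ordWid j) => [l ->|->]; last by rewrite mnm_rcons_max.
  by rewrite mnm_rcons_wid mnmE.
rewrite mnm_rcons_max; split=> //; apply/eqP/mnmP => j.
by rewrite mnmE mnm_rcons_wid.
Qed.

Lemma muni_inj : injective (@muni n R).
Proof.
move=> p q e; apply/mpolyP => M.
have -> : M = [multinom of rcons [multinom M (wid i) | i < n] (M ord_max)].
  apply/mnmP => j; case: (ordWid j) => [l ->|->]; last by rewrite mnm_rcons_max.
  by rewrite mnm_rcons_wid mnmE.
by rewrite -!coef_muni e.
Qed.

Lemma mmap_muni (A : comNzRingType) (f : {rmorphism R -> A}) (v : 'I_n.+1 -> A) q :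
  mmap f v q = (map_poly (mmap f (v \o wid)) (muni q)).[v ord_max].
Proof.
have := @mpoly_rmorph_ext R A n.+1 (mmap f v)
  (horner_eval (v ord_max) \o map_poly (mmap f (v \o wid)) \o @muni n R).
apply => [c|i] /=; first by rewrite muniC map_polyC /= /horner_eval hornerC !mmapC.
rewrite mmapX mmap1U /horner_eval; case: (ordWid i) => [j ->|->].
  by rewrite muniXwiden map_polyC /= hornerC mmapX mmap1U.
by rewrite muniXmax map_polyX hornerX.
Qed.

Lemma mmapM (R' A : comNzRingType) (f : {rmorphism R' -> A}) m (v : 'I_m -> A) :
  {morph mmap f v : p q / p * q}.
Proof. exact: rmorphM. Qed.

End Mpoly.

(** * Algebraic independence *)

Section AlgIndep.
Variable L : fieldType.
Implicit Types (F : subfield L) (x y z : L) (s : seq L).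

Definition mover F n : {pred {mpoly L[n]}} := mpolyOver n (sf_pred F).
Arguments mover : clear implicits.

(** Polynomials have coefficients in [L], and membership in [F] is a side condition, so that
    relations over different subfields live in one ring. *)
Definition aind F n (v : 'I_n -> L) : Prop :=
  forall q : {mpoly L[n]}, q \in mover F n -> q.@[v] = 0 -> q = 0.

Lemma sf_mpoly_eval F n (q : {mpoly L[n]}) (v : 'I_n -> L) :
  q \in mover F n -> (forall i, F (v i)) -> F q.@[v].
Proof.
move=> /mpolyOverP hq hv; apply/sf_predP; rewrite mevalE; apply: rpred_sum => m _.
by apply: rpredM => //; apply: rpred_prod => i _; apply/rpredX/sf_predP.
Qed.

Lemma moverS F F' n : (forall x, F x -> F' x) -> {subset mover F n <= mover F' n}.
Proof. by move=> h; apply: mpolyOverS => x /sf_predP /h ?; apply/sf_predP. Qed.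

Lemma sf_D F x y : F x -> F y -> F (x + y).
Proof.
by move=> hx hy; rewrite -[y]opprK -[- y]sub0r; do 2!apply: sf_B => //; apply: sf_0.
Qed.

Lemma sf_M F x y : F x -> F y -> F (x * y).
Proof.
by move=> hx hy; rewrite -[y]invrK -[y^-1]div1r; do 2!apply: sf_div => //; apply: sf_1.
Qed.

Lemma sf_mmap F (R : comNzRingType) (j : {rmorphism R -> L}) n (v : 'I_n -> L) q :
  (forall c, F (j c)) -> (forall i, F (v i)) -> F (mmap j v q).
Proof.
move=> hj hv; elim/mpolyind: q => [|c m q _ _ IH]; first by rewrite mmap0; apply: sf_0.
rewrite mmapD mmapZ mmapX; apply: sf_D IH; apply: sf_M => //.
rewrite /mmap1; elim/big_ind: _ => [||i _]; [exact: sf_1 | exact: sf_M |].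
by elim: (m i) => [|e IHe]; rewrite ?exprS; [exact: sf_1 | apply: sf_M].
Qed.

Notation lst v := [seq v i | i <- enum 'I__].

Lemma gen_adj_frac F n (v : 'I_n -> L) z : gen (adj F (lst v)) z ->
  exists a b : {mpoly L[n]},
    [/\ a \in mover F n, b \in mover F n, b.@[v] != 0 & z = a.@[v] / b.@[v]].
Proof.
move=> h; pose P z := exists a b : {mpoly L[n]},
    [/\ a \in mover F n, b \in mover F n, b.@[v] != 0 & z = a.@[v] / b.@[v]].
have r1 : (1 : {mpoly L[n]}) \in mover F n by apply: rpred1.
have rB (a b : {mpoly L[n]}) : a \in mover F n -> b \in mover F n -> a - b \in mover F n.
  exact: rpredB.
have rM (a b : {mpoly L[n]}) : a \in mover F n -> b \in mover F n -> a * b \in mover F n.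
  exact: rpredM.
have P1 : P 1 by exists 1, 1; rewrite r1 meval1 oner_eq0 divr1.
have PB a b : P a -> P b -> P (a - b).
  move=> [a1 [b1 [ha1 hb1 n1 ->]]] [a2 [b2 [ha2 hb2 n2 ->]]].
  exists (a1 * b2 - a2 * b1), (b1 * b2).
  rewrite rB ?rM // mevalB !mevalM mulf_neq0 //.
  by rewrite -mulNr addf_div // mulNr.
have Pd a b : P a -> P b -> P (a / b).
  move=> [a1 [b1 [ha1 hb1 n1 ->]]] [a2 [b2 [ha2 hb2 n2 ->]]].
  have [e|ne] := eqVneq a2.@[v] 0.
    exists (1 - 1), 1; rewrite rB // r1 meval1 oner_eq0 e subrr meval0.
    by rewrite mul0r invr0 mulr0 ?mul0r.
  exists (a1 * b2), (b1 * a2).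
  by rewrite !rM // !mevalM mulf_neq0 // invf_div mulf_div.
apply: (@gen_min _ _ (Subfield P1 PB Pd) _ z h) => y /= [hy|].
  exists y%:MP, 1; rewrite r1 meval1 mevalC oner_eq0 divr1; split=> //.
  by rewrite [_ \in _]mpolyOverC; apply/sf_predP.
move=> /mapP[i _ ->]; exists 'X_i, 1.
by rewrite r1 meval1 oner_eq0 mevalXU divr1 [_ \in _]mpolyOverX.
Qed.

Lemma lstS n (v : 'I_n.+1 -> L) : lst v = rcons (lst (v \o wid)) (v ord_max).
Proof. by rewrite enum_ordSr map_rcons -map_comp. Qed.

Lemma mwiden_over F n (p : {mpoly L[n]}) : p \in mover F n -> mwiden p \in mover F n.+1.
Proof.
move=> /mpolyOverP hp; rewrite /mwiden /mmap.
have H (q : {mpoly L[n.+1]}) : q \is a mpolyOver n.+1 (sf_pred F) -> q \in mover F n.+1 by [].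
apply: H; apply: rpred_sum => m _; apply: rpredM; first by rewrite mpolyOverC.
by rewrite /mmap1; apply: rpred_prod => i _; apply/rpredX/mpolyOverX.
Qed.

Lemma meval_mwiden n (p : {mpoly L[n]}) v : (mwiden p).@[v] = p.@[v \o wid].
Proof.
by rewrite /meval mmap_muni muni_mwiden map_polyC hornerC.
Qed.

(** Induction on the last variable: an algebraic equation for the last value becomes a relation once
    denominators are cleared. Conversely, a relation either has all its coefficients zero at the
    earlier values, hence is zero, or is such an equation. *)
Lemma aind_chain F n (v : 'I_n -> L) : aind F v <-> chain F (lst v).
Proof.
elim: n v => [|n IH] v.
  rewrite enum_ord0; split=> // _ q hq e.
  have [c ec] : exists c, q = c%:MP.
    by exists q@_0%MM; apply/mpolyP => m; rewrite mcoeffC (_ : m = 0%MM) ?eqxx ?mulr1 //;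
      apply/mnmP => -[].
  by move: e; rewrite ec mevalC => ->.
rewrite lstS chain_rcons -IH; split.
  move=> hv; split=> [q hq e|].
    have /hv h : mwiden q \in mover F n.+1 by apply: mwiden_over.
    apply: (@inj_mwiden n L); rewrite mwiden0; apply: h.
    by rewrite meval_mwiden.
  move=> /clP[p [p0 /polyOverP hp /eqP pv]].
  have hfr i : exists a b : {mpoly L[n]}, [/\ a \in mover F n,
      b \in mover F n, b.@[v \o wid] != 0 & p`_i = a.@[v \o wid] / b.@[v \o wid]].
    by have /sf_predP/gen_adj_frac := hp i.
  have Uc : mulr_closed (mover F n) by split; [apply: rpred1 | apply: rpredM].
  have [d [q [d0 _ hq hdq]]] := @common_denominator L {mpoly L[n]} _ (meval (v \o wid))
    (size p) (nth 0 p) Uc (rmorph1 _) (rmorphM _) hfr.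
  pose Q : {poly {mpoly L[n]}} := \poly_(i < size p) q i.
  have Q0 : Q = 0.
    rewrite -[Q]mmultiK (_ : mmulti Q = 0) ?muni0 //; apply: hv.
      have H (r : {mpoly L[n.+1]}) : r \is a mpolyOver n.+1 (sf_pred F) -> r \in mover F n.+1 by [].
      apply: H; rewrite /mmulti; apply: rpred_sum => i _; apply: rpredM.
        by apply: mwiden_over; rewrite coef_poly; case: ifP => // _; apply: rpred0.
      by apply/rpredX/mpolyOverX.
    rewrite /meval mmap_muni mmultiK -/(meval _) (_ : map_poly _ Q = d.@[v \o wid] *: p).
      by rewrite hornerZ pv mulr0.
    apply/polyP => i; rewrite coef_map coefZ coef_poly /=; case: ltnP => hi; first exact: hdq.
    by rewrite mmap0 nth_default ?mulr0.
  case/eqP: p0; apply/polyP => i; rewrite coef0.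
  have [hi|hi] := ltnP i (size p); last by rewrite nth_default.
  have /polyP/(_ i) := Q0; rewrite coef0 coef_poly hi => e.
  by apply/eqP; have /eqP := hdq i hi; rewrite e meval0 eq_sym mulf_eq0 (negPf d0).
move=> [hv nv] q hq e; apply: (@muni_inj L n); rewrite muni0.
have hc i : (muni q)`_i \in mover F n.
  by apply/mpolyOverP => m; rewrite coef_muni; move/mpolyOverP: hq.
pose p := map_poly (meval (v \o wid)) (muni q).
have [p0|p0] := eqVneq p 0.
  apply/polyP => i; rewrite coef0; apply: hv => //.
  by have /polyP/(_ i) := p0; rewrite coef_map coef0.
case: nv; apply/clP; exists p; split=> //; last first.
  by rewrite rootE; move: e; rewrite /meval mmap_muni => ->.
apply/polyOverP => i; rewrite coef_map /=; apply/sf_predP/sf_mpoly_eval.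
  by apply: moverS (hc i) => x hx; apply: gen_sub; left.
by move=> j; apply: gen_sub; right; apply/mapP; exists j; rewrite ?mem_enum.
Qed.

Lemma size_lst n (v : 'I_n -> L) : size (lst v) = n.
Proof. by rewrite size_map size_enum_ord. Qed.

Lemma chain_tuple F s : chain F s -> aind F (tnth (in_tuple s)).
Proof. by move=> h; apply/aind_chain; rewrite map_tnth_enum. Qed.

Lemma aind_bound F n (v : 'I_n -> L) w : aind F v ->
  (forall i, cl (adj F w) (v i)) -> (n <= size w)%N.
Proof.
move=> /aind_chain hv hw; rewrite -(size_lst v); apply: steinitz hv _.
by move=> y /mapP[i _ ->].
Qed.

Variables (k : fieldType) (j : {rmorphism k -> L}).

Definition rng : subfield L.
refine (@Subfield L (fun x => exists c, x = j c) _ _ _).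
- by exists 1; rewrite rmorph1.
- by move=> x y [a ->] [b ->]; exists (a - b); rewrite rmorphB.
- by move=> x y [a ->] [b ->]; exists (a / b); rewrite fmorph_div.
Defined.

Lemma alg_indepE n (x : n.-tuple L) : alg_indep j x <-> aind rng (tnth x).
Proof.
have E (q : {mpoly k[n]}) : mmap j (tnth x) q = (map_mpoly j q).@[tnth x].
  have := @mpoly_rmorph_ext k L n (mmap j (tnth x)) (meval (tnth x) \o map_mpoly j).
  apply=> [c|i] /=; first by rewrite map_mpolyC mevalC mmapC.
  by rewrite map_mpolyX mevalXU mmapX mmap1U.
split=> h q.
  move=> /mpolyOverP hq.
  have {}hq m : exists c, q@_m = j c by have /sf_predP := hq m.
  have [f hf] := choice hq.
  pose q' : {mpoly k[n]} := \sum_(m <- msupp q) f m *: 'X_[m].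
  have e : q = map_mpoly j q'.
    rewrite [q in LHS]mpolyE rmorph_sum; apply: eq_bigr => m _.
    by rewrite /= map_mpolyZ map_mpolyX -hf.
  by rewrite e -E => /h ->; rewrite rmorph0.
rewrite E => e; have /h/(_ e) e' : map_mpoly j q \in mover rng n.
  by apply/mpolyOverP => m; rewrite mcoeff_map_mpoly; apply/sf_predP; exists q@_m.
apply/mpolyP => m; have := congr1 (mcoeff m) e'.
by rewrite mcoeff_map_mpoly !mcoeff0 => /eqP; rewrite fmorph_eq0 => /eqP.
Qed.

Lemma aind_rngP n (v : 'I_n -> L) :
  aind rng v <-> forall q, mmap j v q = 0 -> q = 0.
Proof.
have -> : v = tnth [tuple v i | i < n] by apply/funext => i; rewrite tnth_mktuple.
by rewrite -alg_indepE.
Qed.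

End AlgIndep.
Arguments mover {L} F n.

(** * Hilbert's basis theorem *)

Section Noetherian.

Definition idl (R : comNzRingType) (S : R -> Prop) (x : R) : Prop :=
  forall I : R -> Prop, I 0 -> (forall a y z, I y -> I z -> I (a * y + z)) ->
    (forall y, S y -> I y) -> I x.

(** The generators are taken from [S] itself, not merely from its ideal: later they must be
    coordinates of tuples of forms that describe the action. *)
Definition noetherian (R : comNzRingType) : Prop := forall S : R -> Prop,
  exists s : seq R, (forall x, x \in s -> S x) /\
    forall x, S x -> idl (fun y => y \in s) x.

Section Ideals.
Variable R : comNzRingType.
Implicit Types (S T : R -> Prop) (x y : R).

Lemma idl0 S : idl S 0. Proof. by move=> I. Qed.

Lemma idlMD S a x y : idl S x -> idl S y -> idl S (a * x + y).
Proof. by move=> hx hy I I0 IMD IS; apply: (IMD); [exact: (hx I) | exact: (hy I)]. Qed.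

Lemma idl_sub S x : S x -> idl S x.
Proof. by move=> h I _ _; apply. Qed.

Lemma idl_min S T : (forall x, S x -> idl T x) -> forall x, idl S x -> idl T x.
Proof. by move=> h x hx; apply: (hx (idl T)); [exact: idl0 | exact: idlMD | exact: h]. Qed.

Lemma idl_fin S x : idl S x ->
  exists s : seq R, (forall y, y \in s -> S y) /\ idl (fun y => y \in s) x.
Proof.
move=> hx; pose I x := exists s : seq R,
  (forall y, y \in s -> S y) /\ idl (fun y => y \in s) x.
apply: (hx I).
- by exists [::]; split=> //; apply: idl0.
- move=> a y z [s [hs hy]] [t [ht hz]]; exists (s ++ t); split.
    by move=> u; rewrite mem_cat => /orP[/hs|/ht].
  apply: idlMD; [apply: idl_min hy | apply: idl_min hz] => u hu;
    by apply: idl_sub; rewrite mem_cat hu ?orbT.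
- move=> y Sy; exists [:: y]; split; first by move=> z; rewrite inE => /eqP ->.
  by apply: idl_sub; rewrite inE.
Qed.

Lemma idl_fin_seq S (t : seq R) : (forall x, x \in t -> idl S x) ->
  exists s : seq R, (forall y, y \in s -> S y) /\
    forall x, x \in t -> idl (fun y => y \in s) x.
Proof.
elim: t => [|x t IH] ht; first by exists [::].
have [|s [hs hst]] := IH; first by move=> y yt; apply: ht; rewrite inE yt orbT.
have [|s' [hs' hx]] := @idl_fin S x; first by apply: ht; rewrite inE eqxx.
exists (s' ++ s); split; first by move=> y; rewrite mem_cat => /orP[/hs'|/hs].
move=> y; rewrite inE => /orP[/eqP ->|/hst]; [move: hx|];
  by apply: idl_min => z hz; apply: idl_sub; rewrite mem_cat hz ?orbT.
Qed.

Lemma noetherianI : (forall S, exists t : seq R, (forall x, x \in t -> idl S x) /\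
    forall x, S x -> idl (fun y => y \in t) x) -> noetherian R.
Proof.
move=> h S; have [t [htS hSt]] := h S; have [s [hs hst]] := idl_fin_seq htS.
by exists s; split=> // x /hSt; apply: idl_min.
Qed.

End Ideals.

Lemma hilbert_basis (R : comNzRingType) : noetherian R -> noetherian {poly R}.
Proof.
move=> hR; apply: noetherianI => S.
(* [lc n] is the ideal of coefficients of degree n of polynomials of degree at most n in the ideal
   of [S]; it grows with n. *)
pose lc n c := exists p : {poly R}, [/\ idl S p, (size p <= n.+1)%N & p`_n = c].
have lc_shift m n c : (m <= n)%N -> lc m c -> lc n c.
  move=> mn [p [Sp sp <-]]; exists ('X^(n - m) * p); split.
  - by rewrite -[_ * _]addr0; apply: idlMD => //; apply: idl0.
  - have [->|p0] := eqVneq p 0; first by rewrite mulr0 size_poly0.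
    by rewrite mulrC size_mulXn // (leq_trans (leq_add (leqnn _) sp)) // addnS subnK.
  - by rewrite coefXnM ltnNge leq_subr /= subKn.
have [l [hl hl']] := hR (fun c => exists n, lc n c).
have [N hN] : exists N, forall c, c \in l -> lc N c.
  elim: l {hl'} hl => [|c l IH] hl; first by exists 0%N.
  have [|N hN] := IH; first by move=> d dl; apply: hl; rewrite inE dl orbT.
  have [|n hn] := hl c; first by rewrite inE eqxx.
  exists (maxn N n) => d; rewrite inE => /orP[/eqP ->|/hN].
    by apply: lc_shift hn; rewrite leq_maxr.
  by apply: lc_shift; rewrite leq_maxl.
have lvl n : exists s : seq R, (n <= N)%N -> (forall c, c \in s -> lc n c) /\
    forall m c, minn m N = n -> lc m c -> idl (fun y => y \in s) c.
  have [nN|nN|nN] := ltngtP n N; [|by exists [::]|]; last first.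
    exists l => _; split=> [c cl0|m c _ h]; last exact: (hl' c (ex_intro _ m h)).
    by rewrite nN; apply: hN.
  have [s [h1 h2]] := hR (lc n); exists s => _; split=> [c cs|m c e h].
    exact: h1.
  have mn : m = n by move: e nN; rewrite /minn; case: ltnP => // _ ->; rewrite ltnn.
  by rewrite mn in h; exact: (h2 c h).
(* Level N serves all higher degrees, hence [minn m N]. The target [T] is a parameter because the
   final list is assembled from all levels only afterwards. *)
have gens n : exists t : seq {poly R}, (n <= N)%N -> (forall p, p \in t -> idl S p) /\
    forall m (T : {poly R} -> Prop), minn m N = n ->
    (forall p, p \in t -> idl T p) -> forall c, lc m c ->
    exists q, [/\ idl T q, (size q <= m.+1)%N & q`_m = c].
  have [s hs] := lvl n.
  have [nN|nN] := leqP n N; last by exists [::].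
  have [hs1 hs2] := hs nN.
  have hf c : exists p, c \in s -> [/\ idl S p, (size p <= n.+1)%N & p`_n = c].
    by have [/hs1[p hp]|] := boolP (c \in s); [exists p | exists 0].
  have [f {}hf] := choice hf; exists (map f s) => _; split.
    by move=> p /mapP[c cs ->]; case: (hf c cs).
  move=> m T mn hT c /(hs2 _ _ mn) hc.
  apply: (hc (fun c => exists q, [/\ idl T q, (size q <= m.+1)%N & q`_m = c])).
  - by exists 0; rewrite size_poly0 coef0; split=> //; apply: idl0.
  - move=> a y z [q1 [h1 s1 <-]] [q2 [h2 s2 <-]]; exists (a%:P * q1 + q2); split.
    + exact: idlMD.
    + rewrite (leq_trans (size_polyD _ _)) // geq_max s2 andbT mul_polyC.
      exact: leq_trans (size_scale_leq _ _) s1.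
    + by rewrite coefD coefCM.
  move=> y ys; have [_ sy ey] := hf y ys.
  have le_nm : (n <= m)%N by rewrite -mn geq_minl.
  exists ('X^(m - n) * f y); split.
  - rewrite -[_ * _]addr0; apply: idlMD; last exact: idl0.
    by apply: hT; apply: map_f.
  - have [->|p0] := eqVneq (f y) 0; first by rewrite mulr0 size_poly0.
    by rewrite mulrC size_mulXn // (leq_trans (leq_add (leqnn _) sy)) // addnS subnK.
  - by rewrite coefXnM ltnNge leq_subr /= subKn.
have [t ht] := choice gens.
pose T := flatten [seq t n | n <- iota 0 N.+1].
have tT n p : (n <= N)%N -> p \in t n -> p \in T.
  by move=> nN pt; apply/flattenP; exists (t n) => //; apply: map_f; rewrite mem_iota.
have TS p : p \in T -> idl S p.
  move=> /flattenP[_ /mapP[n hn ->] pt]; move: hn; rewrite mem_iota add0n ltnS /= => nN.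
  by case: (ht n nN) => h _; apply: h.
exists T; split=> // p Sp.
have {Sp} : idl S p by apply: idl_sub.
elim: {p}(size p).+1 {-2}p (ltnSn (size p)) => // n IH p sp Sp.
have [p0|p0] := eqVneq p 0; first by rewrite p0; apply: idl0.
case Em: (size p) => [|m]; first by move/eqP: Em; rewrite size_poly_eq0 (negPf p0).
have mN : (minn m N <= N)%N by rewrite geq_minr.
have [_ /(_ m (fun q => q \in T) erefl)] := ht _ mN.
case/(_ _ p`_m) => [q hq||q [Tq sq eq]].
- by apply: idl_sub; apply: tT hq.
- by exists p; rewrite Em.
rewrite -[p](subrK q) -[p - q]mul1r; apply: idlMD => //; apply: IH.
  apply: leq_trans (_ : m.+1 <= n)%N; last by rewrite -Em -ltnS.
  rewrite ltnS; apply/leq_sizeP => i; rewrite leq_eqVlt => /orP[/eqP <-|mi].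
    by rewrite coefB eq subrr.
  by rewrite coefB !nth_default ?subrr // ?Em // (leq_trans sq).
rewrite addrC -mulN1r; apply: idlMD => //.
by apply: idl_min Tq => r /TS.
Qed.

Lemma mpoly_noetherian (k : fieldType) n : noetherian {mpoly k[n]}.
Proof.
elim: n => [|n IH].
  move=> S; have [[x Sx x0]|h] := pselect (exists2 x, S x & x != 0).
    exists [:: x]; split=> [y|y _]; first by rewrite inE => /eqP ->.
    have c0 (p : {mpoly k[0]}) : p = (p@_0%MM)%:MP.
      by apply/mpolyP => m; rewrite mcoeffC (_ : m = 0%MM) ?eqxx ?mulr1 //; apply/mnmP => -[].
    have xc0 : x@_0%MM != 0 by apply: contraNneq x0 => e; rewrite (c0 x) e.
    rewrite (_ : y = (y@_0%MM / x@_0%MM)%:MP * x + 0).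
      by apply: idlMD; [apply: idl_sub; rewrite inE | apply: idl0].
    by rewrite addr0 [X in _ * X](c0 x) -mpolyCM divfK // -c0.
  exists [::]; split=> // x Sx; have [->|x0] := eqVneq x 0; first exact: idl0.
  by case: h; exists x.
move=> S; have [s [hs hS]] := hilbert_basis IH (fun p => S (mmulti p)).
exists (map (@mmulti n k) s); split; first by move=> x /mapP[p /hs h ->].
move=> x Sx; have mK (p : {mpoly k[n.+1]}) : mmulti (muni p) = p.
  by apply: (@muni_inj k n); rewrite mmultiK.
have {}hS : idl (fun y => y \in s) (muni x) by apply: hS; rewrite mK.
pose I P := idl (fun y => y \in map (@mmulti n k) s) (mmulti P).
rewrite -(mK x); apply: (hS I); rewrite /I.
- by rewrite -[0]muni0 mK; apply: idl0.
- move=> a y z hy hz; rewrite (_ : mmulti _ = mmulti a * mmulti y + mmulti z).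
    exact: idlMD.
  by apply: (@muni_inj k n); rewrite muniD muniM !mmultiK.
- by move=> y ys; apply: idl_sub; apply: map_f.
Qed.

Lemma mpoly_finite_zeros (k : fieldType) n (S : {mpoly k[n]} -> Prop) :
  exists s : seq {mpoly k[n]}, (forall p, p \in s -> S p) /\
    forall (A : comNzRingType) (f : {rmorphism {mpoly k[n]} -> A}),
      (forall p, p \in s -> f p = 0) -> forall p, S p -> f p = 0.
Proof.
have [s [hs hS]] := mpoly_noetherian S; exists s; split=> // A f fs p Sp.
apply: (hS p Sp (fun p => f p = 0)) => //; first exact: rmorph0.
by move=> a y z hy hz; rewrite rmorphD rmorphM hy hz mulr0 addr0.
Qed.

End Noetherian.

(** * Extension of specialisations *)

Section Specialization.
Variables (L : fieldType) (K : closedFieldType).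

Section Step.
Variables (A : comNzRingType) (f : {rmorphism A -> L}).
Implicit Types p q m g : {poly A}.
Local Notation "p ^f" := (map_poly f p) : ring_scope.

(** Coefficients lie in a ring, so one divides only after multiplying by powers of the leading
    coefficient, which the specialisations below keep nonzero. *)
Lemma pseudo_division m p : (0 < size m)%N ->
  exists s u r, lead_coef m ^+ s *: p = u * m + r /\ (size r < size m)%N.
Proof.
move=> m0; elim: {p}(size p) {-2}p (leqnn (size p)) => [|n IH] p sp.
  exists 0%N, 0, 0; rewrite size_poly0 mul0r addr0; split=> //.
  by move: sp; rewrite leqn0 size_poly_eq0 => /eqP ->; rewrite scaler0.
have [lt_pm|le_mp] := ltnP (size p) (size m).
  by exists 0%N, 0, p; rewrite expr0 scale1r mul0r add0r.
pose t := p`_n *: 'X^(n - (size m).-1).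
have [|s [u [r [E sr]]]] := IH (lead_coef m *: p - t * m).
  apply/leq_sizeP => j; rewrite leq_eqVlt coefB coefZ -scalerAl coefZ coefXnM => /orP[/eqP <-|lt_nj].
    have le_mn : ((size m).-1 <= n)%N by rewrite -ltnS prednK // (leq_trans le_mp).
    by rewrite ltnNge leq_subr /= subKn // mulrC subrr.
  rewrite [p`_j]nth_default ?(leq_trans sp) // mulr0 sub0r.
  case: ifP => h; first by rewrite mulr0 oppr0.
  rewrite [m`_(_ - _)]nth_default ?mulr0 ?oppr0 //.
  have le_mn : ((size m).-1 <= n)%N by rewrite -ltnS prednK // (leq_trans le_mp).
  have : ((size m).-1 < j - (n - (size m).-1))%N; last by rewrite prednK.
  by rewrite subnBA // ltn_subRL ltn_add2r.
exists s.+1, (u + lead_coef m ^+ s *: t), r; split=> //.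
rewrite exprSr -scalerA -[_ *: p](subrK (t * m)) scalerDr E mulrDl -!addrA.
by rewrite [r + _]addrC scalerAl.
Qed.

(** The size is minimised among images in [L]; the lift is then cut off at that size, so that [f]
    does not kill its leading coefficient and pseudo-division stays meaningful in [L]. *)
Lemma minimal_lift (Q : {poly L} -> Prop) p : Q p^f -> p^f != 0 ->
  exists m, [/\ Q m^f, m^f != 0, f (lead_coef m) != 0
    & forall g, Q g^f -> (size g < size m)%N -> g^f = 0].
Proof.
move=> Qp p0.
pose P n := `[< exists m, [/\ Q m^f, m^f != 0 & size m^f = n] >].
have exP : exists n, P n by exists (size p^f); apply/asboolP; exists p.
case: (ex_minnP exP) => n /asboolP[m [Qm m0 sm]] mn.
pose m' := \poly_(i < n) m`_i.
have em : m'^f = m^f.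
  apply/polyP => i; rewrite !coef_map coef_poly /=; case: ltnP => hi //.
  by rewrite rmorph0 -coef_map nth_default ?sm.
have n0 : (0 < n)%N by rewrite -sm size_poly_gt0.
have lm : f m`_n.-1 = lead_coef m^f by rewrite -coef_map lead_coefE sm.
have sm' : size m' = n.
  apply: size_poly_eq; apply: contraNneq m0 => e.
  by rewrite -lead_coef_eq0 -lm e rmorph0.
exists m'; split; rewrite ?em //.
  by rewrite lead_coefE sm' coef_poly prednK // leqnn lm lead_coef_eq0.
move=> g Qg; rewrite sm' => sg; apply/eqP/negPn/negP => g0.
have : P (size g^f) by apply/asboolP; exists g.
move=> /mn; rewrite leqNgt => /negP; apply.
by apply: leq_ltn_trans sg; apply: size_poly.
Qed.

Lemma map_kernel (h : {rmorphism A -> K}) p : (forall c, f c = 0 -> h c = 0) ->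
  p^f = 0 -> map_poly h p = 0.
Proof.
move=> fh p0; apply/polyP => i; rewrite coef_map coef0 /= fh //.
by rewrite -coef_map p0 coef0.
Qed.

(** Extension of a specialisation to one more element. If [x] is transcendental over the image of
    [f], any xi outside the zeros of the specialised [q] works. If it is algebraic, xi is a root of
    the specialised minimal equation [m], and a Bezout relation between [q] and [m] with constant
    value keeps [q] nonzero there. The element [a] collects the coefficients that must survive. *)
Lemma specialize_step x q : q^f.[x] != 0 ->
  exists2 a, f a != 0 & forall h : {rmorphism A -> K}, (forall c, f c = 0 -> h c = 0) ->
    h a != 0 -> exists xi : K, (forall p, p^f.[x] = 0 -> (map_poly h p).[xi] = 0) /\
      (map_poly h q).[xi] != 0.
Proof.
move=> qx; have q0 : q^f != 0 by apply: contraNneq qx => ->; rewrite horner0.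
have [[p px p0]|alg] := pselect (exists2 p, p^f.[x] = 0 & p^f != 0); last first.
  exists q`_(size q^f).-1.
    by rewrite -coef_map -lead_coefE lead_coef_eq0.
  move=> h fh ha; have hq0 : map_poly h q != 0.
    by apply: contraNneq ha => e; rewrite -coef_map e coef0.
  have /closed_nonrootP[xi hxi] := hq0; exists xi; split=> // p px.
  rewrite map_kernel ?horner0 //; apply: contrapT => p0.
  by case: alg; exists p => //; apply/eqP.
have [m [mx m0 lm mmin]] := minimal_lift (Q := fun P => P.[x] = 0) px p0.
(* [J] is the ideal of [q] and [m] after applying [f]; its nonzero element [g] of least size plays
   the gcd. *)
pose J (P : {poly L}) := exists u v, P = (u * q + v * m)^f.
have Jm : J m^f by exists 0, 1; rewrite mul0r mul1r add0r.
have Jq : J q^f by exists 1, 0; rewrite mul0r mul1r addr0.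
have [g [Jg g0 lg gmin]] := minimal_lift Jm m0.
have sz_gt0 (r : {poly A}) : r^f != 0 -> (0 < size r)%N.
  by move=> r0; rewrite size_poly_gt0; apply: contraNneq r0 => ->; rewrite rmorph0.
have divJ r : J r^f -> exists s u, (f (lead_coef g) ^+ s) *: r^f = u^f * g^f.
  move=> [u1 [v1 e1]]; have [u2 [v2 e2]] := Jg.
  have [s [u [w [E sw]]]] := pseudo_division r (sz_gt0 _ g0).
  exists s, u; have := congr1 (map_poly f) E.
  rewrite map_polyZ rmorphXn rmorphD rmorphM /= [w^f]gmin ?addr0 //.
  exists (lead_coef g ^+ s *: u1 - u * u2), (lead_coef g ^+ s *: v1 - u * v2).
  have -> : w^f = (f (lead_coef g) ^+ s) *: r^f - u^f * g^f.
    by rewrite -rmorphXn -map_polyZ E rmorphD rmorphM /= addrC addKr.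
  rewrite e1 e2 -rmorphXn -map_polyZ -rmorphM -rmorphB /=; congr map_poly.
  by rewrite -!mul_polyC; ring.
have gx : g^f.[x] != 0.
  have [s [u E]] := divJ q Jq; have /(congr1 (horner^~ x)) := E.
  rewrite hornerZ hornerM => E'; apply: contraTneq qx => e.
  by move/eqP: E'; rewrite e mulr0 mulf_eq0 expf_eq0 (negPf lg) andbF /= => ->.
(* A nonconstant [g] would divide [m] up to a constant, and the quotient [u] would be a smaller
   equation for [x], as [g] does not vanish at [x]. *)
have sg : (size g <= 1)%N.
  rewrite leqNgt; apply/negP => sg.
  have [s [u E]] := divJ m Jm.
  have lgs : f (lead_coef g) ^+ s != 0 by rewrite expf_neq0.
  have u0 : u^f != 0.
    by apply: contraNneq m0 => e; move/eqP: E; rewrite e mul0r scaler_eq0 (negPf lgs).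
  have sgf : size g^f = size g.
    by rewrite size_map_poly_id0.
  pose u' := \poly_(i < size u^f) u`_i.
  have eu : u'^f = u^f.
    apply/polyP => i; rewrite !coef_map coef_poly /=; case: ltnP => hi //.
    by rewrite rmorph0 -coef_map nth_default.
  case/eqP: u0; rewrite -eu; apply: mmin.
    rewrite eu; have /(congr1 (horner^~ x)) := E.
    rewrite hornerZ hornerM mx mulr0 => /esym/eqP.
    by rewrite mulf_eq0 (negPf gx) orbF => /eqP.
  apply: leq_ltn_trans (size_poly _ _) _.
  have := congr1 (fun P : {poly L} => size P) E; rewrite size_scale // size_mul //; last first.
    by apply: contraNneq m0 => e; move/eqP: E; rewrite e mul0r scaler_eq0 (negPf lgs).
  rewrite sgf => E'.
  have sm : size m^f = size m by rewrite size_map_poly_id0.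
  by rewrite -sm E' -ltnS prednK ?addn_gt0 ?(ltnW sg) ?orbT // -[X in (X < _)%N]addn1 -addnS leq_add2l.
have [u [v eg]] := Jg.
have gc : g = (lead_coef g)%:P by rewrite {1}(size1_polyC sg) lead_coefE (_ : (size g).-1 = 0%N) //;
  case: (size g) sg => [|[]].
exists (lead_coef m * lead_coef g); first by rewrite rmorphM mulf_neq0.
move=> h fh; rewrite rmorphM mulf_eq0 negb_or => /andP[hlm hlg].
have hm : size (map_poly h m) = size m by rewrite size_map_poly_id0.
have sm1 : size (map_poly h m) != 1%N.
  rewrite hm; apply/eqP => s1; move: mx; rewrite [m](size1_polyC _) ?s1 // map_polyC hornerC /=.
  by move: lm; rewrite lead_coefE s1 => /eqP.
have /closed_rootP[xi /rootP mxi] := sm1.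
exists xi; split=> [r rx|].
  have [s [w [r' [E sr']]]] := pseudo_division r (sz_gt0 _ m0).
  have r'0 : r'^f = 0.
    apply: mmin sr'; have /(congr1 (fun P => P^f.[x])) := E.
    by rewrite map_polyZ hornerZ rx mulr0 rmorphD rmorphM hornerD hornerM mx mulr0 add0r.
  have /(congr1 (fun P => (map_poly h P).[xi])) := E.
  rewrite map_polyZ hornerZ rmorphD rmorphM hornerD hornerM /= mxi mulr0 add0r.
  rewrite (map_kernel fh r'0) horner0 rmorphXn => /eqP.
  by rewrite mulf_eq0 expf_eq0 (negPf hlm) andbF => /eqP.
apply: contraNneq hlg => qxi.
have e : (g - (u * q + v * m))^f = 0 by rewrite rmorphB /= eg subrr.
have := map_kernel fh e; move=> /(congr1 (horner^~ xi)).
rewrite rmorphB rmorphD !rmorphM /= hornerD hornerN hornerD !hornerM qxi mxi !mulr0 addr0 subr0.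
have -> : (map_poly h g).[xi] = h (lead_coef g) by rewrite {1}gc map_polyC hornerC.
by rewrite horner0 => ->.
Qed.

End Step.

(** The elements are removed from the top: the last step has base ring A[n], and the element it must
    keep nonzero becomes the [q] of the induction hypothesis. *)
Lemma specialize (A : comNzRingType) (f : {rmorphism A -> L}) n (x : 'I_n -> L)
    (q : {mpoly A[n]}) : mmap f x q != 0 ->
  exists2 a, f a != 0 & forall h : {rmorphism A -> K}, (forall c, f c = 0 -> h c = 0) ->
    h a != 0 -> exists xi : 'I_n -> K,
      (forall p, mmap f x p = 0 -> mmap h xi p = 0) /\ mmap h xi q != 0.
Proof.
elim: n x q => [|n IH] x q qx.
  have c0 (p : {mpoly A[0]}) : p = (p@_0%MM)%:MP.
    by apply/mpolyP => m; rewrite mcoeffC (_ : m = 0%MM) ?eqxx ?mulr1 //; apply/mnmP => -[].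
  exists q@_0%MM; first by move: qx; rewrite (c0 q) mmapC mcoeffC eqxx mulr1.
  move=> h fh hq; exists (fun=> 0); split=> [p|]; last by rewrite (c0 q) mmapC.
  by rewrite (c0 p) !mmapC; apply: fh.
rewrite mmap_muni in qx.
have [a fa step] := @specialize_step {mpoly A[n]} (mmap f (x \o wid)) _ _ qx.
have [b fb IHb] := IH _ a fa.
exists b => // h fh hb; have [xi [h1 h2]] := IHb h fh hb.
have [y [h3 h4]] := step (mmap h xi) h1 h2.
pose z (i : 'I_n.+1) := if unlift ord_max i is Some j then xi j else y.
have zw : z \o wid =1 xi.
  move=> j; rewrite /z /=; case: unliftP => [l e|e].
    by congr xi; apply/val_inj; move: (congr1 (@nat_of_ord _) e); rewrite lift_max.
  by have /= e' := congr1 (@nat_of_ord _) e; have := ltn_ord j; rewrite e' ltnn.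
have zm : z ord_max = y by rewrite /z unlift_none.
have E p : mmap h z p = (map_poly (mmap h xi) (muni p)).[y].
  rewrite mmap_muni zm; congr (_.[_]); apply: eq_map_poly => c.
  by rewrite (funext zw).
exists z; split=> [p|]; last by rewrite E.
by rewrite mmap_muni E; apply: h3.
Qed.

End Specialization.

Section GenericSpecialization.
Variables (k L : fieldType) (K : closedFieldType).
Variables (j : {rmorphism k -> L}) (iota : {rmorphism k -> K}).

(* Stated as an existence so that the embedding stays opaque to unification. *)
Lemma mpoly_lift_exists n m :
  exists up : {rmorphism {mpoly k[m]} -> {mpoly {mpoly k[n]}[m]}},
    forall (M : comNzRingType) (i : {rmorphism k -> M})
      (h : {rmorphism {mpoly k[n]} -> M}) (x : 'I_m -> M) p,
    (forall c, h c%:MP = i c) -> mmap h x (up p) = mmap i x p.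
Proof.
exists (map_mpoly (@mpolyC n k)) => M i h x p hC.
have := @mpoly_rmorph_ext k M m (mmap h x \o map_mpoly (@mpolyC n k)) (mmap i x).
apply=> [c|a] /=; first by rewrite map_mpolyC !mmapC; apply: hC.
by rewrite map_mpolyX !mmapX.
Qed.

(** The base ring is k[n], embedded in [L] by the independent tuple [f]: the kernel is zero, so
    every tau off the hypersurface alpha = 0 extends. The last clause is how the [f i], written as
    fractions in the [x], receive the prescribed values. *)
Lemma specialize_generic n (f : 'I_n -> L) m (x : 'I_m -> L) (q : {mpoly k[m]}) :
  (forall p, mmap j f p = 0 -> p = 0) -> mmap j x q != 0 ->
  exists2 alpha : {mpoly k[n]}, alpha != 0 & forall tau : 'I_n -> K,
    mmap iota tau alpha != 0 -> exists xi : 'I_m -> K,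
    [/\ mmap iota xi q != 0, forall p, mmap j x p = 0 -> mmap iota xi p = 0
      & forall i A B, f i * mmap j x B = mmap j x A -> tau i * mmap iota xi B = mmap iota xi A].
Proof.
move=> hf q0; have [up mmap_up] := mpoly_lift_exists n m.
have [h1 h1E] : exists h : {rmorphism {mpoly k[n]} -> L}, forall p, h p = mmap j f p.
  by exists (mmap j f).
have h1C c : h1 c%:MP = j c by rewrite h1E mmapC.
have [|alpha al0 hal] := @specialize L K {mpoly k[n]} h1 m x (up q).
  by rewrite (mmap_up _ _ _ _ _ h1C).
exists alpha; first by apply: contraNneq al0 => ->; rewrite rmorph0.
move=> tau htau.
have [h2 h2E] : exists h : {rmorphism {mpoly k[n]} -> K}, forall p, h p = mmap iota tau p.
  by exists (mmap iota tau).
have h2C c : h2 c%:MP = iota c by rewrite h2E mmapC.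
have [||xi [hxi qxi]] := hal h2; rewrite ?h2E //.
  by move=> c; rewrite h1E h2E => /hf ->; rewrite rmorph0.
exists xi; split=> [|p px|i A B e].
- by rewrite -(mmap_up _ _ _ xi q h2C).
- by rewrite -(mmap_up _ _ _ xi p h2C); apply: hxi; rewrite (mmap_up _ _ _ x p h1C).
have : mmap h2 xi (('X_i)%:MP * up B - up A) = 0.
  apply: hxi; rewrite mmapB mmapM mmapC (mmap_up _ _ _ x A h1C) (mmap_up _ _ _ x B h1C).
  by rewrite /= h1E mmapX mmap1U e subrr.
rewrite mmapB mmapM mmapC (mmap_up _ _ _ xi A h2C) (mmap_up _ _ _ xi B h2C) => /eqP.
by rewrite subr_eq0 /= h2E mmapX mmap1U => /eqP.
Qed.

End GenericSpecialization.

(** The values are sought in [K] because [k] may be finite. This is the specialisation of variables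
    over the base ring [k]. *)
Lemma mpoly_nonzero_value (k : fieldType) (K : closedFieldType) (iota : {rmorphism k -> K})
    n (p : {mpoly k[n]}) : p != 0 -> exists tau : 'I_n -> K, mmap iota tau p != 0.
Proof.
move=> p0; pose j : {rmorphism k -> {fraction {mpoly k[n]}}} := @tofrac _ \o @mpolyC n k.
have E q : tofrac q = mmap j (fun i => tofrac 'X_i) q.
  have := @mpoly_rmorph_ext k {fraction {mpoly k[n]}} n (@tofrac _) (mmap j (fun i => tofrac 'X_i)).
  by apply=> [c|i] /=; rewrite ?mmapC ?mmapX ?mmap1U.
have [|a a0 ha] := @specialize _ K k j n (fun i => tofrac 'X_i) p; first by rewrite -E tofrac_eq0.
have [||tau [_ htau]] := ha iota; last by exists tau.
  by move=> c /eqP; rewrite fmorph_eq0 => /eqP ->; rewrite rmorph0.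
by rewrite fmorph_eq0; apply: contraNneq a0 => ->; rewrite rmorph0.
Qed.

(** * Fixed fields and orbits *)

Lemma fractionP (R : idomainType) (x : {fraction R}) :
  exists a b : R, b != 0 /\ x = tofrac a / tofrac b.
Proof.
elim/quotW: x => r; exists \n_r, \d_r; split; first exact: denom_ratioP.
have d0 : tofrac \d_r != 0 by rewrite tofrac_eq0 denom_ratioP.
apply: (mulIf d0); rewrite divfK //; unlock tofrac.
rewrite -[LHS]FracField.pi_mul; apply/eqmodP; rewrite /= FracField.equivfE.
rewrite /FracField.mulf !numden_Ratio ?oner_eq0 ?mulf_neq0 ?denom_ratioP //.
  by rewrite !mulr1 mulrC.
all: exact: oner_neq0.
Qed.

Lemma sub_fractions (F : fieldType) (x x' y y' : F) : y != 0 -> y' != 0 ->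
  x / y - x' / y' = (x * y' - x' * y) / (y * y').
Proof. by move=> y0 y'0; rewrite -mulNr addf_div // mulNr. Qed.

Lemma fraction_map (L L' : fieldType) (P : {rmorphism L -> L'}) n :
  exists F : {fraction {mpoly L[n]}} -> {fraction {mpoly L'[n]}}, forall a b, b != 0 ->
    F (tofrac a / tofrac b) = tofrac (map_mpoly P a) / tofrac (map_mpoly P b).
Proof.
have nz (b : {mpoly L[n]}) : b != 0 -> tofrac (map_mpoly P b) != 0.
  move=> b0; rewrite tofrac_eq0; apply: contraNneq b0 => e; apply/eqP/mpolyP => m.
  have := congr1 (mcoeff m) e; rewrite mcoeff_map_mpoly !mcoeff0 /= => /eqP.
  by rewrite fmorph_eq0 => /eqP.
have h x : exists y, forall a b : {mpoly L[n]}, b != 0 -> x = tofrac a / tofrac b ->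
    y = tofrac (map_mpoly P a) / tofrac (map_mpoly P b).
  have [a [b [b0 ->]]] := fractionP x.
  exists (tofrac (map_mpoly P a) / tofrac (map_mpoly P b)) => a' b' b'0 /eqP.
  rewrite eqr_div ?tofrac_eq0 // -!tofracM tofrac_eq => /eqP e; apply/eqP.
  by rewrite eqr_div ?nz // -!tofracM -!rmorphM e.
by have [F hF] := choice h; exists F => a b b0; apply: hF.
Qed.

Definition preim_sf (L L' : fieldType) (P : {rmorphism L -> L'}) (F : subfield L') : subfield L.
refine (@Subfield L (fun x => F (P x)) _ _ _).
- by rewrite rmorph1; apply: sf_1.
- by move=> x y hx hy; rewrite rmorphB; apply: sf_B.
- by move=> x y hx hy; rewrite fmorph_div; apply: sf_div.
Defined.

Section Dynamics.
Variables (L : fieldType) (sigma : {rmorphism L -> L}).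

Definition fixed : subfield L.
refine (@Subfield L (fun x => sigma x = x) _ _ _).
- exact: rmorph1.
- by move=> x y hx hy; rewrite rmorphB hx hy.
- by move=> x y hx hy; rewrite fmorph_div hx hy.
Defined.

Definition sfI (F F' : subfield L) : subfield L.
refine (@Subfield L (fun x => F x /\ F' x) _ _ _).
- by split; apply: sf_1.
- by move=> x y [? ?] [? ?]; split; apply: sf_B.
- by move=> x y [? ?] [? ?]; split; apply: sf_div.
Defined.

(* An element of W with the fewest monomials, normalised to have a coefficient
   equal to 1, is fixed: applying sigma and subtracting kills that monomial. *)
Lemma fixed_mpoly n (W : {mpoly L[n]} -> Prop) :
  (forall p q, W p -> W q -> W (p - q)) ->
  (forall p m, W p -> p@_m != 0 -> W ((p@_m)^-1 *: p)) ->
  (forall p, W p -> W (map_mpoly sigma p)) ->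
  (exists2 p, W p & p != 0) ->
  exists p, [/\ W p, p != 0 & forall m, fixed p@_m].
Proof.
move=> WB WZ Wsigma [p0 Wp0 p0n0].
pose P l := `[< exists p, [/\ W p, p != 0 & size (msupp p) = l] >].
have exP : exists l, P l by exists (size (msupp p0)); apply/asboolP; exists p0.
case: (ex_minnP exP) => l /asboolP[p [Wp pn0 sp]] mn.
have [m mp] : exists m, m \in msupp p.
  by exists (mlead p); apply: mlead_supp.
have pm0 : p@_m != 0 by rewrite -mcoeff_msupp.
pose p1 := (p@_m)^-1 *: p.
have p1m : p1@_m = 1 by rewrite mcoeffZ mulVf.
have p1n0 : p1 != 0 by apply: contra_eqT p1m => /negbNE/eqP ->; rewrite mcoeff0 eq_sym oner_eq0.
have Wp1 : W p1 by apply: WZ.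
exists p1; split=> // m'.
pose q := map_mpoly sigma p1 - p1.
have [q0|qn0] := eqVneq q 0.
  have := congr1 (mcoeff m') q0; rewrite mcoeffB mcoeff_map_mpoly mcoeff0.
  by move/eqP; rewrite subr_eq0 => /eqP.
have /mn : P (size (msupp q)) by apply/asboolP; exists q; split=> //; apply: WB => //; apply: Wsigma.
rewrite leqNgt => /negP[]; rewrite -sp.
apply: leq_ltn_trans (_ : size (rem m (msupp p)) < _)%N; last first.
  by rewrite size_rem // prednK // (leq_trans _ (_ : 0 < size (msupp p))%N) // lt0n size_eq0; apply: contraTneq mp => ->.
apply: uniq_leq_size; first exact: msupp_uniq.
move=> u; rewrite mcoeff_msupp (mem_rem_uniq _ (msupp_uniq p)) !inE mcoeffB mcoeff_map_mpoly /=.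
move=> h; apply/andP; split.
  by apply: contraNneq h => ->; rewrite p1m rmorph1 subrr.
rewrite mcoeff_msupp; apply: contraNneq h => e.
by rewrite mcoeffZ e mulr0 rmorph0 subrr.
Qed.

Lemma meval_map_mpoly n (p : {mpoly L[n]}) v :
  (map_mpoly sigma p).@[sigma \o v] = sigma p.@[v].
Proof.
have := @mpoly_rmorph_ext L L n (meval (sigma \o v) \o map_mpoly sigma) (sigma \o meval v).
apply=> [c|i] /=; first by rewrite map_mpolyC !mevalC.
by rewrite map_mpolyX !mevalXU.
Qed.

(** A linear disjointness statement. The relations over [M] are stable under sigma because the [v i]
    are fixed; one with fixed coefficients contradicts independence over the smaller field. *)
Lemma aind_fixed_sub (M : subfield L) n (v : 'I_n -> L) :
  (forall x, M x -> M (sigma x)) -> (forall i, fixed (v i)) ->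
  aind (sfI fixed M) v -> aind M v.
Proof.
move=> Ms vfix hv p pM pv; apply/eqP/negPn/negP => pn0.
have [] := @fixed_mpoly n (fun p => p \in mover M n /\ p.@[v] = 0).
- move=> q r [qM qv] [rM rv]; split; last by rewrite mevalB qv rv subrr.
  by move: qM rM; apply: rpredB.
- move=> q m [qM qv] qm; split; last by rewrite mevalZ qv mulr0.
  by apply: mpolyOverZ => //; rewrite rpredV; move/mpolyOverP: qM.
- move=> q [/mpolyOverP qM qv]; split.
    apply/mpolyOverP => m; rewrite mcoeff_map_mpoly.
    by apply/sf_predP/Ms/sf_predP.
  have -> : v = sigma \o v by apply/funext => i /=; rewrite (vfix i).
  by rewrite meval_map_mpoly qv rmorph0.
- by exists p.
move=> q [[/mpolyOverP qM qv] q0 qfix]; case/eqP: q0; apply: hv => //.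
by apply/mpolyOverP => m; apply/sf_predP; split=> //; apply/sf_predP.
Qed.

(** The Casorati argument: a nonzero polynomial with arbitrary coefficients that vanishes along the
    orbit yields one with fixed coefficients, whose values on the orbit are iterates of its value at
    [v]. As sigma is injective, that value is zero. *)
Lemma aind_fixed_orbit n (v : 'I_n -> L) (p : {mpoly L[n]}) : aind fixed v ->
  (forall i, p.@[fun j => iter i sigma (v j)] = 0) -> p = 0.
Proof.
move=> hv pv; apply/eqP/negPn/negP => pn0.
pose orb i j := iter i sigma (v j).
have orbS i : orb i.+1 = sigma \o orb i by apply/funext.
have ev_orb i (q : {mpoly L[n]}) : (forall m, fixed q@_m) -> q.@[orb i] = iter i sigma q.@[v].
  move=> qf; elim: i => [//|i IH]; rewrite iterS -IH -meval_map_mpoly orbS.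
  by congr (meval _ _); apply/mpolyP => m; rewrite mcoeff_map_mpoly; exact: (esym (qf m)).
(* Vanishing is asked only from some index on: applying sigma to the coefficients moves the zeros
   one step along the orbit and says nothing at [v] itself. *)
have [] := @fixed_mpoly n (fun p => exists i0, forall i, (i0 <= i)%N -> p.@[orb i] = 0).
- move=> q r [i hi] [i' hi']; exists (maxn i i') => l; rewrite geq_max => /andP[h h'].
  by rewrite mevalB hi // hi' // subrr.
- by move=> q m [i hi] _; exists i => l h; rewrite mevalZ hi // mulr0.
- move=> q [i hi]; exists i.+1 => -[//|l] h.
  by rewrite orbS meval_map_mpoly hi // rmorph0.
- by exists p => //; exists 0%N => i _; apply: pv.
move=> q [[i hi] q0 qf]; case/eqP: q0; apply: hv.
  by apply/mpolyOverP => m; apply/sf_predP.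
have := hi i (leqnn i); rewrite ev_orb // => /eqP e; apply/eqP; move: e.
by elim: i {hi} => //= i IH; rewrite fmorph_eq0.
Qed.

(** * Orbits contained in finitely many rational families *)

Section Nice.
Variables (N : nat) (g : nat -> 'I_N -> L).
Local Notation Fr := {fraction {mpoly L[N]}}.

Definition spec (eta : 'I_N -> L) (theta : Fr) (c : L) : Prop :=
  exists a b : {mpoly L[N]},
    [/\ b.@[eta] != 0, theta = tofrac a / tofrac b & c = a.@[eta] / b.@[eta]].

Lemma eval_neq0 eta (b : {mpoly L[N]}) : b.@[eta] != 0 -> tofrac b != 0.
Proof. by apply: contraNneq => /eqP; rewrite tofrac_eq0 => /eqP ->; rewrite meval0. Qed.

Lemma spec_poly eta a : spec eta (tofrac a) a.@[eta].
Proof. by exists a, 1; rewrite meval1 oner_eq0 tofrac1 !divr1. Qed.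

Lemma specC eta c : spec eta (tofrac c%:MP) c.
Proof. by have := spec_poly eta c%:MP; rewrite mevalC. Qed.

Lemma specB eta s c t d : spec eta s c -> spec eta t d -> spec eta (s - t) (c - d).
Proof.
move=> [a [b [b0 -> ->]]] [a' [b' [b'0 -> ->]]].
exists (a * b' - a' * b), (b * b'); split.
- by rewrite mevalM mulf_neq0.
- by rewrite (sub_fractions _ _ (eval_neq0 b0) (eval_neq0 b'0)) tofracB !tofracM.
- by rewrite (sub_fractions _ _ b0 b'0) mevalB !mevalM.
Qed.

Lemma specM eta s c t d : spec eta s c -> spec eta t d -> spec eta (s * t) (c * d).
Proof.
move=> [a [b [b0 -> ->]]] [a' [b' [b'0 -> ->]]].
exists (a * a'), (b * b'); split; first by rewrite mevalM mulf_neq0.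
  by rewrite mulf_div !tofracM.
by rewrite mulf_div !mevalM.
Qed.

Lemma specD eta s c t d : spec eta s c -> spec eta t d -> spec eta (s + t) (c + d).
Proof.
move=> h1 h2; rewrite -[t]opprK -[d]opprK; apply: specB => //.
rewrite -[- t]sub0r -[- d]sub0r; apply: specB => //.
by have := specC eta 0; rewrite mpolyC0 tofrac0.
Qed.

Lemma spec0 eta c : spec eta 0 c -> c = 0.
Proof.
move=> [a [b [b0 /esym/eqP]]]; rewrite mulf_eq0 invr_eq0 (negPf (eval_neq0 b0)) orbF.
by rewrite tofrac_eq0 => /eqP -> ->; rewrite meval0 mul0r.
Qed.

Lemma specV eta s c : c != 0 -> spec eta s c -> spec eta s^-1 c^-1.
Proof.
move=> c0 [a [b [b0 -> e]]]; exists b, a; rewrite !invf_div; split=> //.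
  by move: c0; rewrite e mulf_eq0 negb_or => /andP[].
by rewrite e invf_div.
Qed.

Lemma spec_mpoly eta n (s : 'I_n -> Fr) (c : 'I_n -> L) (p : {mpoly L[n]}) :
  (forall i, spec eta (s i) (c i)) ->
  spec eta (mmap (@tofrac _ \o @mpolyC N L) s p) p.@[c].
Proof.
move=> h; elim/mpolyind: p => [|a m p _ _ IH].
  by rewrite mmap0 meval0; have := specC eta 0; rewrite mpolyC0 tofrac0.
rewrite mmapD mmapZ mmapX mevalD mevalZ mevalX /=; apply: specD IH; apply: specM.
  exact: specC.
rewrite /mmap1; elim/big_ind2: _ => [|s1 c1 s2 c2|i _]; [|exact: specM|].
  by have := specC eta 1; rewrite mpolyC1 tofrac1.
elim: (m i) => [|l IHl]; last by rewrite !exprS; apply: specM.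
by rewrite !expr0; have := specC eta 1; rewrite mpolyC1 tofrac1.
Qed.

(** The list depends on [x] but not on [i]; which member is used at time [i] is left open, since the
    local formulas for the action may change along the orbit. *)
Definition nice (x : L) : Prop := exists s : seq Fr, forall i, exists2 theta,
  theta \in s & spec (g i) theta (iter i sigma x).

Lemma nice_fixed x : sigma x = x -> nice x.
Proof.
move=> hx; exists [:: tofrac x%:MP] => i; exists (tofrac x%:MP); first by rewrite inE.
by rewrite iter_fix //; apply: specC.
Qed.

Lemma iter_rmorphB i : {morph iter i sigma : x y / x - y}.
Proof. by move=> x y; elim: i => //= i ->; rewrite rmorphB. Qed.

Lemma iter_fmorph_div i : {morph iter i sigma : x y / x / y}.
Proof. by move=> x y; elim: i => //= i ->; rewrite fmorph_div. Qed.

Lemma iter_fmorph_eq0 i x : (iter i sigma x == 0) = (x == 0).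
Proof. by elim: i => //= i IH; rewrite fmorph_eq0. Qed.

(** Differences and quotients only lengthen the lists, so niceness has to be checked only on
    generators of a function field. *)
Definition nice_sf : subfield L.
refine (@Subfield L nice _ _ _).
- by apply: nice_fixed; apply: rmorph1.
- move=> x y [s hs] [t ht]; exists [seq a - b | a <- s, b <- t] => i.
  have [a ha sa] := hs i; have [b hb sb] := ht i.
  by exists (a - b); [apply: allpairs_f | rewrite iter_rmorphB; apply: specB].
- move=> x y [s hs] [t ht]; have [->|y0] := eqVneq y 0.
    by rewrite invr0 mulr0; apply: nice_fixed; apply: rmorph0.
  exists [seq a / b | a <- s, b <- t] => i.
  have [a ha sa] := hs i; have [b hb sb] := ht i.
  exists (a / b); first exact: allpairs_f.
  rewrite iter_fmorph_div; apply: specM => //; apply: specV => //.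
  by rewrite iter_fmorph_eq0.
Defined.

(** If n > N, then for every choice [t] of one family per function the n chosen elements of L(X_1,
    ..., X_N) satisfy a relation [q t] over [L]. At each time some choice is the true one, so the
    product of all [q t] vanishes along the orbit, although its coefficients need not be fixed. The
    Casorati argument makes this product zero, a contradiction. *)
Lemma nice_bound n (v : 'I_n -> L) : (forall i, nice (v i)) -> aind fixed v -> (n <= N)%N.
Proof.
move=> hn hv; rewrite leqNgt; apply/negP => lt_Nn.
have [l hl] := choice hn.
(* A common bound on the lengths leaves finitely many choices; a position past the end of a list
   reads as the fraction 0, which is harmless. *)
pose M := (\max_i size (l i))%N.
pose theta (t : {ffun 'I_n -> 'I_M}) i := nth 0 (l i) (t i).
pose j : {rmorphism L -> Fr} := @tofrac _ \o @mpolyC N L.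
have dep t : exists2 q : {mpoly L[n]}, q != 0 & mmap j (theta t) q = 0.
  apply: contrapT => nq.
  have : alg_indep j [tuple theta t i | i < n].
    move=> q; have -> : tnth [tuple theta t i | i < n] = theta t.
      by apply/funext => i; rewrite tnth_mktuple.
    by move=> e; apply: contrapT => q0; apply: nq; exists q => //; apply/eqP.
  move=> /alg_indepE/aind_bound; move=> /(_ [seq tofrac 'X_i | i : 'I_N]).
  rewrite size_map size_enum_ord leqNgt lt_Nn => /= ab; suff: false by [].
  apply: ab => i.
  apply: gen_cl; move: (tnth _ _) => x {i}.
  set G := gen _.
  have GX (a : {mpoly L[N]}) : G (tofrac a).
    have -> : tofrac a = mmap j (fun i => tofrac 'X_i) a.
      have := @mpoly_rmorph_ext L Fr N (@tofrac _) (mmap j (fun i => tofrac 'X_i)).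
      by apply=> [c|i] /=; rewrite ?mmapC ?mmapX ?mmap1U.
    apply: sf_mmap => [c|i]; apply: gen_sub; first by left; exists c.
    by right; apply/mapP; exists i; rewrite ?mem_enum.
  by have [a [b [b0 ->]]] := fractionP x; apply: sf_div.
have [q hq0 hq] : exists2 q : {ffun 'I_n -> 'I_M} -> {mpoly L[n]},
    forall t, q t != 0 & forall t, mmap j (theta t) (q t) = 0.
  have dep' t : exists q : {mpoly L[n]}, q != 0 /\ mmap j (theta t) q = 0.
    by have [q] := dep t; exists q.
  have [q hq] := choice dep'; exists q => t; by case: (hq t).
have P0 : \prod_t q t = 0.
  apply: (aind_fixed_orbit hv) => i.
  have hi a : exists u : 'I_M, spec (g i) (nth 0 (l a) u) (iter i sigma (v a)).
    have [th thl sp] := hl a i.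
    have lt_M : (index th (l a) < M)%N.
      by apply: leq_trans (leq_bigmax a); rewrite index_mem.
    by exists (Ordinal lt_M); rewrite nth_index.
  have [u hu] := choice hi.
  rewrite rmorph_prod; apply/eqP; rewrite prodf_seq_eq0; apply/hasP.
  exists (finfun u); first exact: mem_index_enum.
  apply/eqP/(@spec0 (g i)); rewrite -(hq (finfun u)); apply: spec_mpoly => a.
  by rewrite /theta ffunE.
by move/eqP: P0; rewrite prodf_seq_eq0 => /hasP[t _]; rewrite (negPf (hq0 t)) andbF.
Qed.

End Nice.
End Dynamics.

Lemma nice_map (L L' : fieldType) (P : {rmorphism L -> L'}) (sigma : {rmorphism L -> L})
    (sigma' : {rmorphism L' -> L'}) N (g : nat -> 'I_N -> L) x :
  (forall y, sigma' (P y) = P (sigma y)) ->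
  nice sigma g x -> nice sigma' (fun i => P \o g i) (P x).
Proof.
move=> com [s hs]; have [F hF] := fraction_map P N; exists (map F s) => i.
have [theta th [a [b [b0 e c]]]] := hs i; exists (F theta); first exact: map_f.
have mE (q : {mpoly L[N]}) : (map_mpoly P q).@[P \o g i] = P q.@[g i].
  have := @mpoly_rmorph_ext L L' N (meval (P \o g i) \o map_mpoly P) (P \o meval (g i)).
  apply=> [d|j] /=; first by rewrite map_mpolyC !mevalC.
  by rewrite map_mpolyX !mevalXU.
have bn0 : b != 0 by apply: contraNneq b0 => ->; rewrite meval0.
exists (map_mpoly P a), (map_mpoly P b); rewrite !mE e hF // fmorph_eq0; split=> //.
have -> : iter i sigma' (P x) = P (iter i sigma x) by elim: i {hs b0 c mE} => //= i ->.
by rewrite c fmorph_div.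
Qed.

(** * Function fields *)

Section FunctionFields.
Variables (k : fieldType) (K : closedFieldType) (iota : {rmorphism k -> K}).
Implicit Types X Y Z : ivar iota.

Lemma frac_of_zmod X : zmod_morphism (frac_of X).
Proof. by move=> p q; apply: frac_ofB. Qed.

Lemma frac_of_monoid X : monoid_morphism (frac_of X).
Proof.
split; last by move=> p q; apply: frac_ofM.
by rewrite /frac_of rmorph1 tofrac1.
Qed.

HB.instance Definition _ X := GRing.isZmodMorphism.Build
  {mpoly k[qp_N X]} (fracring X) (frac_of X) (@frac_of_zmod X).
HB.instance Definition _ X := GRing.isMonoidMorphism.Build
  {mpoly k[qp_N X]} (fracring X) (frac_of X) (@frac_of_monoid X).

Lemma vanishM X p q : (p * q \in vanish X) = (p \in vanish X) || (q \in vanish X).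
Proof. by rewrite -!frac_of_eq0 frac_ofM mulf_eq0. Qed.

Lemma notin_vanish1 X : (1 : {mpoly k[qp_N X]}) \notin vanish X.
Proof. by rewrite -frac_of_eq0 rmorph1 oner_eq0. Qed.

Lemma frac_of_neq0 X p : p \notin vanish X -> frac_of X p != 0.
Proof. by rewrite frac_of_eq0. Qed.

Definition ffsf X : subfield (fracring X).
refine (@Subfield _ (@funfield k K iota X) _ _ _).
- exists 0%N, 1, 1; rewrite dhomog1 notin_vanish1 rmorph1 divr1.
  by split.
- move=> _ _ [d [A [B [hA hB vB ->]]]] [d' [A' [B' [hA' hB' vB' ->]]]].
  exists (d + d')%N, (A * B' - A' * B), (B * B'); split.
  + by apply: rpredB; [apply: dhomogM | rewrite addnC; apply: dhomogM].
  + exact: dhomogM.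
  + by rewrite vanishM negb_or vB.
  + by rewrite sub_fractions ?frac_of_neq0 // frac_ofB !frac_ofM.
- move=> _ _ [d [A [B [hA hB vB ->]]]] [d' [A' [B' [hA' hB' vB' ->]]]].
  have [vA'|vA'] := boolP (A' \in vanish X).
    exists 0%N, 0, 1; rewrite dhomog1 notin_vanish1 rmorph1 dhomog0; split=> //.
    by move: vA'; rewrite -frac_of_eq0 => /eqP ->; rewrite rmorph0 !mul0r invr0 mulr0.
  exists (d + d')%N, (A * B'), (B * A'); split.
  + exact: dhomogM.
  + exact: dhomogM.
  + by rewrite vanishM negb_or vB.
  + by rewrite invf_div mulf_div !frac_ofM.
Defined.

Definition ff X : fieldType := sf (ffsf X).
Definition ffv X : ff X -> fracring X := sfv (ffsf X).
HB.instance Definition _ X := GRing.RMorphism.on (@ffv X).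

Lemma ffv_inj X : injective (@ffv X). Proof. exact: sfv_inj. Qed.

Variant repr_spec X (f : ff X) : Prop :=
  Repr d (A B : {mpoly k[qp_N X]}) of A \is d.-homog & B \is d.-homog
    & B \notin vanish X & ffv f = frac_of X A / frac_of X B.

Lemma reprP X (f : ff X) : repr_spec f.
Proof. by have [d [A [B [hA hB vB e]]]] := @sfvP _ (ffsf X) f; apply: (Repr hA hB vB e). Qed.

Lemma ff_lift X x : funfield x -> exists f : ff X, ffv f = x.
Proof. by move=> h; have [y hy] := @sf_lift _ (ffsf X) x h; exists y. Qed.

Lemma ff_frac X d (A B : {mpoly k[qp_N X]}) : A \is d.-homog -> B \is d.-homog ->
  B \notin vanish X -> exists f : ff X, ffv f = frac_of X A / frac_of X B.
Proof. by move=> hA hB vB; apply: ff_lift; exists d, A, B. Qed.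

Lemma dhomog_const n c : (c%:MP : {mpoly k[n]}) \is 0.-homog.
Proof. by rewrite -[c%:MP]mulr1 mul_mpolyC; apply/rpredZ/dhomog1. Qed.

Lemma cst_exists X c : exists f : ff X, ffv f = frac_const X c.
Proof.
apply: ff_lift; exists 0%N, c%:MP, 1.
by rewrite dhomog1 notin_vanish1 rmorph1 divr1 dhomog_const.
Qed.

Definition cst X (c : k) : ff X := projT1 (cid (cst_exists X c)).

Lemma ffv_cst X c : ffv (cst X c) = frac_const X c.
Proof. by rewrite /cst; case: cid. Qed.

Lemma cst_zmod X : zmod_morphism (cst X).
Proof.
move=> a b; apply: ffv_inj; rewrite rmorphB /= !ffv_cst /frac_const.
by rewrite [in LHS]rmorphB /= frac_ofB.
Qed.

Lemma cst_monoid X : monoid_morphism (cst X).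
Proof.
split=> [|a b]; apply: ffv_inj; rewrite ?rmorph1 ?rmorphM /= !ffv_cst /frac_const.
  by rewrite mpolyC1 rmorph1.
by rewrite [in LHS]rmorphM /= frac_ofM.
Qed.

HB.instance Definition _ X := GRing.isZmodMorphism.Build k (ff X) (cst X) (@cst_zmod X).
HB.instance Definition _ X := GRing.isMonoidMorphism.Build k (ff X) (cst X) (@cst_monoid X).

Definition ksf X : subfield (ff X) := rng (cst X).

Lemma ffv_mmap X n (f : 'I_n -> ff X) q :
  ffv (mmap (cst X) f q) = mmap (frac_const X) (fun i => ffv (f i)) q.
Proof.
have := @mpoly_rmorph_ext k (fracring X) n (@ffv X \o mmap (cst X) f)
  (mmap (frac_of X \o @mpolyC _ _) (fun i => ffv (f i))).
by apply=> [c|i] /=; rewrite ?mmapC ?mmapX ?mmap1U //; apply: ffv_cst.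
Qed.

Lemma aindP X n (f : 'I_n -> ff X) :
  aind (ksf X) f <-> forall q, mmap (cst X) f q = 0 -> q = 0.
Proof. exact: aind_rngP. Qed.

Lemma aind_ff X n (f : 'I_n -> ff X) :
  aind (ksf X) f <-> alg_indep (frac_const X) [tuple ffv (f i) | i < n].
Proof.
rewrite aindP /alg_indep.
have -> : tnth [tuple ffv (f i) | i < n] = fun i => ffv (f i).
  by apply/funext => i; rewrite tnth_mktuple.
split=> h q e; apply: h; last by rewrite -ffv_mmap e rmorph0.
by apply: ffv_inj; rewrite ffv_mmap e rmorph0.
Qed.

Section Coordinates.
Variables (X : ivar iota) (a : 'I_(qp_N X)).
Hypothesis va : 'X_a \notin vanish X.

Lemma coord_exists i : exists f : ff X, ffv f = frac_of X 'X_i / frac_of X 'X_a.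
Proof. by apply: (@ff_frac _ 1) => //; rewrite dhomogX; apply/eqP/mdeg1. Qed.

Definition acoord i : ff X := projT1 (cid (coord_exists i)).

Lemma ffv_coord i : ffv (acoord i) = frac_of X 'X_i / frac_of X 'X_a.
Proof. by rewrite /acoord; case: cid. Qed.

(** Dehomogenisation in the chart where X_a is nonzero. *)
Lemma ffv_mmap_coord d (A : {mpoly k[qp_N X]}) : A \is d.-homog ->
  ffv (mmap (cst X) acoord A) = frac_of X A / frac_of X 'X_a ^+ d.
Proof.
move=> /dhomogP hA; have fa0 := frac_of_neq0 va.
rewrite ffv_mmap {2}(mpolyE A) rmorph_sum /= mulr_suml; apply: eq_big_seq => m hm.
rewrite -mul_mpolyC frac_ofM -mulrA; congr (_ * _).
have -> : d = (\sum_i m i)%N by rewrite -mdegE; apply/esym/hA.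
rewrite mpolyXE_id rmorph_prod /= expr_sum -prodfV -big_split; apply: eq_bigr => i _ /=.
by rewrite ffv_coord expr_div_n rmorphXn.
Qed.

(** A fraction of forms of equal degree is the fraction of their dehomogenisations, the powers of
    X_a cancelling. Whatever defines a subfield of k(X) is checked on these generators. *)
Lemma acoord_gen f : gen (adj (ksf X) [seq acoord i | i <- enum 'I_(qp_N X)]) f.
Proof.
have [d A B hA hB vB e] := reprP f.
have fa0 : frac_of X 'X_a ^+ d != 0 by rewrite expf_neq0 // frac_of_neq0.
have -> : f = mmap (cst X) acoord A / mmap (cst X) acoord B.
  apply: ffv_inj; rewrite fmorph_div /= (ffv_mmap_coord hA) (ffv_mmap_coord hB) e.
  by rewrite invf_div mulrA divfK.
by apply: sf_div; apply: sf_mmap => [c|i]; apply: gen_sub;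
  [left; exists c | right; apply/mapP; exists i; rewrite ?mem_enum
  |left; exists c | right; apply/mapP; exists i; rewrite ?mem_enum].
Qed.

End Coordinates.

Lemma coord_var_exists X : exists a : 'I_(qp_N X), 'X_a \notin vanish X.
Proof.
have [[v hv] _] := iv_irr X; have := hv; rewrite inE => /andP[/rV0Pn[a va] _].
exists a; apply/negP => /vanishP/(_ _ hv)/eqP.
by rewrite /ev mmapX mmap1U (negPf va).
Qed.

(** A crude bound, enough for the maxima defining transcendence degrees to exist, so that the
    default value 0 of [natmax] does not interfere. *)
Lemma ff_bound X n (f : 'I_n -> ff X) : aind (ksf X) f -> (n <= qp_N X)%N.
Proof.
have [a va] := coord_var_exists X.
move=> hf; have := @aind_bound _ _ _ f [seq acoord va i | i <- enum 'I_(qp_N X)] hf.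
by rewrite size_map size_enum_ord; apply=> i; apply/gen_cl/acoord_gen.
Qed.

Definition is_trdeg X (S : ff X -> Prop) (m : nat) : Prop :=
  (exists f : 'I_m -> ff X, (forall i, S (f i)) /\ aind (ksf X) f) /\
  forall n (f : 'I_n -> ff X), (forall i, S (f i)) -> aind (ksf X) f -> (n <= m)%N.

Lemma trdegP X (S : ff X -> Prop) (S' : fracring X -> Prop) :
  (forall x, S' x <-> exists2 f, S f & ffv f = x) ->
  is_trdeg S (trdeg (frac_const X) S').
Proof.
move=> SS'.
pose P n := exists f : 'I_n -> ff X, (forall i, S (f i)) /\ aind (ksf X) f.
pose Q n := exists2 x : n.-tuple (fracring X),
            (forall i, S' (tnth x i)) & alg_indep (frac_const X) x.
have PQ n : Q n <-> P n.
  split=> [[x xS xi]|[f [fS fi]]].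
    have hf i : exists f, S f /\ ffv f = tnth x i.
      by have /SS'[f] := xS i; exists f.
    have [f hf'] := choice hf; exists f; split=> [i|]; first by case: (hf' i).
    apply/aind_ff; rewrite (_ : [tuple _ | _ < _] = x) //.
    by apply: eq_from_tnth => i; rewrite tnth_mktuple; case: (hf' i).
  exists [tuple ffv (f i) | i < n]; last by apply/aind_ff.
  by move=> i; rewrite tnth_mktuple; apply/SS'; exists (f i).
have bP n : P n -> (n <= qp_N X)%N by move=> [f [_ /ff_bound]].
pose Pb n := `[< P n >].
have exP : exists n, Pb n.
  exists 0%N; apply/asboolP; exists (fun i : 'I_0 => 0); split; first by case.
  by apply/aind_chain; rewrite enum_ord0.
have ubP n : Pb n -> (n <= qp_N X)%N by move/asboolP/bP.
case: (ex_maxnP exP ubP) => m /asboolP Pm mx.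
suff -> : trdeg (frac_const X) S' = m.
  split=> // n f fS fi; apply: mx; apply/asboolP; by exists f.
apply: natmaxE; split; first by apply/PQ.
by move=> n /PQ hn; apply: mx; apply/asboolP.
Qed.

Lemma dim_varP X : is_trdeg (fun _ : ff X => True) (dim_var X).
Proof.
apply: trdegP => x; split=> [/ff_lift[f hf]|[f _ <-]]; first by exists f.
exact: (@sfvP _ (ffsf X) f).
Qed.

(** Dominance in terms of ideals: substitution preserves and reflects the vanishing of forms, which
    makes substitution in fractions well defined. Systems, projections and translations all provide
    such maps. *)
Record dmap X Y := DMap {
  dm_tuple :> (qp_N Y).-tuple {mpoly k[qp_N X]};
  dm_deg : exists d, forall i, tnth dm_tuple i \is d.-homog;
  dm_vanish : forall A, A \is homog mdeg ->
    (A \mPo dm_tuple \in vanish X) = (A \in vanish Y)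
}.

Lemma dm_comp_homog X Y (P : dmap X Y) : exists e, forall d A, A \is d.-homog ->
  A \mPo P \is (d * e).-homog.
Proof. by have [e he] := dm_deg P; exists e => d A hA; apply: dhomog_comp. Qed.

Lemma dm_notin X Y (P : dmap X Y) d A : A \is d.-homog -> A \notin vanish Y ->
  A \mPo P \notin vanish X.
Proof. by move=> hA; rewrite dm_vanish //; apply: homogE hA. Qed.

Lemma pb_exists X Y (P : dmap X Y) (f : ff Y) : exists g : ff X,
  forall d A B, A \is d.-homog -> B \is d.-homog -> B \notin vanish Y ->
    ffv f = frac_of Y A / frac_of Y B ->
    ffv g = frac_of X (A \mPo P) / frac_of X (B \mPo P).
Proof.
have [d A B hA hB vB e] := reprP f; have [de hde] := dm_comp_homog P.
have [g hg] := ff_frac (hde _ _ hA) (hde _ _ hB) (dm_notin P hB vB).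
exists g => d' A' B' hA' hB' vB'; rewrite e hg => /(frac_eq _ _ vB vB') h.
apply/frac_eq; rewrite ?(dm_notin P hB) ?(dm_notin P hB') //.
rewrite -!rmorphM -rmorphB dm_vanish //.
by apply: (@homogE _ _ _ (d + d')); apply: rpredB; [|rewrite addnC]; apply: dhomogM.
Qed.

Definition pb X Y (P : dmap X Y) (f : ff Y) : ff X := projT1 (cid (pb_exists P f)).

Lemma pbE X Y (P : dmap X Y) f d A B : A \is d.-homog -> B \is d.-homog ->
  B \notin vanish Y -> ffv f = frac_of Y A / frac_of Y B ->
  ffv (pb P f) = frac_of X (A \mPo P) / frac_of X (B \mPo P).
Proof. by rewrite /pb; case: cid => g hg; apply: hg. Qed.

Lemma pb_zmod X Y (P : dmap X Y) : zmod_morphism (pb P).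
Proof.
move=> f f'; apply: ffv_inj; rewrite rmorphB /=.
have [d A B hA hB vB e] := reprP f; have [d' A' B' hA' hB' vB' e'] := reprP f'.
rewrite (pbE P hA hB vB e) (pbE P hA' hB' vB' e').
rewrite sub_fractions ?frac_of_neq0 ?(dm_notin P hB) ?(dm_notin P hB') //.
rewrite -!frac_ofM -frac_ofB -!rmorphM -rmorphB.
apply: (@pbE _ _ _ _ (d + d')); first by apply: rpredB; [|rewrite addnC]; apply: dhomogM.
- exact: dhomogM.
- by rewrite vanishM negb_or vB.
- by rewrite rmorphB /= e e' sub_fractions ?frac_of_neq0 // frac_ofB !frac_ofM.
Qed.

Lemma pb_monoid X Y (P : dmap X Y) : monoid_morphism (pb P).
Proof.
split.
  apply: ffv_inj; rewrite (@pbE _ _ _ _ 0 1 1) ?dhomog1 ?notin_vanish1 ?rmorph1 ?divr1 //.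
move=> f f'; apply: ffv_inj; rewrite rmorphM /=.
have [d A B hA hB vB e] := reprP f; have [d' A' B' hA' hB' vB' e'] := reprP f'.
rewrite (pbE P hA hB vB e) (pbE P hA' hB' vB' e') mulf_div -!frac_ofM -!rmorphM.
apply: (@pbE _ _ _ _ (d + d')); rewrite ?dhomogM //.
- by rewrite vanishM negb_or vB.
- by rewrite rmorphM /= e e' mulf_div !frac_ofM.
Qed.

HB.instance Definition _ X Y (P : dmap X Y) :=
  GRing.isZmodMorphism.Build (ff Y) (ff X) (pb P) (@pb_zmod X Y P).
HB.instance Definition _ X Y (P : dmap X Y) :=
  GRing.isMonoidMorphism.Build (ff Y) (ff X) (pb P) (@pb_monoid X Y P).

Lemma pb_cst X Y (P : dmap X Y) c : pb P (cst Y c) = cst X c.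
Proof.
apply: ffv_inj; rewrite (@pbE _ _ P _ 0 c%:MP 1) ?dhomog1 ?dhomog_const ?notin_vanish1 //.
  by rewrite comp_mpolyC rmorph1 rmorph1 divr1 ffv_cst.
by rewrite rmorph1 divr1 ffv_cst.
Qed.

Lemma pb_mmap X Y (P : dmap X Y) n (f : 'I_n -> ff Y) q :
  pb P (mmap (cst Y) f q) = mmap (cst X) (pb P \o f) q.
Proof.
have := @mpoly_rmorph_ext k (ff X) n (pb P \o mmap (cst Y) f) (mmap (cst X) (pb P \o f)).
by apply=> [c|i] /=; rewrite ?mmapC ?pb_cst // !mmapX !mmap1U.
Qed.

Lemma pb_aind X Y (P : dmap X Y) n (f : 'I_n -> ff Y) :
  aind (ksf Y) f <-> aind (ksf X) (pb P \o f).
Proof.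
rewrite !aindP; split=> h q e; apply: h; last by rewrite -pb_mmap e rmorph0.
by apply/eqP; rewrite -(fmorph_eq0 (pb P)) /= pb_mmap e.
Qed.

Lemma eqmx_rV n (u v : 'rV[K]_n) : (u == v)%MS <-> exists2 c, c != 0 & u = c *: v.
Proof.
split=> [/andP[/sub_rVP[c e] h]|[c c0 ->]].
  have [c0|c0] := eqVneq c 0; last by exists c.
  have u0 : u = 0 by rewrite e c0 scale0r.
  exists 1; rewrite ?oner_neq0 // scale1r u0; symmetry.
  by move: h => /sub_rVP[c' ->]; rewrite u0 scaler0.
by apply/eqmxP; apply: eqmx_scale.
Qed.

(** Projectively equal values differ by a scalar, which cancels in a ratio of forms of the same
    degree. Agreement off the zeros of [H] suffices because the vanishing ideal is prime. *)
Lemma comp_ratio_eq X Y (P Q : (qp_N Y).-tuple {mpoly k[qp_N X]}) H d A B :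
  H \notin vanish X ->
  (forall v, v \in pts X -> ev iota H v != 0 -> (evmap iota P v == evmap iota Q v)%MS) ->
  A \is d.-homog -> B \is d.-homog ->
  B \mPo P \notin vanish X -> B \mPo Q \notin vanish X ->
  frac_of X (A \mPo P) / frac_of X (B \mPo P) = frac_of X (A \mPo Q) / frac_of X (B \mPo Q).
Proof.
move=> vH PQ hA hB vP vQ; apply/frac_eq => //.
suff : H * ((A \mPo P) * (B \mPo Q) - (A \mPo Q) * (B \mPo P)) \in vanish X.
  by rewrite vanishM (negPf vH).
apply/vanishP => v hv; rewrite evM; have [->|Hv] := eqVneq (ev iota H v) 0; first by rewrite mul0r.
have /eqmx_rV[c c0 e] := PQ v hv Hv.
move: (ev_comp iota A P v) (ev_comp iota A Q v) (ev_comp iota B P v) (ev_comp iota B Q v).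
move: (A \mPo P) (A \mPo Q) (B \mPo P) (B \mPo Q) => a a' b b' Ea Ea' Eb Eb'.
rewrite evB !evM Ea Ea' Eb Eb' e (ev_scale _ _ _ hA) (ev_scale _ _ _ hB).
by rewrite -mulrA [X in _ - X]mulrCA subrr mulr0.
Qed.

Lemma pb_eq X Y (P Q : dmap X Y) H : H \notin vanish X ->
  (forall v, v \in pts X -> ev iota H v != 0 -> (evmap iota P v == evmap iota Q v)%MS) ->
  pb P =1 pb Q.
Proof.
move=> vH PQ f; have [d A B hA hB vB e] := reprP f; apply: ffv_inj.
rewrite (pbE P hA hB vB e) (pbE Q hA hB vB e).
exact: (comp_ratio_eq vH PQ hA hB (dm_notin P hB vB) (dm_notin Q hB vB)).
Qed.

Definition val_at X (v : 'rV[K]_(qp_N X)) (f : ff X) (c : K) : Prop :=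
  exists d A B, [/\ A \is d.-homog, B \is d.-homog, B \notin vanish X,
    ffv f = frac_of X A / frac_of X B & ev iota B v != 0 /\ c = ev iota A v / ev iota B v].

Lemma val_at0 X v c : v \in pts X -> val_at v (0 : ff X) c -> c = 0.
Proof.
move=> hv [d [A [B [hA hB vB e [Bv ->]]]]].
have : A \in vanish X.
  move/esym/eqP: e; rewrite rmorph0 mulf_eq0 invr_eq0 !frac_of_eq0.
  by rewrite (negPf vB) orbF.
by move=> /vanishP -> //; rewrite mul0r.
Qed.

Lemma val_atD X v (f g : ff X) c e : val_at v f c -> val_at v g e -> val_at v (f + g) (c + e).
Proof.
move=> [d [A [B [hA hB vB E [Bv ->]]]]] [d' [A' [B' [hA' hB' vB' E' [Bv' ->]]]]].
exists (d + d')%N, (A * B' + A' * B), (B * B'); split.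
- by apply: rpredD; [|rewrite addnC]; apply: dhomogM.
- exact: dhomogM.
- by rewrite vanishM negb_or vB.
- by rewrite rmorphD /= E E' addf_div ?frac_of_neq0 // [in RHS]rmorphD /= !frac_ofM.
- by rewrite evM mulf_neq0 // addf_div // -!evM /ev rmorphD.
Qed.

Lemma val_atM X v (f g : ff X) c e : val_at v f c -> val_at v g e -> val_at v (f * g) (c * e).
Proof.
move=> [d [A [B [hA hB vB E [Bv ->]]]]] [d' [A' [B' [hA' hB' vB' E' [Bv' ->]]]]].
exists (d + d')%N, (A * A'), (B * B'); split; try exact: dhomogM.
- by rewrite vanishM negb_or vB.
- by rewrite rmorphM /= E E' mulf_div !frac_ofM.
- by rewrite !evM mulf_neq0 // mulf_div.
Qed.

Lemma val_at_cst X v c : val_at v (cst X c) (iota c).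
Proof.
exists 0%N, c%:MP, 1; rewrite dhomog_const dhomog1 notin_vanish1; split=> //.
  by rewrite rmorph1 divr1 ffv_cst.
by rewrite /ev rmorph1 oner_eq0 mmapC divr1.
Qed.

Lemma val_at_mmap X v n (f : 'I_n -> ff X) (c : 'I_n -> K) q :
  (forall i, val_at v (f i) (c i)) -> val_at v (mmap (cst X) f q) (mmap iota c q).
Proof.
move=> h; elim/mpolyind: q => [|a m q _ _ IH].
  by rewrite !mmap0 -(rmorph0 (cst X)) -(rmorph0 iota); apply: val_at_cst.
rewrite !mmapD !mmapZ !mmapX; apply: val_atD IH; apply: val_atM; first exact: val_at_cst.
have v1 : val_at v (1 : ff X) 1.
  by rewrite -(rmorph1 (cst X)) -(rmorph1 iota); apply: val_at_cst.
rewrite /mmap1; elim/big_ind2: _ => [//|x1 x2 y1 y2|i _]; first exact: val_atM.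
by elim: (m i) => [|l IHl]; rewrite ?expr0 // !exprS; apply: val_atM.
Qed.

Lemma val_at_scale X v (f : ff X) a c : a != 0 -> val_at v f c -> val_at (a *: v) f c.
Proof.
move=> a0 [d [A [B [hA hB vB E [Bv ->]]]]]; exists d, A, B; split=> //.
rewrite (ev_scale _ _ _ hA) (ev_scale _ _ _ hB) mulf_neq0 ?expf_neq0 //; split=> //.
by rewrite -mulf_div divff ?expf_neq0 // mul1r.
Qed.

Lemma val_at_pb X Y (P : dmap X Y) v f c : val_at (evmap iota P v) f c -> val_at v (pb P f) c.
Proof.
move=> [d [A [B [hA hB vB E [Bv ->]]]]]; have [e he] := dm_comp_homog P.
exists (d * e)%N, (A \mPo P), (B \mPo P); split; try exact: he.
- exact: (dm_notin P hB vB).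
- exact: (pbE P hA hB vB E).
- by rewrite !ev_comp.
Qed.

Lemma qp_neq_notin X : exists2 g, g \in qp_neqs X & g \notin vanish X.
Proof.
have [[v hv] _] := iv_irr X; have := hv; rewrite inE => /and3P[_ _ /hasP[g gX gv]].
by exists g => //; apply: contraNN gv => /vanishP ->.
Qed.

(* The specialisation f |-> tau extends to the homogeneous coordinate ring, and a
   specialisation of the coordinates is a point of X. *)
Lemma generic_values X a n (f : 'I_n -> ff X) : 'X_a \notin vanish X -> aind (ksf X) f ->
  exists2 alpha : {mpoly k[n]}, alpha != 0 & forall tau : 'I_n -> K,
    mmap iota tau alpha != 0 ->
    exists2 v, v \in pts X & v 0 a != 0 /\ forall i, val_at v (f i) (tau i).
Proof.
move=> va /aindP hf.
have rep i : exists R : nat * {mpoly k[qp_N X]} * {mpoly k[qp_N X]},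
    [/\ R.1.2 \is R.1.1.-homog, R.2 \is R.1.1.-homog, R.2 \notin vanish X
      & ffv (f i) = frac_of X R.1.2 / frac_of X R.2].
  by have [d A B hA hB vB e] := reprP (f i); exists (d, A, B).
have [R hR] := choice rep; have [g gX vg] := qp_neq_notin X.
pose A i := (R i).1.2; pose B i := (R i).2.
have coordF p d : p \is d.-homog -> p \notin vanish X -> mmap (cst X) (acoord va) p != 0.
  move=> hp vp; rewrite -(fmorph_eq0 (@ffv X)) /= (ffv_mmap_coord va hp).
  by rewrite mulf_neq0 ?invr_eq0 ?expf_neq0 ?frac_of_neq0.
have [dg hg] : exists d, g \is d.-homog.
  by apply/homogP; have := qp_homog X; rewrite all_cat => /andP[_ /allP]; apply.
(* The factor [g] puts the specialised point into the open part of X, and the factors [B i] keep the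
   [f i] defined there. *)
pose q := g * \prod_i B i.
have q0 : mmap (cst X) (acoord va) q != 0.
  rewrite /q rmorphM rmorph_prod /= mulf_neq0 ?(coordF _ dg) //.
  by apply/prodf_neq0 => i _; have [_ hB vB _] := hR i; apply: coordF hB vB.
have [alpha al0 hal] := specialize_generic iota hf q0.
exists alpha => // tau /hal[xi [qxi hxi fxi]].
pose v : 'rV[K]_(qp_N X) := \row_i xi i.
have evv p : ev iota p v = mmap iota xi p.
  by rewrite /ev; congr mmap; apply/funext => i; rewrite mxE.
move: qxi; rewrite /q rmorphM rmorph_prod /= mulf_eq0 negb_or => /andP[gxi Bxi].
have va1 : v 0 a = 1.
  have : mmap iota xi ('X_a - 1) = 0.
    apply: hxi; apply: ffv_inj; rewrite rmorphB /= mmapX mmap1U rmorph1 rmorphB /= ffv_coord.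
    by rewrite divff ?frac_of_neq0 // rmorph1 rmorph0 subrr.
  by rewrite rmorphB /= mmapX mmap1U rmorph1 mxE => /eqP; rewrite subr_eq0 => /eqP.
exists v; last first.
  rewrite va1 oner_eq0; split=> // i.
  have [hA hB vB e] := hR i.
  exists (R i).1.1, (A i), (B i); split=> //; rewrite !evv.
  have Bi : mmap iota xi (B i) != 0 by have /prodf_neq0/(_ i isT) := Bxi.
  split=> //; apply: (mulIf Bi); rewrite divfK //; apply: fxi.
  apply: ffv_inj; rewrite rmorphM /= (ffv_mmap_coord va hA) (ffv_mmap_coord va hB).
  by rewrite e mulrA divfK ?frac_of_neq0.
rewrite inE; apply/and3P; split.
- by apply/rV0Pn; exists a; rewrite va1 oner_neq0.
- apply/allP => r rX; rewrite evv; apply/eqP/hxi.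
  have [dr hr] : exists d, r \is d.-homog.
    by apply/homogP; have := qp_homog X; rewrite all_cat => /andP[/allP h _]; apply: h.
  apply: ffv_inj; rewrite (ffv_mmap_coord va hr) rmorph0.
  suff /eqP -> : frac_of X r == 0 by rewrite mul0r.
  rewrite frac_of_eq0; apply/vanishP => w; rewrite inE => /and3P[_ /allP h _].
  by apply/eqP/h.
- by apply/hasP; exists g; rewrite ?evv.
Qed.

End FunctionFields.

(** * Products *)

Section Products.
Variables (k : fieldType) (K : closedFieldType) (iota : {rmorphism k -> K}).
Local Notation evK := (ev (idfun : {rmorphism K -> K})).
Local Notation evmapK := (evmap (idfun : {rmorphism K -> K})).
Implicit Types X Y : qpvar iota.

Lemma ev_map n (p : {mpoly k[n]}) v : evK (map_mpoly iota p) v = ev iota p v.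
Proof.
have := @mpoly_rmorph_ext k K n
  (mmap (idfun : {rmorphism K -> K}) (fun i => v 0 i) \o map_mpoly iota) (mmap iota (fun i => v 0 i)).
by apply=> [c|i] /=; rewrite ?map_mpolyC ?map_mpolyX ?mmapC ?mmapX.
Qed.

Lemma dhomog_map n d (p : {mpoly k[n]}) : p \is d.-homog -> map_mpoly iota p \is d.-homog.
Proof.
move=> /dhomogP hp; apply/dhomogP => m; rewrite mcoeff_msupp mcoeff_map_mpoly => h.
by apply: hp; rewrite mcoeff_msupp; apply: contraNneq h => ->; rewrite /= rmorph0.
Qed.

Lemma homog_map n (p : {mpoly k[n]}) : p \is homog mdeg -> map_mpoly iota p \is homog mdeg.
Proof. by move=> /homogP[d /dhomog_map hp]; apply: homogE hp. Qed.

Lemma evX (F : fieldType) (j : {rmorphism F -> K}) n i (v : 'rV[K]_n) : ev j 'X_i v = v 0 i.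
Proof. by rewrite /ev mmapX mmap1U. Qed.

Lemma homogX (F : fieldType) n i : ('X_i : {mpoly F[n]}) \is homog mdeg.
Proof. by apply: (@homogE _ _ _ 1); rewrite dhomogX; apply/eqP/mdeg1. Qed.

Lemma zclosed_map n (C : 'rV[K]_n -> Prop) : zclosed iota C -> zclosed (idfun : {rmorphism K -> K}) C.
Proof.
move=> [fs /allP hfs hC]; exists (map (map_mpoly iota) fs).
  by apply/allP => _ /mapP[f /hfs hf ->]; apply: homog_map.
move=> v /hC ->; rewrite all_map; split=> /allP h; apply/allP => f /h /=;
  by rewrite ev_map.
Qed.

Lemma geom_irreducible_irreducible X : geom_irreducible X -> irreducible X.
Proof.
by move=> [hX h]; split=> // C D /zclosed_map hC /zclosed_map hD; apply: h.
Qed.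

Lemma geom_form_mul X (p q : {mpoly K[qp_N X]}) v w : geom_irreducible X ->
  p \is homog mdeg -> q \is homog mdeg -> v \in pts X -> w \in pts X ->
  evK p v != 0 -> evK q w != 0 -> exists2 u, u \in pts X & evK p u != 0 /\ evK q u != 0.
Proof.
move=> [_ hX] hp hq hv hw pv qw; apply: contrapT => nu.
have cl (r : {mpoly K[qp_N X]}) : r \is homog mdeg ->
    zclosed (idfun : {rmorphism K -> K}) (fun v : 'rV[K]_(qp_N X) => evK r v = 0).
  move=> hr; exists [:: r]; first by rewrite /= hr.
  by move=> u _; rewrite /= andbT; split=> [->|/eqP].
have [|h|h] := hX _ _ (cl p hp) (cl q hq).
- move=> u hu; have [pu|pu] := eqVneq (evK p u) 0; first by left.
  have [qu|qu] := eqVneq (evK q u) 0; first by right.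
  by case: nu; exists u.
- by move: pv; rewrite h ?eqxx.
- by move: qw; rewrite h ?eqxx.
Qed.

Definition mxtuple (R : comNzRingType) n m l (A : 'M[{mpoly R[l]}]_(n, m)) :
  (n * m).-tuple {mpoly R[l]} := [tuple mxvec A 0 i | i < n * m].

Lemma tnth_mxtuple (R : comNzRingType) n m l (A : 'M[{mpoly R[l]}]_(n, m)) i j :
  tnth (mxtuple A) (mxvec_index i j) = A i j.
Proof. by rewrite tnth_mktuple mxvecE. Qed.

Lemma mxtuple_homog (R : comNzRingType) n m l (A : 'M[{mpoly R[l]}]_(n, m)) d :
  (forall i j, A i j \is d.-homog) -> forall i, tnth (mxtuple A) i \is d.-homog.
Proof. by move=> h i; case/mxvec_indexP: i => a b; rewrite tnth_mxtuple. Qed.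

Lemma evmap_mxtuple (F : fieldType) (j : {rmorphism F -> K}) n m l
    (A : 'M[{mpoly F[l]}]_(n, m)) v :
  evmap j (mxtuple A) v = mxvec (\matrix_(a, b) ev j (A a b) v).
Proof.
by apply/rowP => i; case/mxvec_indexP: i => a b; rewrite mxE tnth_mxtuple mxvecE mxE.
Qed.

Lemma segreE n m (x : 'rV[K]_n) (y : 'rV[K]_m) :
  segre x y = mxvec (\matrix_(i, j) (x 0 i * y 0 j)).
Proof. by congr mxvec; apply/matrixP => i j; rewrite !mxE big_ord1 !mxE. Qed.

Lemma segre_neq0 n m (x : 'rV[K]_n) (y : 'rV[K]_m) : (segre x y != 0) = (x != 0) && (y != 0).
Proof.
apply/idP/andP => [h|[/rV0Pn[i xi] /rV0Pn[j yj]]].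
  split; apply: contraNneq h => ->; rewrite /segre.
    by rewrite trmx0 mul0mx linear0.
  by rewrite mulmx0 linear0.
apply/rV0Pn; exists (mxvec_index i j); rewrite segreE mxvecE mxE.
by rewrite mulf_neq0.
Qed.

Lemma segreZ n m c d (x : 'rV[K]_n) (y : 'rV[K]_m) :
  segre (c *: x) (d *: y) = (c * d) *: segre x y.
Proof.
rewrite !segreE -linearZ; congr mxvec; apply/matrixP => i j; rewrite !mxE.
by rewrite mulrACA.
Qed.

Lemma evmap_zcol_segre n m (b : 'I_m) (x : 'rV[K]_n) (y : 'rV[K]_m) :
  evmap iota (zcol k n b) (segre x y) = y 0 b *: x.
Proof. by rewrite evmap_zcol col_segre. Qed.

Lemma evmap_zrow_segre n m (a : 'I_n) (x : 'rV[K]_n) (y : 'rV[K]_m) :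
  evmap iota (zrow k m a) (segre x y) = x 0 a *: y.
Proof. by rewrite evmap_zrow row_segre. Qed.

Lemma ev_zvar_segre n m (a : 'I_n) (b : 'I_m) (x : 'rV[K]_n) (y : 'rV[K]_m) :
  ev iota (zvar k a b) (segre x y) = x 0 a * y 0 b.
Proof. by rewrite ev_zvar segreE mxvecK mxE. Qed.

Section Slices.
Variables n m : nat.

(** Restriction of forms in Segre coordinates to a slice where one factor is fixed at a K-point. The
    results have coefficients in [K], hence the recourse to geometric irreducibility. *)
Definition slice_l (x : 'rV[K]_n) : (n * m).-tuple {mpoly K[m]} :=
  mxtuple (\matrix_(i, j) ((x 0 i)%:MP * 'X_j)).
Definition slice_r (y : 'rV[K]_m) : (n * m).-tuple {mpoly K[n]} :=
  mxtuple (\matrix_(i, j) ((y 0 j)%:MP * 'X_i)).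

Lemma ev_slice_l (q : {mpoly K[n * m]}) x y : evK (q \mPo slice_l x) y = evK q (segre x y).
Proof.
rewrite ev_comp evmap_mxtuple segreE; congr (ev _ _ (mxvec _)).
by apply/matrixP => i j; rewrite !mxE evM evX /ev mmapC.
Qed.

Lemma ev_slice_r (q : {mpoly K[n * m]}) x y : evK (q \mPo slice_r y) x = evK q (segre x y).
Proof.
rewrite ev_comp evmap_mxtuple segreE; congr (ev _ _ (mxvec _)).
by apply/matrixP => i j; rewrite !mxE evM evX /ev mmapC mulrC.
Qed.

Lemma slice_l_homog (q : {mpoly K[n * m]}) x : q \is homog mdeg -> q \mPo slice_l x \is homog mdeg.
Proof.
move=> /homogP[d hq]; apply: (@homogE _ _ _ (d * 1)); apply: dhomog_comp => // l.
by apply: mxtuple_homog => i j; rewrite mxE mul_mpolyC rpredZ // dhomogX; apply/eqP/mdeg1.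
Qed.

Lemma slice_r_homog (q : {mpoly K[n * m]}) y : q \is homog mdeg -> q \mPo slice_r y \is homog mdeg.
Proof.
move=> /homogP[d hq]; apply: (@homogE _ _ _ (d * 1)); apply: dhomog_comp => // l.
by apply: mxtuple_homog => i j; rewrite mxE mul_mpolyC rpredZ // dhomogX; apply/eqP/mdeg1.
Qed.

End Slices.

Lemma zclosed_slice_r X Y (C : 'rV[K]_(qp_N X * qp_N Y) -> Prop) y : y != 0 ->
  zclosed (idfun : {rmorphism K -> K}) C ->
  zclosed (idfun : {rmorphism K -> K}) (fun x : 'rV[K]_(qp_N X) => C (segre x y)).
Proof.
move=> y0 [fs /allP hfs hC]; exists [seq f \mPo slice_r _ y | f <- fs].
  by apply/allP => _ /mapP[f /hfs hf ->]; apply: slice_r_homog.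
move=> x x0; rewrite hC ?segre_neq0 ?x0 // all_map.
by split=> /allP h; apply/allP => f /h /=; rewrite ev_slice_r.
Qed.

Lemma zclosed_slice_l X Y (C : 'rV[K]_(qp_N X * qp_N Y) -> Prop) x : x != 0 ->
  zclosed (idfun : {rmorphism K -> K}) C ->
  zclosed (idfun : {rmorphism K -> K}) (fun y : 'rV[K]_(qp_N Y) => C (segre x y)).
Proof.
move=> x0 [fs /allP hfs hC]; exists [seq f \mPo slice_l _ x | f <- fs].
  by apply/allP => _ /mapP[f /hfs hf ->]; apply: slice_l_homog.
move=> y y0; rewrite hC ?segre_neq0 ?x0 // all_map.
by split=> /allP h; apply/allP => f /h /=; rewrite ev_slice_l.
Qed.

Lemma pts_neq0 X v : v \in pts X -> v != 0.
Proof. by rewrite inE => /and3P[]. Qed.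

(** By irreducibility of X, each slice with y fixed lies in C or in D. If (x, y) is outside C and
    (x', y') outside D, the closed sets C(x, .) and D(x', .) thus cover Y, against the
    irreducibility of Y. *)
Lemma geom_irreducible_prod X Y : geom_irreducible X -> geom_irreducible Y ->
  geom_irreducible (prodv X Y).
Proof.
move=> [[x0 hx0] hX] [[y0 hy0] hY]; split.
  by exists (segre x0 y0); apply/prod_pts; exists x0, y0.
move=> C D hC hD hCD.
have hy y : y \in pts Y -> (forall x, x \in pts X -> C (segre x y)) \/
    (forall x, x \in pts X -> D (segre x y)).
  move=> yY; apply: hX.
  - by apply: zclosed_slice_r; rewrite ?(pts_neq0 yY).
  - by apply: zclosed_slice_r; rewrite ?(pts_neq0 yY).
  - by move=> x xX; apply: hCD; apply/prod_pts; exists x, y.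
have [hc|/existsNP[u /not_implyP[uZ nC]]] := pselect (forall v, v \in pts (prodv X Y) -> C v).
  by left.
right=> w /prod_pts[x' [y' [x'X y'Y ->]]]; apply: contrapT => nD.
move: uZ nC => /prod_pts[x [y [xX yY ->]]] nC.
have [] := hY (fun y => C (segre x y)) (fun y => D (segre x' y)).
- by apply: zclosed_slice_l; rewrite ?(pts_neq0 xX).
- by apply: zclosed_slice_l; rewrite ?(pts_neq0 x'X).
- by move=> z /hy[h|h]; [left | right]; apply: h.
- by move=> /(_ _ yY).
- by move=> /(_ _ y'Y).
Qed.

(* [dominant] only tests subsets closed over k, which do not survive fixing one
   factor of a product at a K-point; hence this variant over K. *)
Definition geom_dominant X (P : (qp_N X).-tuple {mpoly k[qp_N X]}) : Prop :=
  forall q h : {mpoly K[qp_N X]}, q \is homog mdeg -> h \is homog mdeg ->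
    (exists2 v, v \in pts X & evK h v != 0) ->
    (forall v, v \in pts X -> evmap iota P v != 0 -> evK h v != 0 -> evK q (evmap iota P v) = 0) ->
    forall w, w \in pts X -> evK q w = 0.

Lemma geom_dominant_dominant (X : ivar iota) (P : (qp_N X).-tuple {mpoly k[qp_N X]}) :
  rational_map P -> @geom_dominant X P -> dominant P.
Proof.
move=> [_ [H [hH vH HP]]] hP C [fs /allP hfs hC] CP w hw.
apply/hC; first exact: pts_neq0 hw.
apply/allP => f fs_f; rewrite -ev_map; apply/eqP.
apply: (hP _ (map_mpoly iota H)) hw; try by apply: homog_map => //; apply: hfs.
  apply: contrapT => nv; case/negP: vH; apply/vanishP => v hv.
  apply: contrapT => /eqP Hv; apply: nv; exists v => //.
  by rewrite ev_map.
move=> v hv Pv; rewrite !ev_map => Hv; have PX := HP v hv Hv.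
have /hC := CP v hv PX; move=> /(_ (pts_neq0 PX))/allP/(_ f fs_f)/eqP.
exact.
Qed.

Lemma notin_vanishI (X : ivar iota) p v : v \in pts X -> ev iota p v != 0 -> p \notin vanish X.
Proof. by move=> hv; apply: contraNN => /vanishP ->. Qed.

Section ProductMap.
Variables S T : rds iota.
Hypotheses (gS : geom_irreducible S) (gT : geom_irreducible T).
Variables (a : 'I_(qp_N S)) (b : 'I_(qp_N T)).
Hypotheses (va : 'X_a \notin vanish S) (vb : 'X_b \notin vanish T).

(** A column and a row of the Segre matrix recover x and y up to the factors y_b and x_a, so this is
    phi x psi up to the scalar computed in [prod_map_scale]. *)
Definition prod_map : (qp_N (prodv S T)).-tuple {mpoly k[qp_N (prodv S T)]} :=
  mxtuple (\matrix_(i < qp_N S, j < qp_N T)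
    ((tnth (rds_map S) i \mPo zcol k (qp_N S) b) * (tnth (rds_map T) j \mPo zrow k (qp_N T) a))).

Lemma prod_mapE x y : evmap iota prod_map (segre x y) =
  segre (evmap iota (rds_map S) (y 0 b *: x)) (evmap iota (rds_map T) (x 0 a *: y)).
Proof.
rewrite evmap_mxtuple [RHS]segreE; congr mxvec; apply/matrixP => i j; rewrite !mxE evM !ev_comp.
by rewrite evmap_zcol_segre evmap_zrow_segre.
Qed.

Lemma evmap_scale n m (P : m.-tuple {mpoly k[n]}) d c v :
  (forall i, tnth P i \is d.-homog) -> evmap iota P (c *: v) = c ^+ d *: evmap iota P v.
Proof. by move=> hP; apply/rowP => i; rewrite !mxE (ev_scale _ _ _ (hP i)). Qed.

Lemma prod_map_scale : exists d e, forall x y, evmap iota prod_map (segre x y) =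
  (y 0 b ^+ d * x 0 a ^+ e) *: segre (evmap iota (rds_map S) x) (evmap iota (rds_map T) y).
Proof.
have [d hd] := proj1 (rds_rational S); have [e he] := proj1 (rds_rational T).
exists d, e => x y; rewrite prod_mapE (evmap_scale _ _ hd) (evmap_scale _ _ he).
by rewrite segreZ.
Qed.

Definition prod_ivar : ivar iota :=
  IVar (geom_irreducible_irreducible (geom_irreducible_prod gS gT)).

Lemma notin_vanish_pt (X : ivar iota) p : p \notin vanish X ->
  exists2 v, v \in pts X & ev iota p v != 0.
Proof.
move=> vp; apply: contrapT => nv; case/negP: vp; apply/vanishP => v hv.
by apply: contrapT => /eqP pv; apply: nv; exists v.
Qed.

Lemma prod_rational : @rational_map _ _ _ prod_ivar prod_ivar prod_map.
Proof.
have [[d hd] [HS [hHS vHS HSP]]] := rds_rational S.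
have [[e he] [HT [hHT vHT HTP]]] := rds_rational T.
split.
  exists (d * 1 + e * 1)%N; apply: mxtuple_homog => i j; rewrite mxE; apply: dhomogM.
    by apply: dhomog_comp => // l; rewrite tnth_mktuple zvar_homog.
  by apply: dhomog_comp => // l; rewrite tnth_mktuple zvar_homog.
(* At (x, y) this form is x_a y_b H_S(y_b x) H_T(x_a y): the scalar factors stay nonzero and both
   maps are defined. *)
exists (zvar k a b * ((HS \mPo zcol k (qp_N S) b) * (HT \mPo zrow k (qp_N T) a))).
have HE x y : ev iota (zvar k a b * ((HS \mPo zcol k (qp_N S) b) * (HT \mPo zrow k (qp_N T) a))) (segre x y)
    = (x 0 a * y 0 b) * (ev iota HS (y 0 b *: x) * ev iota HT (x 0 a *: y)).
  by rewrite !evM !ev_comp evmap_zcol_segre evmap_zrow_segre ev_zvar_segre.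
split.
- have /homogP[d1 h1] := zcol_homog b hHS; have /homogP[d2 h2] := zrow_homog a hHT.
  apply: (@homogE _ _ _ (1 + (d1 + d2))); apply: dhomogM; first exact: zvar_homog.
  exact: dhomogM.
- have /notin_vanish_pt[x hx nx] : 'X_a * HS \notin vanish S by rewrite vanishM negb_or va.
  have /notin_vanish_pt[y hy ny] : 'X_b * HT \notin vanish T by rewrite vanishM negb_or vb.
  have /andP[xa Hx] : (x 0 a != 0) && (ev iota HS x != 0).
    by rewrite -negb_or -mulf_eq0 -(evX iota) -evM.
  have /andP[yb Hy] : (y 0 b != 0) && (ev iota HT y != 0).
    by rewrite -negb_or -mulf_eq0 -(evX iota) -evM.
  apply: (@notin_vanishI prod_ivar _ (segre x y)).
    by apply/prod_pts; exists x, y.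
  by rewrite HE !mulf_eq0 !ev_eq0_scale // (negPf xa) (negPf yb) (negPf Hx) (negPf Hy).
move=> u /prod_pts[x [y [hx hy ->]]]; rewrite HE !mulf_eq0 !negb_or => /andP[/andP[xa yb] /andP[Hx Hy]].
rewrite prod_mapE; apply/prod_pts; eexists; eexists; split; last reflexivity.
- by apply: HSP => //; apply: pts_scale.
- by apply: HTP => //; apply: pts_scale.
Qed.

(** Dominance is applied in x with y' fixed, then in y with phi(x) fixed. The open condition is
    passed on through slices: h(x, y0) nonzero ensures that h(x, .) is not identically zero on T. *)
Lemma prod_geom_dominant : @geom_dominant S (rds_map S) -> @geom_dominant T (rds_map T) ->
  @geom_dominant (prodv S T) prod_map.
Proof.
move=> dS dT q h hq hh [u0 /prod_pts[x0 [y0 [hx0 hy0 ->]]] h0] hP w /prod_pts[x' [y' [hx' hy' ->]]].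
have [d [e mapE]] := prod_map_scale.
have [xa hxa] := notin_vanish_pt va; rewrite evX => xa0.
have [yb hyb] := notin_vanish_pt vb; rewrite evX => yb0.
have homM n (p r : {mpoly K[n]}) : p \is homog mdeg -> r \is homog mdeg -> p * r \is homog mdeg.
  move=> /homogP[d1 h1] /homogP[d2 h2]; apply: (@homogE _ _ _ (d1 + d2)).
  exact: dhomogM.
rewrite -ev_slice_r.
apply: (dS _ ((h \mPo slice_r _ y0) * 'X_a)) hx' => [|||x hx Px].
- exact: slice_r_homog.
- by apply: homM; [exact: slice_r_homog | exact: homogX].
- have [||x hx [h1 h2]] := geom_form_mul gS (slice_r_homog y0 hh) (homogX K a) hx0 hxa.
  + by rewrite ev_slice_r.
  + by rewrite evX.
  by exists x => //; rewrite evM mulf_neq0.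
rewrite evM evX ev_slice_r mulf_eq0 negb_or => /andP[hxy0 xa'].
rewrite ev_slice_r -ev_slice_l.
apply: (dT _ ((h \mPo slice_l _ x) * 'X_b)) hy' => [|||y hy Py].
- exact: slice_l_homog.
- by apply: homM; [exact: slice_l_homog | exact: homogX].
- have [||y hy [h1 h2]] := geom_form_mul gT (slice_l_homog x hh) (homogX K b) hy0 hyb.
  + by rewrite ev_slice_l.
  + by rewrite evX.
  by exists y => //; rewrite evM mulf_neq0.
rewrite evM evX ev_slice_l mulf_eq0 negb_or => /andP[hxy yb'].
have c0 : y 0 b ^+ d * x 0 a ^+ e != 0 by rewrite mulf_neq0 ?expf_neq0.
have := hP (segre x y); rewrite mapE scalemx_eq0 negb_or c0 segre_neq0 Px Py => /(_ _ isT hxy).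
have -> : segre x y \in pts (prodv S T) by apply/prod_pts; exists x, y.
have /homogP[dq hdq] := hq.
rewrite (ev_scale _ _ _ hdq) ev_slice_l => /(_ isT)/eqP.
by rewrite mulf_eq0 expf_eq0 (negPf c0) andbF => /eqP.
Qed.

Lemma prod_rds_exists : @geom_dominant S (rds_map S) -> @geom_dominant T (rds_map T) ->
  exists Z : prod_rds S T, geom_irreducible (rds_of_prod Z) /\
    @geom_dominant (rds_of_prod Z) (rds_map (rds_of_prod Z)).
Proof.
move=> dS dT; have dZ := prod_geom_dominant dS dT.
have mE v w : v \in pts S -> w \in pts T ->
      evmap iota (rds_map S) v != 0 -> evmap iota (rds_map T) w != 0 ->
      evmap iota prod_map (segre v w) != 0 ->
      (evmap iota prod_map (segre v w) ==
       segre (evmap iota (rds_map S) v) (evmap iota (rds_map T) w))%MS.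
  move=> _ _ _ _; have [d [e ->]] := prod_map_scale.
  rewrite scalemx_eq0 negb_or => /andP[c0 _]; apply/eqmx_rV.
  by exists (w 0 b ^+ d * v 0 a ^+ e).
exists (@ProdRDS _ _ _ S T (geom_irreducible_irreducible (geom_irreducible_prod gS gT))
  prod_map prod_rational (geom_dominant_dominant prod_rational dZ) mE).
by split=> //; apply: geom_irreducible_prod.
Qed.

End ProductMap.
End Products.

(** * Product systems *)

Section Systems.
Variables (k : fieldType) (K : closedFieldType) (iota : {rmorphism k -> K}).
Implicit Types (S T : rds iota) (X Y W : ivar iota).

Lemma comp_mpolyXi (R : comNzRingType) n m (P : n.-tuple {mpoly R[m]}) i : 'X_i \mPo P = tnth P i.
Proof. by rewrite /comp_mpoly mmapX mmap1U. Qed.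

Lemma rds_map_vanish T A : A \is homog mdeg -> (A \mPo rds_map T \in vanish T) = (A \in vanish T).
Proof.
move=> hA; apply/idP/idP; last exact: (vanish_comp (rds_rational T)).
exact: (vanish_comp_dom (@rds_dominant _ _ _ T) hA).
Qed.

Definition rds_dmap T : dmap T T := DMap (proj1 (rds_rational T)) (@rds_map_vanish T).

Definition rds_endo T : ff T -> ff T := pb (rds_dmap T).
HB.instance Definition _ T := GRing.RMorphism.on (@rds_endo T).

Lemma adimP T : is_trdeg (fixed (@rds_endo T)) (adim T).
Proof.
apply: trdegP => x; split=> [[d [A [B [hA hB vB e1 e2]]]]|[f ff <-]].
  have [f hf] := ff_frac hA hB vB; exists f; last by rewrite hf.
  apply: ffv_inj; rewrite (pbE (rds_dmap T) hA hB vB hf) hf -e1.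
  exact: (esym e2).
have [d A B hA hB vB e] := reprP f; exists d, A, B; split=> //.
rewrite -[f in LHS]ff.
exact: (pbE (rds_dmap T) hA hB vB e).
Qed.

Lemma notin_vanishM X p q : p \notin vanish X -> q \notin vanish X -> p * q \notin vanish X.
Proof. by rewrite -!frac_of_eq0 frac_ofM; apply: mulf_neq0. Qed.

Section Composition.
Variables (X Y W : ivar iota) (P : dmap X Y) (Q : dmap Y W).

Definition dcomp_tuple : (qp_N W).-tuple {mpoly k[qp_N X]} :=
  [tuple tnth Q i \mPo P | i < qp_N W].

Lemma comp_dcomp A : A \mPo dcomp_tuple = (A \mPo Q) \mPo P.
Proof.
have := @mpoly_rmorph_ext k {mpoly k[qp_N X]} _ (comp_mpoly dcomp_tuple)
  (comp_mpoly P \o comp_mpoly Q).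
apply=> [c|i] /=; first by rewrite !comp_mpolyC.
by rewrite !comp_mpolyXi tnth_mktuple.
Qed.

Lemma dcomp_deg : exists d, forall i, tnth dcomp_tuple i \is d.-homog.
Proof.
have [e he] := dm_comp_homog P; have [d hd] := dm_deg Q.
by exists (d * e)%N => i; rewrite tnth_mktuple; apply: he.
Qed.

Lemma dcomp_vanish A : A \is homog mdeg -> (A \mPo dcomp_tuple \in vanish X) = (A \in vanish W).
Proof.
move=> hA; rewrite comp_dcomp dm_vanish ?dm_vanish //.
have [e he] := dm_comp_homog Q; have /homogP[d hd] := hA.
by apply: (@homogE _ _ _ (d * e)); apply: he.
Qed.

Definition dcomp : dmap X W := DMap dcomp_deg dcomp_vanish.

Lemma pb_dcomp f : pb dcomp f = pb P (pb Q f).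
Proof.
have [d A B hA hB vB e] := reprP f; apply: ffv_inj.
have [e1 he] := dm_comp_homog Q.
rewrite (pbE dcomp hA hB vB e).
rewrite (pbE P (he _ _ hA) (he _ _ hB) (dm_notin Q hB vB) (pbE Q hA hB vB e)).
by rewrite /dcomp /= !comp_dcomp.
Qed.

Lemma evmap_dcomp v : evmap iota dcomp v = evmap iota Q (evmap iota P v).
Proof. by apply/rowP => i; rewrite !mxE tnth_mktuple ev_comp. Qed.

End Composition.

Section ProductSystem.
Variables (S T : rds iota) (Z : prod_rds S T).
Local Notation W := (rds_of_prod Z).
Variables (a : 'I_(qp_N S)) (b : 'I_(qp_N T)).
Hypotheses (va : 'X_a \notin vanish S) (vb : 'X_b \notin vanish T).

Lemma segre_pts x y : x \in pts S -> y \in pts T -> segre x y \in pts W.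
Proof. by move=> hx hy; apply/prod_pts; exists x, y. Qed.

Lemma segre_ptsP u : u \in pts W -> exists x y, [/\ x \in pts S, y \in pts T & u = segre x y].
Proof. by move/prod_pts. Qed.

Definition proj_l_tuple : (qp_N S).-tuple {mpoly k[qp_N W]} := zcol k (qp_N S) b.
Definition proj_r_tuple : (qp_N T).-tuple {mpoly k[qp_N W]} := zrow k (qp_N T) a.

Lemma proj_l_deg : exists d, forall i, tnth proj_l_tuple i \is d.-homog.
Proof. by exists 1%N => i; rewrite tnth_mktuple zvar_homog. Qed.

Lemma proj_r_deg : exists d, forall i, tnth proj_r_tuple i \is d.-homog.
Proof. by exists 1%N => i; rewrite tnth_mktuple zvar_homog. Qed.

Lemma proj_l_vanish A : A \is homog mdeg -> (A \mPo proj_l_tuple \in vanish W) = (A \in vanish S).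
Proof.
move=> hA; apply/idP/idP => /vanishP h; apply/vanishP.
  move=> x hx; have [y hy] := notin_vanish_pt vb; rewrite evX => yb.
  have /eqP := h _ (segre_pts hx hy).
  by rewrite ev_comp /proj_l_tuple evmap_zcol_segre ev_eq0_scale // => /eqP.
move=> u /segre_ptsP[x [y [hx hy ->]]]; rewrite ev_comp /proj_l_tuple evmap_zcol_segre.
by apply/eqP/ev_scale_eq0 => //; apply/eqP/h.
Qed.

Lemma proj_r_vanish A : A \is homog mdeg -> (A \mPo proj_r_tuple \in vanish W) = (A \in vanish T).
Proof.
move=> hA; apply/idP/idP => /vanishP h; apply/vanishP.
  move=> y hy; have [x hx] := notin_vanish_pt va; rewrite evX => xa.
  have /eqP := h _ (segre_pts hx hy).
  by rewrite ev_comp /proj_r_tuple evmap_zrow_segre ev_eq0_scale // => /eqP.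
move=> u /segre_ptsP[x [y [hx hy ->]]]; rewrite ev_comp /proj_r_tuple evmap_zrow_segre.
by apply/eqP/ev_scale_eq0 => //; apply/eqP/h.
Qed.

Definition proj_l : dmap W S := DMap proj_l_deg proj_l_vanish.
Definition proj_r : dmap W T := DMap proj_r_deg proj_r_vanish.

Lemma evmap_proj_l x y : evmap iota proj_l (segre x y) = y 0 b *: x.
Proof. exact: evmap_zcol_segre. Qed.

Lemma evmap_proj_r x y : evmap iota proj_r (segre x y) = x 0 a *: y.
Proof. exact: evmap_zrow_segre. Qed.

Lemma zvar_notin : zvar k a b \notin vanish W.
Proof.
have [x hx] := notin_vanish_pt va; rewrite evX => xa.
have [y hy] := notin_vanish_pt vb; rewrite evX => yb.
apply: (notin_vanishI (segre_pts hx hy)).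
by rewrite ev_zvar_segre mulf_neq0.
Qed.

(* Off the zeros of this form, the two projections and the three maps are all
   defined. *)
Let H : {mpoly k[qp_N W]} := zvar k a b * (zvar k a b \mPo rds_map W) *
  ((tnth (rds_map S) a \mPo proj_l) * (tnth (rds_map T) b \mPo proj_r)).

Let H_notin : H \notin vanish W.
Proof.
have [d hd] := proj1 (rds_rational S); have [e he] := proj1 (rds_rational T).
have xh n (i : 'I_n) : ('X_i : {mpoly k[n]}) \is 1.-homog by rewrite dhomogX; apply/eqP/mdeg1.
apply: notin_vanishM; apply: notin_vanishM.
- exact: zvar_notin.
- exact: (dm_notin (rds_dmap W) (zvar_homog k a b) zvar_notin).
- apply: (dm_notin proj_l (hd a)); rewrite -comp_mpolyXi.
  exact: (dm_notin (rds_dmap S) (xh _ a) va).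
- apply: (dm_notin proj_r (he b)); rewrite -comp_mpolyXi.
  exact: (dm_notin (rds_dmap T) (xh _ b) vb).
Qed.

(** The map of a product system is an arbitrary tuple, known only up to scalars and where it is
    nonzero; here the scalar at a generic pair of points is extracted. *)
Let generic_pt x y : x \in pts S -> y \in pts T -> ev iota H (segre x y) != 0 ->
  exists c, [/\ c != 0, x 0 a != 0, y 0 b != 0,
    evmap iota (rds_map W) (segre x y) =
      c *: segre (evmap iota (rds_map S) x) (evmap iota (rds_map T) y) &
    (evmap iota (rds_map S) x 0 a != 0) && (evmap iota (rds_map T) y 0 b != 0)].
Proof.
move=> hx hy; rewrite /H.
rewrite evM [ev iota (zvar k a b * _) _]evM [ev iota ((_ \mPo proj_l) * _) _]evM.
rewrite !mulf_eq0 !negb_or !ev_comp evmap_proj_l evmap_proj_r ev_zvar_segre.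
move=> /andP[/andP[xy Pu] /andP[PSa PTb]].
have [d hd] := proj1 (rds_rational S); have [e he] := proj1 (rds_rational T).
have Sa : evmap iota (rds_map S) x 0 a != 0.
  by rewrite mxE; apply: contraNneq PSa => h; rewrite (ev_scale _ _ _ (hd a)) h mulr0.
have Tb : evmap iota (rds_map T) y 0 b != 0.
  by rewrite mxE; apply: contraNneq PTb => h; rewrite (ev_scale _ _ _ (he b)) h mulr0.
have Sx : evmap iota (rds_map S) x != 0 by apply/rV0Pn; exists a.
have Ty : evmap iota (rds_map T) y != 0 by apply/rV0Pn; exists b.
have Wu : evmap iota (rds_map W) (segre x y) != 0.
  by apply: contraNneq Pu => ->; rewrite ev_zvar linear0 mxE.
have /eqmx_rV[c c0 ec] := pr_mapE hx hy Sx Ty Wu.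
exists c; rewrite Sa Tb; split=> //.
  by apply: contraNneq xy => ->; rewrite mul0r.
by apply: contraNneq xy => ->; rewrite mulr0.
Qed.

Lemma eqmx_scale2 n (v : 'rV[K]_n) c d : c != 0 -> d != 0 -> (c *: v == d *: v)%MS.
Proof.
move=> c0 d0; apply/eqmx_rV; exists (c / d); first by rewrite mulf_neq0 ?invr_eq0.
by rewrite scalerA divfK.
Qed.

Lemma proj_l_endo f : rds_endo (pb proj_l f) = pb proj_l (rds_endo f).
Proof.
rewrite /rds_endo -!pb_dcomp; apply: (pb_eq H_notin) => u /segre_ptsP[x [y [hx hy ->]]] Hu.
have [c [c0 xa yb e /andP[Sa Tb]]] := generic_pt hx hy Hu.
rewrite !evmap_dcomp /= e evmap_proj_l.
have h1 i : tnth proj_l i \is 1.-homog by rewrite tnth_mktuple zvar_homog.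
have [d hd] := proj1 (rds_rational S).
rewrite (evmap_scale iota _ _ hd) (evmap_scale iota _ _ h1) evmap_proj_l scalerA expr1.
by apply: eqmx_scale2; rewrite ?mulf_neq0 ?expf_neq0.
Qed.

Lemma proj_r_endo f : rds_endo (pb proj_r f) = pb proj_r (rds_endo f).
Proof.
rewrite /rds_endo -!pb_dcomp; apply: (pb_eq H_notin) => u /segre_ptsP[x [y [hx hy ->]]] Hu.
have [c [c0 xa yb e /andP[Sa Tb]]] := generic_pt hx hy Hu.
rewrite !evmap_dcomp /= e evmap_proj_r.
have h1 i : tnth proj_r i \is 1.-homog by rewrite tnth_mktuple zvar_homog.
have [d hd] := proj1 (rds_rational T).
rewrite (evmap_scale iota _ _ hd) (evmap_scale iota _ _ h1) evmap_proj_r scalerA expr1.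
by apply: eqmx_scale2; rewrite ?mulf_neq0 ?expf_neq0.
Qed.

Lemma zvarX_notin : 'X_(mxvec_index a b) \notin vanish W.
Proof. exact: zvar_notin. Qed.

Lemma coord_prod i j : acoord zvarX_notin (mxvec_index i j) =
  pb proj_l (acoord va i) * pb proj_r (acoord vb j).
Proof.
have xh n (l : 'I_n) : ('X_l : {mpoly k[n]}) \is 1.-homog by rewrite dhomogX; apply/eqP/mdeg1.
apply: ffv_inj; rewrite ffv_coord rmorphM /=.
rewrite (pbE proj_l (xh _ i) (xh _ a) va (ffv_coord va i)).
rewrite (pbE proj_r (xh _ j) (xh _ b) vb (ffv_coord vb j)).
rewrite !comp_mpolyXi !tnth_mktuple mulf_div -!frac_ofM.
apply/frac_eq; [exact: zvar_notin | by apply: notin_vanishM; apply: zvar_notin |].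
apply/vanishP => u /segre_ptsP[x [y [hx hy ->]]].
rewrite evB !evM !ev_zvar_segre; ring.
Qed.

(** An affine Segre coordinate is the product of a coordinate of S and one of T. *)
Lemma prod_ff_gen (F : subfield (ff W)) :
  (forall f, F (pb proj_l f)) -> (forall g, F (pb proj_r g)) -> forall f, F f.
Proof.
move=> hl hr f; refine (@gen_min _ _ F _ f (@acoord_gen _ _ _ _ _ zvarX_notin f)) => g [[c ->]|/mapP[l _ ->]].
  by rewrite /= -(pb_cst proj_l); apply: hl.
by case/mxvec_indexP: l => i j; rewrite coord_prod; apply: sf_M; [apply: hl | apply: hr].
Qed.

(** Tower through the field [F] of fixed functions that come from T, whose transcendence degree is
    at most adim T. Fixed functions independent over [F] remain so over all of k(T) by
    [aind_fixed_sub], and k(S x T) is generated over k(T) by the [qp_N S] coordinates of S. *)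
Lemma adim_prod_bound : (adim W <= adim T + qp_N S)%N.
Proof.
have [[f [ffix find]] _] := adimP W.
have [_ Tmax] := adimP T.
pose P : {rmorphism ff T -> ff W} := pb proj_r.
pose M : subfield (ff W) := rng P.
pose F := sfI (fixed (@rds_endo W)) M.
have kF x : ksf W x -> F x.
  move=> [c ->]; split; last by exists (cst T c); rewrite /P /= pb_cst.
  by rewrite /= /rds_endo pb_cst.
have Fb w : chain (ksf W) w -> (forall x, x \in w -> F x) -> (size w <= adim T)%N.
  move=> /chain_tuple hw wF.
  have hg i : exists g, tnth (in_tuple w) i = P g /\ fixed (@rds_endo T) g.
    have [hfix [g hg]] := wF _ (mem_tnth i (in_tuple w)); exists g; split=> //.
    apply: (fmorph_inj P); rewrite /= -proj_r_endo.
    by move: hfix; rewrite hg.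
  have [g hg'] := choice hg; apply: (Tmax _ g) => [i|]; first by case: (hg' i).
  apply/(pb_aind proj_r); move: hw; congr (aind _ _).
  by apply/funext => i; case: (hg' i).
have [v [hv vf]] := chain_tower kF (proj1 (aind_chain _ _) find) Fb.
rewrite size_lst => /leq_trans; apply; rewrite leq_add2l.
have vind : aind M (tnth (in_tuple v)).
  apply: (@aind_fixed_sub _ (@rds_endo W)).
  - by move=> x [g ->]; exists (rds_endo g); rewrite /P /= proj_r_endo.
  - by move=> i; have /vf/mapP[l _ ->] := mem_tnth i (in_tuple v); apply: ffix.
  - exact: chain_tuple hv.
have := @aind_bound _ _ _ _ [seq pb proj_l (acoord va i) | i <- enum 'I_(qp_N S)] vind.
rewrite size_map size_enum_ord; apply => i; apply: gen_cl.
apply: prod_ff_gen => [g|g]; last by apply: gen_sub; left; exists g.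
set G := gen _.
refine (@gen_min _ _ (preim_sf (pb proj_l) G) _ g (@acoord_gen _ _ _ _ _ va g)) => x [[c ->]|/mapP[l _ ->]].
  by rewrite /= pb_cst -(pb_cst proj_r); apply: gen_sub; left; exists (cst T c).
by apply: gen_sub; right; apply/mapP; exists l; rewrite ?mem_enum.
Qed.

(** Given a nonzero relation q, choose values tau in [K], generic for both tuples and with q(tau)
    nonzero, then points x and y where the functions take these values. Evaluating the relation at
    (x, y) gives q(tau) = 0. *)
Lemma trdeg_prod m n (f : 'I_m -> ff S) (g : 'I_n -> ff T) :
  aind (ksf S) f -> aind (ksf T) g ->
  aind (ksf W) (fun i : 'I_(m + n) =>
    match split i with inl j => pb proj_l (f j) | inr j => pb proj_r (g j) end).
Proof.
move=> /(generic_values va)[al al0 hal] /(generic_values vb)[be be0 hbe].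
pose ups (p : {mpoly k[m]}) : {mpoly k[m + n]} := p \mPo [tuple 'X_(lshift n i) | i < m].
pose upt (p : {mpoly k[n]}) : {mpoly k[m + n]} := p \mPo [tuple 'X_(rshift m i) | i < n].
have upsE tau p : mmap iota tau (ups p) = mmap iota (tau \o lshift n) p.
  have := @mpoly_rmorph_ext k K m (mmap iota tau \o comp_mpoly [tuple 'X_(lshift n i) | i < m])
    (mmap iota (tau \o lshift n)).
  apply=> [c|i] /=; first by rewrite comp_mpolyC !mmapC.
  by rewrite comp_mpolyXi tnth_mktuple !mmapX !mmap1U.
have uptE tau p : mmap iota tau (upt p) = mmap iota (tau \o @rshift m n) p.
  have := @mpoly_rmorph_ext k K n (mmap iota tau \o comp_mpoly [tuple 'X_(rshift m i) | i < n])
    (mmap iota (tau \o @rshift m n)).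
  apply=> [c|i] /=; first by rewrite comp_mpolyC !mmapC.
  by rewrite comp_mpolyXi tnth_mktuple !mmapX !mmap1U.
apply/aindP => q hq; apply/eqP/negPn/negP => q0.
have ups0 : ups al != 0.
  have [tau htau] := mpoly_nonzero_value iota al0.
  apply: contraNneq htau => e.
  have := upsE (fun i => match split i with inl j => tau j | inr _ => 0 end) al.
  rewrite e mmap0 => ->; apply/eqP; congr mmap; apply/funext => i /=.
  by rewrite (unsplitK (inl i)).
have upt0 : upt be != 0.
  have [tau htau] := mpoly_nonzero_value iota be0.
  apply: contraNneq htau => e.
  have := uptE (fun i => match split i with inl j => 0 | inr j => tau j end) be.
  rewrite e mmap0 => ->; apply/eqP; congr mmap; apply/funext => i /=.
  by rewrite (unsplitK (inr i)).
have [tau] := mpoly_nonzero_value iota (mulf_neq0 q0 (mulf_neq0 ups0 upt0)).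
rewrite !mmapM upsE uptE !mulf_eq0 !negb_or => /and3P[qtau /hal[x hx [xa fx]] /hbe[y hy [yb gy]]].
have hu := segre_pts hx hy.
case/eqP: qtau; apply: (val_at0 hu); rewrite -hq; apply: val_at_mmap => i.
rewrite -[in tau i](splitK i); case: (split i) => j /=.
  by apply: val_at_pb; rewrite evmap_proj_l; apply: val_at_scale => //; apply: fx.
by apply: val_at_pb; rewrite evmap_proj_r; apply: val_at_scale => //; apply: gy.
Qed.

Lemma dim_prod m n :
  (exists g : 'I_n -> ff T, aind (ksf T) g) -> (exists f : 'I_m -> ff S, aind (ksf S) f) ->
  exists h : 'I_(m + n) -> ff W, aind (ksf W) h.
Proof. by move=> [g hg] [f hf]; eexists; apply: trdeg_prod hf hg. Qed.

End ProductSystem.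

(* Each function has all its iterates among the values at the points gamma of
   finitely many rational functions of N parameters. *)
Definition nice_rds T N (gamma : nat -> 'I_N -> k) : Prop :=
  forall f, nice (@rds_endo T) (fun i => cst T \o gamma i) f.

(** The same parameters gamma serve both factors, so N does not grow with the number of factors;
    this keeps the deficit constant. *)
Lemma nice_rds_prod S T (Z : prod_rds S T) N (gamma : nat -> 'I_N -> k) :
  nice_rds S gamma -> nice_rds T gamma -> nice_rds (rds_of_prod Z) gamma.
Proof.
move=> hS hT; have [a va] := coord_var_exists S; have [b vb] := coord_var_exists T.
have gE (X Y : ivar iota) (P : dmap X Y) :
    (fun i => cst X \o gamma i) = (fun i => pb P \o (cst Y \o gamma i)).
  by apply/funext => i; apply/funext => l /=; rewrite pb_cst.
move=> h; pose F := nice_sf (@rds_endo (rds_of_prod Z)) (fun i => cst (rds_of_prod Z) \o gamma i).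
refine (@prod_ff_gen S T Z a b va vb F _ _ h) => {h} f /=.
  rewrite (gE _ _ (proj_l Z vb)); apply: (nice_map _ (hS f)) => g.
  exact: proj_l_endo va vb g.
rewrite (gE _ _ (proj_r Z va)); apply: (nice_map _ (hT f)) => g.
exact: proj_r_endo va vb g.
Qed.

(** Tower through the fixed field, which contributes at most adim T; the functions that stay
    independent over it number at most N by [nice_bound]. *)
Lemma nice_rds_bound T N (gamma : nat -> 'I_N -> k) n (f : 'I_n -> ff T) :
  nice_rds T gamma -> aind (ksf T) f -> (n <= adim T + N)%N.
Proof.
move=> hT hf; have [_ Tmax] := adimP T.
have kF x : ksf T x -> fixed (@rds_endo T) x.
  by move=> [c ->]; rewrite /= /rds_endo pb_cst.
have Fb w : chain (ksf T) w -> (forall x, x \in w -> fixed (@rds_endo T) x) -> (size w <= adim T)%N.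
  by move=> /chain_tuple hw wF; apply: Tmax hw => i; apply/wF/mem_tnth.
have [v [hv vf]] := chain_tower kF (proj1 (aind_chain _ _) hf) Fb.
rewrite size_lst => /leq_trans; apply; rewrite leq_add2l.
apply: (nice_bound (v := tnth (in_tuple v))) (chain_tuple hv) => i.
exact: hT.
Qed.

End Systems.

(** * Translations *)

Section Translations.
Variables (k : fieldType) (K : closedFieldType) (iota : {rmorphism k -> K}).
Local Notation evK := (ev (idfun : {rmorphism K -> K})).

Lemma eqmx_rV_sym n (u v : 'rV[K]_n) : (u == v)%MS -> (v == u)%MS.
Proof. by rewrite andbC. Qed.

Lemma eqmx_rV_trans n (v u w : 'rV[K]_n) : (u == v)%MS -> (v == w)%MS -> (u == w)%MS.
Proof.
move=> /eqmx_rV[c c0 ->] /eqmx_rV[d d0 ->]; apply/eqmx_rV.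
by exists (c * d); rewrite ?mulf_neq0 // scalerA.
Qed.

Lemma eqmx_pts (X : qpvar iota) u v : (u == v)%MS -> u \in pts X -> v \in pts X.
Proof. by move=> /eqmx_rV_sym/eqmx_rV[c c0 ->]; apply: pts_scale. Qed.

Lemma morphism_scale (X Y : qpvar iota) f : @var_morphism _ _ _ X Y f ->
  forall u v, u \in pts X -> (u == v)%MS -> (f u == f v)%MS.
Proof.
move=> hf u v hu uv; have hv := eqmx_pts uv hu; have /eqmx_rV[c c0 e] := uv.
have [_ [P [[d hd] Pv hP]]] := hf v hv.
have Pu : evmap iota P u = c ^+ d *: evmap iota P v by rewrite e (evmap_scale iota _ _ hd).
have Pu0 : evmap iota P u != 0 by rewrite Pu scalemx_eq0 negb_or expf_neq0.
apply: eqmx_rV_trans (hP u hu Pu0) _; apply: eqmx_rV_trans (eqmx_rV_sym (hP v hv Pv)).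
by apply/eqmx_rV; exists (c ^+ d); rewrite ?expf_neq0.
Qed.

Variables (S : rds iota) (G : alg_group iota).
Variable rho : 'rV[K]_(qp_N (prodv G S)) -> 'rV[K]_(qp_N S).
Hypotheses (S_geom : geom_irreducible S) (hact : group_action rho).

Let act a x := rho (segre a x).

Lemma act_pts a x : a \in pts G -> x \in pts S -> act a x \in pts S.
Proof.
move=> ha hx; have [rho_morph _ _] := hact.
by have [] := rho_morph (segre a x); first by apply/prod_pts; exists a, x.
Qed.

Lemma act_eqmx a b x y : a \in pts G -> x \in pts S -> (a == b)%MS -> (x == y)%MS ->
  (act a x == act b y)%MS.
Proof.
move=> ha hx /eqmx_rV[c c0 e] /eqmx_rV[d d0 e']; have [rho_morph _ _] := hact.
apply: (morphism_scale rho_morph); first by apply/prod_pts; exists a, x.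
by rewrite e e' segreZ; apply/eqmx_rV; exists (c * d); rewrite ?mulf_neq0.
Qed.

Lemma ag_mul_pts (a b : 'rV[K]_(qp_N G)) : a \in pts G -> b \in pts G -> ag_mul a b \in pts G.
Proof.
move=> ha hb; have [] := @ag_prod_morph _ _ _ G (segre a b) => //.
by apply/prod_pts; exists a, b.
Qed.

(** Only one point with a nonzero value is asked for: S being irreducible, [P] is then nonzero on a
    dense open subset. *)
Definition represents (a : 'rV[K]_(qp_N G)) (P : (qp_N S).-tuple {mpoly k[qp_N S]}) : Prop :=
  [/\ exists d, forall i, tnth P i \is d.-homog,
      exists2 v, v \in pts S & evmap iota P v != 0
    & forall v, v \in pts S -> evmap iota P v != 0 -> (evmap iota P v == act a v)%MS].

Lemma homog_comp_K n m (q : {mpoly K[n]}) (P : n.-tuple {mpoly K[m]}) :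
  q \is homog mdeg -> (exists d, forall i, tnth P i \is d.-homog) -> q \mPo P \is homog mdeg.
Proof. by move=> /homogP[d hd] [e he]; apply: (@homogE _ _ _ (d * e)); apply: dhomog_comp. Qed.

(** If q(w) is nonzero, v1 = a^(-1) w is sent to w, but [P] may vanish at v1. There, local forms [R]
    of the action at (a, v1), restricted to the slice at a, replace [P]. Geometric irreducibility
    provides a point u where [h], q(R') and one coordinate each of [P] and [R'] are nonzero; at u
    the two tuples agree up to a scalar, so q does not vanish at P(u). *)
Lemma represents_dominant a P : a \in pts G -> represents a P -> @geom_dominant _ _ iota S P.
Proof.
move=> ha [[e he] [v2 hv2 /rV0Pn[j Pj]] hP] q h hq hh [v0 hv0 h0] qP w hw.
apply: contrapT => /eqP qw.
have [rho_morph rho1 rhoM] := hact.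
have hai : ag_inv a \in pts G by have [] := @ag_inv_morph _ _ _ G a ha.
pose v1 := act (ag_inv a) w; have hv1 : v1 \in pts S by apply: act_pts.
have v1w : (act a v1 == w)%MS.
  apply: eqmx_rV_trans (eqmx_rV_sym (rhoM _ _ _ ha hai hw)) _.
  apply: eqmx_rV_trans (rho1 w hw); apply: act_eqmx => //; first exact: ag_mul_pts.
    exact: ag_mulgV.
  by apply/andP.
have hu1 : segre a v1 \in pts (prodv G S) by apply/prod_pts; exists a, v1.
have [_ [R [[d hd] Rv1 hR]]] := rho_morph _ hu1.
pose R' : (qp_N S).-tuple {mpoly K[qp_N S]} :=
  [tuple map_mpoly iota (tnth R i) \mPo slice_l _ a | i < qp_N S].
have R'E v : evmap (idfun : {rmorphism K -> K}) R' v = evmap iota R (segre a v).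
  by apply/rowP => i; rewrite !mxE tnth_mktuple ev_slice_l ev_map.
have hR' : exists d, forall i, tnth R' i \is d.-homog.
  exists (d * 1)%N => i; rewrite tnth_mktuple; apply: dhomog_comp; first exact: dhomog_map.
  by apply: mxtuple_homog => r s; rewrite mxE mul_mpolyC rpredZ // dhomogX; apply/eqP/mdeg1.
have R'i i : tnth R' i \is homog mdeg by have [d' hd'] := hR'; apply: homogE (hd' i).
have /rV0Pn[i Ri] := Rv1.
have hPj : map_mpoly iota (tnth P j) \is homog mdeg by apply: homogE (dhomog_map iota (he j)).
have homM n (p r : {mpoly K[n]}) : p \is homog mdeg -> r \is homog mdeg -> p * r \is homog mdeg.
  move=> /homogP[d1 h1] /homogP[d2 h2]; apply: (@homogE _ _ _ (d1 + d2)).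
  exact: dhomogM.
have [||u1 hu1S [n1 n2]] := geom_form_mul S_geom hh hPj hv0 hv2; rewrite ?ev_map //.
  by move: Pj; rewrite mxE.
have qR1 : evK (q \mPo R') v1 != 0.
  have /eqmx_rV[c c0 ec] : (evmap iota R (segre a v1) == w)%MS.
    exact: eqmx_rV_trans (eqmx_rV_sym (hR _ hu1 Rv1)) v1w.
  rewrite ev_comp R'E ec; have /homogP[dq hdq] := hq.
  by rewrite (ev_scale _ _ _ hdq) mulf_neq0 ?expf_neq0.
have R'v1 : evK (tnth R' i) v1 != 0.
  by have := congr1 (fun M : 'rV_ _ => M 0 i) (R'E v1); rewrite mxE => ->.
have [u [hu [n3 n4]]] : exists u, u \in pts S /\
    evK (h * map_mpoly iota (tnth P j)) u != 0 /\ evK ((q \mPo R') * tnth R' i) u != 0.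
  have [||u hu [? ?]] := geom_form_mul S_geom (homM _ _ _ hh hPj)
    (homM _ _ _ (homog_comp_K hq hR') (R'i i)) hu1S hv1; last by exists u.
  + by rewrite evM mulf_neq0.
  + by rewrite evM mulf_neq0.
move: n3 n4; rewrite !evM !mulf_eq0 !negb_or ev_map => /andP[hu0 Pju] /andP[qu Riu].
have Pu : evmap iota P u != 0 by apply/rV0Pn; exists j; rewrite mxE.
have Ru : evmap iota R (segre a u) != 0.
  by rewrite -R'E; apply/rV0Pn; exists i; rewrite mxE.
have hau : segre a u \in pts (prodv G S) by apply/prod_pts; exists a, u.
have /eqmx_rV[c c0 ec] := eqmx_rV_trans (hP u hu Pu) (hR _ hau Ru).
have := qP u hu Pu hu0; rewrite ec -R'E; have /homogP[dq hdq] := hq.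
rewrite (ev_scale _ _ _ hdq) -ev_comp => /eqP.
by rewrite mulf_eq0 expf_eq0 (negPf c0) andbF (negPf qu).
Qed.

Lemma represents_vanish a P : a \in pts G -> represents a P ->
  forall A, A \is homog mdeg -> (A \mPo P \in vanish S) = (A \in vanish S).
Proof.
move=> ha hP A hA; have dP := represents_dominant ha hP.
have [_ [v1 hv1 Pv1] hPv] := hP.
apply/idP/idP => /vanishP h; apply/vanishP => v hv.
  rewrite -ev_map; apply: (dP _ 1) hv; first exact: homog_map.
  - by apply: (@homogE _ _ _ 0); apply: dhomog1.
  - by exists v1; rewrite // /ev rmorph1 oner_eq0.
  by move=> u hu _ _; rewrite ev_map -ev_comp h.
rewrite ev_comp; have [->|Pv] := eqVneq (evmap iota P v) 0.
  by rewrite -(scale0r v); apply/eqP/ev_scale_eq0 => //; apply/eqP/h.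
have /eqmx_rV[c c0 ->] := hPv v hv Pv.
by apply/eqP/ev_scale_eq0 => //; apply/eqP/h/act_pts.
Qed.

Lemma represents_deg a P : represents a P -> exists d, forall i, tnth P i \is d.-homog.
Proof. by case. Qed.

Definition rep_dmap a P (ha : a \in pts G) (hP : represents a P) : dmap S S :=
  DMap (represents_deg hP) (represents_vanish ha hP).

Variable g0 : 'rV[k]_(qp_N G).
Hypothesis hg0 : map_mx iota g0 \in pts G.
Local Notation g := (map_mx iota g0).

Lemma ev_map_mx n (p : {mpoly k[n]}) (v : 'rV[k]_n) :
  ev iota p (map_mx iota v) = iota (p.@[fun i => v 0 i]).
Proof.
have := @mpoly_rmorph_ext k K n (mmap iota (fun i => map_mx iota v 0 i)) (iota \o meval (fun i => v 0 i)).
by apply=> [c|i] /=; rewrite ?mmapC ?mevalC // mmapX mmap1U mevalXU mxE.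
Qed.

(** Multiplication is given near the point by forms over [k], whose values at vectors over [k] are
    again over [k]. The hypothesis sits inside the existential so that [choice] yields a total
    function. *)
Lemma power_step (a : 'rV[k]_(qp_N G)) : exists b : 'rV[k]_(qp_N G), map_mx iota a \in pts G ->
  map_mx iota b \in pts G /\ (map_mx iota b == ag_mul (map_mx iota a) g)%MS.
Proof.
have [ha|ha] := pselect (map_mx iota a \in pts G); last by exists 0.
have hu : segre (map_mx iota a) g \in pts (prodv G G).
  by apply/prod_pts; exists (map_mx iota a), g.
have [hm [R [_ Ru hR]]] := @ag_prod_morph _ _ _ G _ hu.
pose u := mxvec (a^T *m g0).
have uE : segre (map_mx iota a) g = map_mx iota u.
  by rewrite /segre /u map_mxvec map_mxM map_trmx.
exists (\row_i (tnth R i).@[fun l => u 0 l]) => _.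
have -> : map_mx iota (\row_i (tnth R i).@[fun l => u 0 l]) = evmap iota R (segre (map_mx iota a) g).
  by apply/rowP => i; rewrite !mxE uE ev_map_mx.
have h := hR _ hu Ru; split; last exact: eqmx_rV_sym.
exact: eqmx_pts h hm.
Qed.

Lemma power_sequence : exists p : nat -> 'rV[k]_(qp_N G), forall n,
  [/\ map_mx iota (p n) \in pts G,
      forall x, x \in pts S -> (act (map_mx iota (p 0%N)) x == x)%MS
    & forall x, x \in pts S ->
        (act (map_mx iota (p n.+1)) x == act (map_mx iota (p n)) (act g x))%MS].
Proof.
have [f hf] := choice power_step; have [rho_morph rho1 rhoM] := hact.
pose p n := iter n f (ag_one G).
have hp n : map_mx iota (p n) \in pts G.
  by elim: n => [|n IH]; [exact: ag_unit_pts | case: (hf _ IH)].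
exists p => n; split=> // x hx.
apply: eqmx_rV_trans (rhoM _ _ _ (hp n) hg0 hx).
apply: act_eqmx => //; last by apply/andP.
by case: (hf _ (hp n)).
Qed.

Lemma finite_local_forms :
  exists s : seq ((qp_N S).-tuple {mpoly k[qp_N (prodv G S)]}),
    (forall R, R \in s -> (exists d, forall i, tnth R i \is d.-homog) /\
      forall w, w \in pts (prodv G S) -> evmap iota R w != 0 -> (rho w == evmap iota R w)%MS) /\
    forall w, w \in pts (prodv G S) -> exists2 R, R \in s & evmap iota R w != 0.
Proof.
have [rho_morph _ _] := hact.
pose valid (R : (qp_N S).-tuple {mpoly k[qp_N (prodv G S)]}) :=
  (exists d, forall i, tnth R i \is d.-homog) /\
  forall w, w \in pts (prodv G S) -> evmap iota R w != 0 -> (rho w == evmap iota R w)%MS.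
(* Quasi-compactness of G x S, from Hilbert's basis theorem. *)
have [s [hs hz]] := mpoly_finite_zeros
  (fun p => exists2 R, valid R & exists i, p = tnth R i).
have hR p : exists R, p \in s -> valid R /\ exists i, p = tnth R i.
  have [/hs[R vR hp]|] := boolP (p \in s); first by exists R.
  by exists [tuple 0 | i < qp_N S].
have [F hF] := choice hR; exists (map F s); split.
  by move=> _ /mapP[p ps ->]; case: (hF p ps).
move=> w hw; have [_ [R [dR Rw hRw]]] := rho_morph w hw.
apply: contrapT => nR; case/eqP: Rw; apply/rowP => i; rewrite mxE mxE.
apply: (hz K (mmap iota (fun i => w 0 i))); last first.
  by exists R; [split | exists i].
move=> p ps; have [vF [j pj]] := hF p ps.
apply: contrapT => /eqP pw; apply: nR; exists (F p); first exact: map_f.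
by apply/rV0Pn; exists j; rewrite mxE -pj.
Qed.

Definition slice_k n m (c : 'rV[k]_n) : (n * m).-tuple {mpoly k[m]} :=
  mxtuple (\matrix_(i, j) ((c 0 i)%:MP * 'X_j)).

Lemma evmap_slice_k n m (c : 'rV[k]_n) (x : 'rV[K]_m) :
  evmap iota (slice_k m c) x = segre (map_mx iota c) x.
Proof.
rewrite evmap_mxtuple segreE; congr mxvec; apply/matrixP => i j.
by rewrite !mxE evM evX /ev mmapC.
Qed.

Definition slice_form n m l (R : l.-tuple {mpoly k[n * m]}) (c : 'rV[k]_n) :
  l.-tuple {mpoly k[m]} := [tuple tnth R i \mPo slice_k m c | i < l].

Lemma evmap_slice_form n m l (R : l.-tuple {mpoly k[n * m]}) c (x : 'rV[K]_m) :
  evmap iota (slice_form R c) x = evmap iota R (segre (map_mx iota c) x).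
Proof. by apply/rowP => i; rewrite !mxE tnth_mktuple ev_comp evmap_slice_k. Qed.

Lemma slice_form_homog n m l (R : l.-tuple {mpoly k[n * m]}) c d :
  (forall i, tnth R i \is d.-homog) -> forall i, tnth (slice_form R c) i \is d.-homog.
Proof.
move=> hR i; rewrite tnth_mktuple -[d]muln1; apply: dhomog_comp => // j.
by apply: mxtuple_homog => r s; rewrite mxE mul_mpolyC rpredZ // dhomogX; apply/eqP/mdeg1.
Qed.

Hypothesis Smap : forall x, x \in pts S -> evmap iota (rds_map S) x != 0 ->
  (evmap iota (rds_map S) x == act g x)%MS.

Lemma rds_represents : represents g (rds_map S).
Proof.
have [hd [H [_ vH HP]]] := rds_rational S; split=> //.
have [v hv Hv] := notin_vanish_pt vH; exists v => //.
exact: pts_neq0 (HP v hv Hv).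
Qed.

Lemma represents_slice_exists (s : seq ((qp_N S).-tuple {mpoly k[qp_N (prodv G S)]})) c :
  (forall R, R \in s -> (exists d, forall i, tnth R i \is d.-homog) /\
      forall w, w \in pts (prodv G S) -> evmap iota R w != 0 -> (rho w == evmap iota R w)%MS) ->
  (forall w, w \in pts (prodv G S) -> exists2 R, R \in s & evmap iota R w != 0) ->
  map_mx iota c \in pts G -> exists2 R, R \in s & represents (map_mx iota c) (slice_form R c).
Proof.
move=> hs cov hc; have [[v hv] _] := S_geom.
have cv x : x \in pts S -> segre (map_mx iota c) x \in pts (prodv G S).
  by move=> hx; apply/prod_pts; exists (map_mx iota c), x.
have [R Rs Rv] := cov _ (cv v hv); have [[d hd] hR] := hs R Rs.
exists R => //; split.
- by exists d; apply: slice_form_homog.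
- by exists v => //; rewrite evmap_slice_form.
move=> x hx; rewrite evmap_slice_form => Rx.
by apply: eqmx_rV_sym; apply: hR => //; apply: cv.
Qed.

Lemma represents_coord a P : represents a P -> exists j, tnth P j \notin vanish S.
Proof.
move=> [_ [v hv /rV0Pn[j Pj]] _]; exists j; apply: (notin_vanishI hv).
by move: Pj; rewrite mxE.
Qed.

(** The tuple [P] is arbitrary, so at each n a convenient local form may be used. In the induction
    step, phi followed by a tuple for g^n agrees with [P] on a dense open set, since g^(n+1) x = g^n
    (g x). *)
Lemma iter_endo (p : nat -> 'rV[k]_(qp_N G)) :
  (forall n, [/\ map_mx iota (p n) \in pts G,
      forall x, x \in pts S -> (act (map_mx iota (p 0%N)) x == x)%MS
    & forall x, x \in pts S ->
        (act (map_mx iota (p n.+1)) x == act (map_mx iota (p n)) (act g x))%MS]) ->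
  forall n P (hP : represents (map_mx iota (p n)) P) (hp : map_mx iota (p n) \in pts G) f,
    iter n (@rds_endo _ _ _ S) f = pb (rep_dmap hp hP) f.
Proof.
move=> hp_ n; elim: n => [|n IH] P hP hp f.
  have [d A B hA hB vB e] := reprP f; apply: ffv_inj; rewrite (pbE _ hA hB vB e) /= e.
  have [j vj] := represents_coord hP; have [_ _ hPv] := hP.
  rewrite -{1}(comp_mpoly_id A) -{1}(comp_mpoly_id B).
  have idE v : evmap iota [tuple 'X_i | i < qp_N S] v = v.
    by apply/rowP => i; rewrite mxE tnth_mktuple evX.
  apply: (@comp_ratio_eq _ _ _ S S _ _ _ d A B vj) => //.
  - move=> v hv Pj; rewrite idE.
    have Pv : evmap iota P v != 0 by apply/rV0Pn; exists j; rewrite mxE.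
    apply: eqmx_rV_sym; apply: eqmx_rV_trans (hPv v hv Pv) _.
    by have [_ h0 _] := hp_ 0%N; apply: h0.
  - by rewrite comp_mpoly_id.
  - exact: (dm_notin (rep_dmap hp hP) hB vB).
have [s [hs cov]] := finite_local_forms.
have [hpn _ hstep] := hp_ n.
have [R Rs hQ] := represents_slice_exists hs cov hpn.
rewrite iterS (IH _ hQ hpn) /rds_endo -pb_dcomp.
have [i vi] := represents_coord hQ; have [j vj] := represents_coord hP.
have [_ [HS [_ vHS HSP]]] := rds_rational S.
have [d hd] := represents_deg hQ.
set Q := slice_form R (p n) in hQ vi hd *.
have vH : HS * ((tnth Q i \mPo rds_map S) * tnth P j) \notin vanish S.
  by do 2?[apply: notin_vanishM => //]; apply: (dm_notin (rds_dmap S) (hd i) vi).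
apply: (pb_eq vH) => u hu; rewrite !evM ev_comp !mulf_eq0 !negb_or => /and3P[Hu Qi Pj].
have Pu := HSP u hu Hu; have Pu0 := pts_neq0 Pu.
rewrite evmap_dcomp /=.
have [_ _ hQv] := hQ; have [_ _ hPv] := hP.
have Qu : evmap iota Q (evmap iota (rds_map S) u) != 0.
  by apply/rV0Pn; exists i; rewrite mxE.
have Pu' : evmap iota P u != 0 by apply/rV0Pn; exists j; rewrite mxE.
apply: eqmx_rV_trans (hQv _ Pu Qu) _.
apply: eqmx_rV_trans (eqmx_rV_sym (hPv _ hu Pu')).
apply: eqmx_rV_trans (eqmx_rV_sym (hstep u hu)).
by apply: act_eqmx => //; [apply/andP | apply: Smap].
Qed.

(** The n-th iterate of X_i / X_a is R_i(g^n, x) / R_a(g^n, x) for one of finitely many local forms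
    [R]. Numerator and denominator are polynomials in the coordinates of g^n with coefficients in
    k(S), hence values at g^n of elements of k(S)(X_1, ..., X_N) that do not depend on n. *)
Lemma translational_nice : exists gamma : nat -> 'I_(qp_N G) -> k, nice_rds S gamma.
Proof.
have [p hp] := power_sequence; exists (fun n i => p n 0 i).
have [a va] := coord_var_exists S; have [s [hs cov]] := finite_local_forms.
pose F := nice_sf (@rds_endo _ _ _ S) (fun n => cst S \o (fun i => p n 0 i)).
move=> f; refine (@gen_min _ _ F _ f (@acoord_gen _ _ _ _ _ va f)) => {f} x [[c ->]|/mapP[i _ ->]].
  by apply: nice_fixed; rewrite /= /rds_endo pb_cst.
pose Fr := {mpoly (ff S)[qp_N G]}.
(* In the t-th coordinate of [R], the Segre variable of index (r, t') is replaced by X_r times the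
   affine coordinate of index t'; the free variables X_r stand for the coordinates of the group
   element. *)
have [num numE] : exists num : (qp_N S).-tuple {mpoly k[qp_N (prodv G S)]} -> 'I_(qp_N S) -> Fr,
    forall R n t, (num R t).@[cst S \o (fun i => p n 0 i)] =
      mmap (cst S) (acoord va) (tnth (slice_form R (p n)) t).
  pose j : {rmorphism k -> Fr} := @mpolyC (qp_N G) (ff S) \o cst S.
  pose z (l : 'I_(qp_N G * qp_N S)) : Fr :=
    mxvec (\matrix_(r, t) ('X_r * (acoord va t)%:MP)) 0 l.
  exists (fun R t => mmap j z (tnth R t)) => R n t.
  rewrite tnth_mktuple; move: (tnth R t) => q.
  have := @mpoly_rmorph_ext k (ff S) (qp_N (prodv G S))
    (meval (cst S \o (fun i => p n 0 i)) \o mmap j z)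
    (mmap (cst S) (acoord va) \o comp_mpoly (slice_k (qp_N S) (p n))).
  apply=> [c|l] /=; first by rewrite comp_mpolyC !mmapC /= mevalC.
  rewrite comp_mpolyXi mmapX mmap1U; case/mxvec_indexP: l => r t'.
  by rewrite tnth_mxtuple /z mxvecE !mxE mevalM mevalC mevalXU mmapM mmapC mmapX mmap1U.
exists [seq tofrac (num R i) / tofrac (num R a) | R <- s] => n.
have [hpn _ _] := hp n.
have [R Rs hR] := represents_slice_exists hs cov hpn.
exists (tofrac (num R i) / tofrac (num R a)); first by apply/mapP; exists R.
have [d hd] := represents_deg hR.
have xh (l : 'I_(qp_N S)) : ('X_l : {mpoly k[qp_N S]}) \is 1.-homog.
  by rewrite dhomogX; apply/eqP/mdeg1.
have va' := dm_notin (rep_dmap hpn hR) (xh a) va.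
have nva : tnth (slice_form R (p n)) a \notin vanish S by move: va'; rewrite comp_mpolyXi.
have fa0 : frac_of S 'X_a ^+ d != 0 by rewrite expf_neq0 // frac_of_neq0.
exists (num R i), (num R a); split; [|reflexivity|].
  rewrite numE -(fmorph_eq0 (@ffv _ _ _ S)) /= (ffv_mmap_coord va (hd a)).
  apply: mulf_neq0; first exact: frac_of_neq0.
  by rewrite invr_eq0.
rewrite (iter_endo hp hR hpn) 2!numE; apply: ffv_inj.
rewrite [RHS]fmorph_div /= (ffv_mmap_coord va (hd i)) (ffv_mmap_coord va (hd a)).
rewrite (pbE (rep_dmap hpn hR) (xh i) (xh a) va (ffv_coord va i)) !comp_mpolyXi.
by rewrite invf_div mulrA divfK.
Qed.

End Translations.

(** * Increments of the algebraic dimension *)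

Section Conclusion.
Variables (k : fieldType) (K : closedFieldType) (iota : {rmorphism k -> K}).

(** The set of increments is nonempty by the given product system and bounded by [qp_N S], so
    [natmax] does not fall back to 0. *)
Lemma sadim_is_max (S : rds iota) : (exists T : rds iota, inhabited (prod_rds S T)) ->
  is_max (fun s => exists (T : rds iota) (Z : prod_rds S T),
            s = (adim (rds_of_prod Z) - adim T)%N) (sadim S).
Proof.
move=> [T0 [Z0]]; set P := (P in is_max P _).
pose Pb n := `[< P n >].
have exP : exists n, Pb n.
  by exists (adim (rds_of_prod Z0) - adim T0)%N; apply/asboolP; exists T0, Z0.
have ubP n : Pb n -> (n <= qp_N S)%N.
  move=> /asboolP[T [Z ->]]; rewrite leq_subLR.
  have [a va] := coord_var_exists S; have [b vb] := coord_var_exists T.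
  exact: adim_prod_bound va vb.
case: (ex_maxnP exP ubP) => m /asboolP Pm mx.
have hm : is_max P m by split=> // n Pn; apply: mx; apply/asboolP.
by rewrite /sadim (natmaxE hm).
Qed.

Lemma increments (S T : rds iota) (Z : prod_rds S T) :
  (adim (rds_of_prod Z) <= adim T + sadim S)%N.
Proof.
have [|_ mx] := @sadim_is_max S; first by exists T; split.
by rewrite -leq_subLR; apply: mx; exists T, Z.
Qed.

(** The m-th system is a product of m + 1 copies of S, starting from S itself. Each new factor adds
    dim S independent functions but at most sadim S to the algebraic dimension. *)
Lemma power_systems (S : rds iota) N (gamma : nat -> 'I_N -> k) m :
  geom_irreducible S -> @geom_dominant _ _ _ S (rds_map S) -> nice_rds S gamma ->
  exists T : rds iota, [/\ geom_irreducible T, @geom_dominant _ _ _ T (rds_map T),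
    nice_rds T gamma, exists f : 'I_(m.+1 * dim_var S) -> ff T, aind (ksf T) f
    & (adim T <= adim S + m * sadim S)%N].
Proof.
move=> gS dS nS; have [[f [_ hf]] _] := dim_varP S.
have ex : exists f : 'I_(dim_var S) -> ff S, aind (ksf S) f by exists f.
elim: m => [|m [T [gT dT nT exT le]]].
  by exists S; split=> //; rewrite ?mul1n // mul0n addn0.
have [a va] := coord_var_exists S; have [b vb] := coord_var_exists T.
have [Z [gZ dZ]] := prod_rds_exists gS gT va vb dS dT.
exists (rds_of_prod Z); split=> //.
- exact: nice_rds_prod.
- by rewrite mulSn; apply: (dim_prod Z va vb exT ex).
apply: leq_trans (increments Z) _.
by rewrite mulSn [(_ + m * _)%N]addnC addnA leq_add2r.
Qed.

End Conclusion.

Theorem proposition3p1 (k : fieldType) (K : closedFieldType)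
    (iota : {rmorphism k -> K}) (S : rds iota)
    (S_geom_irr : geom_irreducible S) (S_transl : translational S) :
  (dim_var S <= sadim S)%N.
Proof.
have [G [rho [g0 [hact _ hg0 Smap]]]] := S_transl.
have [gamma nS] := translational_nice S_geom_irr hact hg0 Smap.
have dS := represents_dominant S_geom_irr hact hg0 (rds_represents Smap).
rewrite leqNgt; apply/negP => lt_sd.
(* With this m the bounds give (m + 1) dim S <= adim S + m sadim S + N_G = m + m sadim S, while dim
   S > sadim S makes the left side at least (m + 1)(sadim S + 1), which is larger. *)
pose m := (adim S + qp_N G)%N.
have [T [_ _ nT [f hf] le]] := power_systems m S_geom_irr dS nS.
have := leq_trans (nice_rds_bound nT hf) (leq_add le (leqnn (qp_N G))).
rewrite leqNgt => /negP; apply.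
apply: leq_trans (_ : m.+1 * (sadim S).+1 <= _)%N; last by rewrite leq_mul2l lt_sd orbT.
have -> : (adim S + m * sadim S + qp_N G = m + m * sadim S)%N by rewrite addnAC.
by rewrite mulSn mulnS addSn ltnS leq_addl.
Qed.
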